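(* Let $0<p,q<\infty$, $n$ a positive integer, $\mathbf{u}=(u_0,\dots,u_n)$ with $u_k\in H(\mathbb{D})$, and $\varphi$ an analytic self-map of $\mathbb{D}$. Then $L_{\mathbf{u},\varphi}^{(n)}:A^p\to A^q$ is bounded (respectively compact) if and only if $W_{u_k,\varphi}^{(k)}:A^p\to A^q$ is bounded (respectively compact) for each $k=0,1,\dots,n$.
   Context: $\mathbb{D}$ is the open unit disc, $H(\mathbb{D})$ the analytic functions on $\mathbb{D}$, $dA=\frac{dx\,dy}{\pi}$, and $A^p=\{f\in H(\mathbb{D}):\int_{\mathbb{D}}|f|^p\,dA<\infty\}$. For $u\in H(\mathbb{D})$ and integer $k\ge0$, the generalized weighted composition operator is $W_{u,\varphi}^{(k)}f=u\cdot(f^{(k)}\circ\varphi)$, and $L_{\mathbf{u},\varphi}^{(n)}=\sum_{k=0}^nW_{u_k,\varphi}^{(k)}$. *)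

(* Defs.v *)
From HB Require Import structures.
From mathcomp Require Import all_boot all_order all_algebra.
From mathcomp Require Import all_classical all_reals all_analysis.
From mathcomp Require Import complex.

Set Implicit Arguments.
Unset Strict Implicit.
Unset Printing Implicit Defensive.

Import Order.TTheory GRing.Theory Num.Theory.
Import numFieldNormedType.Exports.

Local Open Scope classical_set_scope.
Local Open Scope ring_scope.
Local Open Scope complex_scope.

Section Bergman.
Variable R : realType.

Local Notation C := (R[i])^o.

Definition cpt (xy : R * R) : C := (xy.1 +i* xy.2).

Definition disc : set C := [set z | ComplexField.Normc.normc z < 1].

(* f is analytic (complex differentiable) at every point of the open disc;
   [derivable f z 1] in the C-normed space C is complex differentiability. *)
Definition holo (f : C -> C) : Prop := forall z, disc z -> derivable f z 1.

(* The measure dA = dx dy / pi is realised as the product Lebesgue measure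
   on R * R with the factor 1/pi put inside the integrand. *)
Definition leb2 := ((@lebesgue_measure R) \x (@lebesgue_measure R))%E.

Definition pint (p : R) (f : C -> C) : \bar R :=
  (\int[leb2]_(xy in [set xy | disc (cpt xy)])
      ((ComplexField.Normc.normc (f (cpt xy))) `^ p / pi)%:E)%E.

Definition Ap (p : R) (f : C -> C) : Prop := holo f /\ (pint p f < +oo)%E.

Definition normA (p : R) (f : C -> C) : R := (fine (pint p f)) `^ (p^-1).

Definition bounded_op (p q : R) (T : (C -> C) -> (C -> C)) : Prop :=
  (forall f, Ap p f -> Ap q (T f)) /\
  exists c : R, forall f, Ap p f -> normA q (T f) <= c * normA p f.

Definition compact_op (p q : R) (T : (C -> C) -> (C -> C)) : Prop :=
  (forall f, Ap p f -> Ap q (T f)) /\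
  forall fs : nat -> (C -> C),
    (forall m, Ap p (fs m)) -> (exists M : R, forall m, normA p (fs m) <= M) ->
    exists (sigma : nat -> nat) (g : C -> C),
      {homo sigma : m k / (m < k)%N} /\ Ap q g /\
      (fun m => normA q (T (fs (sigma m)) \- g)) @ \oo --> (0 : R).

Definition Wop (u phi : C -> C) (k : nat) (f : C -> C) : C -> C :=
  fun z => u z * (derive1n k f) (phi z).

Definition Lop (n : nat) (us : 'I_n.+1 -> C -> C) (phi : C -> C)
  (f : C -> C) : C -> C :=
  fun z => \sum_(k < n.+1) Wop (us k) phi k f z.

End Bergman.

(* Main.v *)
(* Only the implication from L to the single operators W_l needs an idea.
   Write eta(z) = 1 - |z| and decompose the disc into Whitney squares E_k with
   centres a_k.  For f in A^p let c_k be a smoothed local size of f on E_k, and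
   consider, for signs e_k and large integers t, the functions
     F(z) = sum_(k < J) e_k c_k (eta(a_k) / (1 - conj(a_k) z))^t.
   Kernel estimates bound |F|^p and |F|^p eta^2 in mean by |f|^p and |f|^p eta^2,
   uniformly in the signs and in J, while Cauchy estimates bound eta(a_k)^l |f^(l)|
   by c_k on E_k.  Averaging |L F|^q over all signs isolates the k-th summand of F.
   The l-th derivative of the t-th power of a kernel is that power times the rising
   factorial t (t + 1) ... (t + l - 1) times a factor independent of t, of modulus
   comparable to eta(a_k)^(-l) on E_k, so that n + 1 consecutive values of t separate
   the orders l = 0, ..., n.  Hence |W_l f|^q is dominated in mean by |L F|^q for
   finitely many test functions F.
   Compactness goes the same way: T is compact exactly when T f is small in A^q
   for all f in the unit ball of A^p such that |f|^p eta^2 is small in mean. *)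
Require Import Defs.
From mathcomp Require Import all_boot all_order all_algebra.
From mathcomp Require Import all_classical all_reals all_analysis.
From mathcomp Require Import complex measurable_realfun ring lra.
Import Order.TTheory GRing.Theory Num.Theory.
Import numFieldNormedType.Exports.
Local Open Scope classical_set_scope.
Local Open Scope ring_scope.
Set Implicit Arguments.
Unset Strict Implicit.
Unset Printing Implicit Defensive.

(** The obstacle is that the terms of the sum may cancel, and that for q < p testing on one kernel
    at a time does not suffice. Signs settle both, for all p and q: where phi takes its value in E_k
    only the k-th summand of F is wanted, so the sign average need only be bounded below by a single
    term, and no square function inequality enters. The preimages of the squares under phi are
    disjoint, hence the pointwise bounds add up. The smoothing of c_k serves two opposite ends: c_k
    must dominate f near E_k, and must be summable in k against the integral of |f|^p, with weight 1
    and with weight eta^2. The kernel exponents leave room for both. The weight eta^2 is the growth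
    rate of A^p: |f|^p eta^2 is bounded on the unit ball, so dominated convergence makes locally
    uniform smallness visible in a single integral. Cauchy theory is done on rectangles, where the
    integral of 1/(z - w) is bounded below instead of evaluated. No constant depends on f, on the
    u_k or on phi, which permits the scaling arguments on the unit ball. *)

Local Notation nc := ComplexField.Normc.normc.

(** * Complex derivatives and contour integrals *)

Section ComplexNorm.
Variable R : realType.
Local Notation C := (R[i])^o.
Implicit Types (x y z : C).

Lemma normr_nc (x : R[i]) : `|x| = (nc x)%:C%C.
Proof. by []. Qed.

Lemma nc_ge0 x : 0 <= nc x.
Proof. by case: x => a b /=; exact: sqrtr_ge0. Qed.

Lemma nc_eq0 x : (nc x == 0) = (x == 0).
Proof.
apply/eqP/eqP => [/ComplexField.Normc.eq0_normc//|->].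
exact: ComplexField.Normc.normc0.
Qed.

Lemma nc0 : nc (0 : C) = 0. Proof. exact: ComplexField.Normc.normc0. Qed.
Lemma nc1 : nc (1 : C) = 1. Proof. exact: ComplexField.Normc.normc1. Qed.

Lemma nc_gt0 x : (0 < nc x) = (x != 0).
Proof. by rewrite lt_def nc_ge0 andbT nc_eq0. Qed.

Lemma ncM x y : nc (x * y) = nc x * nc y.
Proof. exact: ComplexField.Normc.normcM. Qed.

Lemma ncV x : nc (x^-1) = (nc x)^-1.
Proof. exact: ComplexField.Normc.normcV. Qed.

Lemma ncX x n : nc (x ^+ n) = nc x ^+ n.
Proof. by elim: n => [|n IH]; rewrite ?expr0 ?nc1// !exprS ncM IH. Qed.

Lemma ncD x y : nc (x + y) <= nc x + nc y.
Proof. by rewrite -lecR rmorphD/=; exact: (@ler_normD _ R[i]). Qed.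

Lemma ncN x : nc (- x) = nc x.
Proof. by case: x => a b /=; rewrite !sqrrN. Qed.

Lemma ncB x y : nc (x - y) <= nc x + nc y.
Proof. by rewrite (le_trans (ncD _ _))// ncN. Qed.

Lemma ncBC x y : nc (x - y) = nc (y - x).
Proof. by rewrite -ncN opprB. Qed.

Lemma nc_lowerB x y : nc x - nc y <= nc (x - y).
Proof. by rewrite lerBlDr (le_trans _ (ncD _ _))// subrK. Qed.

Lemma nc_sum (I : Type) (r : seq I) (P : pred I) (F : I -> C) :
  nc (\sum_(i <- r | P i) F i) <= \sum_(i <- r | P i) nc (F i).
Proof.
elim/big_rec2: _ => [|i x y _ H]; first by rewrite nc0.
by rewrite (le_trans (ncD _ _))// lerD2l.
Qed.

Lemma nc_Re x : `|complex.Re x| <= nc x.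
Proof.
case: x => a b /=; rewrite -sqrtr_sqr ler_wsqrtr// lerDl; exact: sqr_ge0.
Qed.

Lemma nc_Im x : `|complex.Im x| <= nc x.
Proof.
case: x => a b /=; rewrite -sqrtr_sqr ler_wsqrtr// lerDr; exact: sqr_ge0.
Qed.

Lemma nc_sqr x : nc x ^+ 2 = complex.Re x ^+ 2 + complex.Im x ^+ 2.
Proof. by case: x => a b /=; rewrite sqr_sqrtr// addr_ge0// sqr_ge0. Qed.

Lemma nc_le_ReIm x : nc x <= `|complex.Re x| + `|complex.Im x|.
Proof.
rewrite -(@ler_pXn2r _ 2)// ?nnegrE ?nc_ge0 ?addr_ge0//.
rewrite nc_sqr sqrrD !real_normK ?num_real// lerD2r lerDl.
by rewrite mulrn_wge0// mulr_ge0.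
Qed.

Lemma nc_real (a : R) : nc (a%:C%C : C) = `|a|.
Proof. by rewrite /= expr0n addr0 sqrtr_sqr. Qed.

Lemma nc_nat n : nc (n%:R : C) = n%:R.
Proof. by rewrite -[n%:R in LHS](rmorph_nat (real_complex R)) nc_real normr_nat. Qed.

Lemma nc_conj (x : C) : nc (x^*%C : C) = nc x.
Proof. by case: x => a b /=; rewrite sqrrN. Qed.

End ComplexNorm.

(** * Complex differentiability and continuity in epsilon-delta form *)

Section ComplexDerivative.
Variable R : realType.
Local Notation C := (R[i])^o.
Implicit Types (f g : C -> C) (z d : C).

(** Free of division and with a real modulus, so that every estimate takes place in [R]; [cdiffP]
    shows it to be [is_derive]. *)
Definition cdiff f z d := forall e : R, 0 < e -> exists2 r : R, 0 < r &
  forall h : C, nc h < r -> nc (f (z + h) - f z - d * h) <= e * nc h.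

Definition ccont f z := forall e : R, 0 < e -> exists2 r : R, 0 < r &
  forall h : C, nc h < r -> nc (f (z + h) - f z) <= e.

Lemma cdiffP f z d : cdiff f z d <-> is_derive z 1 f d.
Proof.
have key : cdiff f z d <->
    ((fun h : C => h^-1 *: ((f \o shift z) (h *: (1:C)) - f z)) @ 0^' --> d).
  split.
  - move=> H; apply/cvgrPdist_le => -[e ei] e0.
    (* A positive element of [R[i]] has imaginary part 0, since the order compares only numbers with
       equal imaginary parts; the tolerance is therefore real. *)
    have [e0' ei0] : 0 < e /\ ei = 0.
      by move: e0; rewrite ltcE/= => /andP[/eqP -> ->].
    rewrite {}ei0 in e0 *; have [r r0 Hr] := H e e0'.
    near=> h.
    have h0 : h != 0 by near: h; exact: nbhs_dnbhs_neq.
    have hr : nc h < r.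
      have : `|h| < r%:C%C.
        near: h; apply: dnbhs0_lt; by rewrite ltcR.
      by rewrite normr_nc ltcR.
    rewrite normr_nc lecR.
    have -> : d - h^-1 *: ((f \o shift z) (h *: (1:C)) - f z) =
        - (h^-1 * (f (z + h) - f z - d * h)).
      rewrite /= /shift /= /GRing.scale /= mulr1 [h + z]addrC; field; exact: h0.
    rewrite ncN ncM ncV mulrC ler_pdivrMr ?nc_gt0//; exact: Hr.
  - move/cvgrPdist_le => H e e0.
    have e0' : 0 < (e%:C)%C by rewrite ltcR.
    have := H _ e0'; rewrite /dnbhs/= => /nbhs_normP [] [r ri] /= r0 Hr.
    have [r0' ri0] : 0 < r /\ ri = 0.
      by move: r0; rewrite ltcE/= => /andP[/eqP -> ->].
    exists r => // h hr; have [->|h0] := eqVneq h 0.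
      by rewrite addr0 subrr mulr0 subrr nc0 mulr0.
    have := Hr h; rewrite /ball_/= sub0r normrN normr_nc ri0 ltcR => /(_ hr h0).
    rewrite normr_nc lecR.
    have -> : d - h^-1 *: ((f \o shift z) (h *: (1:C)) - f z) =
        - (h^-1 * (f (z + h) - f z - d * h)).
      rewrite /= /shift /= /GRing.scale /= mulr1 [h + z]addrC; field; exact: h0.
    by rewrite ncN ncM ncV mulrC ler_pdivrMr ?nc_gt0.
rewrite key; split => [H|[H <-]]; last exact: H.
split; first by apply/cvg_ex; exists d.
exact/cvg_lim.
Unshelve. all: by end_near.
Qed.

Lemma cdiff_derive1 {f z d} : cdiff f z d -> derive1 f z = d.
Proof. by move=> /cdiffP H; rewrite derive1E derive_val. Qed.

Lemma cdiff_derivable f z d : cdiff f z d -> derivable f z 1.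
Proof. by move=> /cdiffP []. Qed.

Lemma derivable_cdiff f z : derivable f z 1 -> cdiff f z (derive1 f z).
Proof. by move=> H; apply/cdiffP; rewrite derive1E; exact/derivableP. Qed.

Lemma cdiff_cont f z d : cdiff f z d -> ccont f z.
Proof.
move=> H e e0; have [r r0 Hr] := H 1 ltr01.
have k0 : 0 < 1 + nc d by rewrite ltr_pwDl// nc_ge0.
exists (Num.min r (e / (1 + nc d))); first by rewrite lt_min r0 divr_gt0.
move=> h; rewrite lt_min ltr_pdivlMr// => /andP[hr he].
have -> : f (z + h) - f z = (f (z + h) - f z - d * h) + d * h by rewrite subrK.
rewrite (le_trans (ncD _ _))// ncM (le_trans _ (ltW he))// mulrDr mulr1 [nc h * _]mulrC lerD2r.
by rewrite -[leRHS]mul1r Hr.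
Qed.

Lemma cdiff_cst (c : C) z : cdiff (fun=> c) z 0.
Proof. by move=> e e0; exists 1 => // h _; rewrite mul0r !subrr nc0 mulr_ge0 ?nc_ge0 ?ltW. Qed.

Lemma cdiff_id z : cdiff id z 1.
Proof. by move=> e e0; exists 1 => // h _; rewrite mul1r [z + h]addrC addrK subrr nc0 mulr_ge0
  ?nc_ge0 ?ltW. Qed.

Lemma cdiffD f g z d d' : cdiff f z d -> cdiff g z d' -> cdiff (fun w => f w + g w) z (d + d').
Proof. by move=> /cdiffP H /cdiffP H'; apply/cdiffP; exact: is_deriveD. Qed.

Lemma cdiffM f g z d d' : cdiff f z d -> cdiff g z d' ->
  cdiff (fun w => f w * g w) z (f z * d' + g z * d).
Proof. by move=> /cdiffP H /cdiffP H'; apply/cdiffP; exact: is_deriveM. Qed.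

Lemma cdiffZ (c : C) f z d : cdiff f z d -> cdiff (fun w => c * f w) z (c * d).
Proof.
move=> H; have := cdiffM (cdiff_cst c z) H; by rewrite mulr0 addr0.
Qed.

Lemma cdiffN f z d : cdiff f z d -> cdiff (fun w => - f w) z (- d).
Proof. by move=> /cdiffP H; apply/cdiffP; exact: is_deriveN. Qed.

Lemma cdiffB f g z d d' : cdiff f z d -> cdiff g z d' -> cdiff (fun w => f w - g w) z (d - d').
Proof. by move=> H H'; apply: cdiffD => //; exact: cdiffN. Qed.

Lemma cdiffV f z d : f z != 0 -> cdiff f z d -> cdiff (fun w => (f w)^-1) z (- (f z) ^- 2 * d).
Proof. move=> fz /cdiffP [H1 H2]; apply/cdiffP; split; first exact: derivableV.
by rewrite deriveV// H2. Qed.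

Lemma cdiff_comp f g z d d' : cdiff g z d -> cdiff f (g z) d' ->
  cdiff (fun w => f (g w)) z (d' * d).
Proof.
move=> Hg Hf e e0.
have k0 : 0 < 1 + nc d by rewrite ltr_pwDl// nc_ge0.
have l0 : 0 < 1 + nc d' by rewrite ltr_pwDl// nc_ge0.
(* Half of [e] pays for the error of [f] on an increment of size at most [(1 + nc d) * nc h], the
   other half for [d'] times the error of [g]. *)
have [r r0 Hr] := Hf _ (divr_gt0 (divr_gt0 e0 k0) (ltr0n _ 2)).
have [s s0 Hs] := Hg _ ltr01.
have [s' s'0 Hs'] := Hg _ (divr_gt0 (divr_gt0 e0 l0) (ltr0n _ 2)).
exists (Num.min (Num.min s s') (r / (1 + nc d))).
  by rewrite !lt_min s0 s'0 divr_gt0.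
move=> h; rewrite !lt_min ltr_pdivlMr// => /andP[/andP[hs hs'] hr].
set k := g (z + h) - g z.
have kE : g (z + h) = g z + k by rewrite /k subrKC.
have kh : nc k <= nc h * (1 + nc d).
  have -> : k = (k - d * h) + d * h by rewrite subrK.
  rewrite (le_trans (ncD _ _))// ncM mulrDr mulr1 [nc h * _]mulrC lerD2r.
  by rewrite -[leRHS]mul1r Hs.
have := Hr k (le_lt_trans kh hr); rewrite -kE => H1.
have := Hs' h hs'; rewrite -/k => H2.
have -> : f (g (z + h)) - f (g z) - d' * d * h =
   (f (g (z + h)) - f (g z) - d' * k) + d' * (k - d * h) by ring.
rewrite (le_trans (ncD _ _))// ncM.
have H3 : nc d' * nc (k - d * h) <= e / 2 * nc h.
  apply: le_trans (_ : (1 + nc d') * (e / (1 + nc d') / 2 * nc h) <= _).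
    by rewrite ler_pM ?nc_ge0// lerDr.
  rewrite le_eqVlt; apply/orP; left; apply/eqP; field; exact: lt0r_neq0.
have H4 : e / (1 + nc d) / 2 * nc k <= e / 2 * nc h.
  apply: le_trans (_ : e / (1 + nc d) / 2 * (nc h * (1 + nc d)) <= _).
    by rewrite ler_wpM2l// !divr_ge0 // ltW.
  rewrite le_eqVlt; apply/orP; left; apply/eqP; field; exact: lt0r_neq0.
rewrite (le_trans (lerD H1 (le_refl _)))// (le_trans (lerD H4 H3))//.
by rewrite -mulrDl -splitr.
Qed.

Lemma cdiff_near f g z d (s : R) : 0 < s -> (forall w, nc (w - z) < s -> f w = g w) ->
  cdiff f z d -> cdiff g z d.
Proof.
move=> s0 E H e e0; have [r r0 Hr] := H e e0.
exists (Num.min r s); first by rewrite lt_min r0.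
move=> h; rewrite lt_min => /andP[hr hs].
rewrite -!E ?Hr// ?subrr ?nc0//; by rewrite addrC addKr.
Qed.

Lemma ccont_cst (c : C) z : ccont (fun=> c) z.
Proof. by move=> e e0; exists 1 => // h _; rewrite subrr nc0 ltW. Qed.

Lemma ccont_id z : ccont id z.
Proof. by move=> e e0; exists e => // h he; rewrite [z + h]addrC addrK ltW. Qed.

Lemma ccontD f g z : ccont f z -> ccont g z -> ccont (fun w => f w + g w) z.
Proof.
move=> F G e e0; have e2 : 0 < e / 2 by rewrite divr_gt0.
have [r r0 Hr] := F _ e2; have [s s0 Hs] := G _ e2.
exists (Num.min r s); first by rewrite lt_min r0.
move=> h; rewrite lt_min => /andP[hr hs]; rewrite opprD addrACA.
by rewrite (le_trans (ncD _ _))// (splitr e) lerD// (Hr, Hs).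
Qed.

Lemma ccontM f g z : ccont f z -> ccont g z -> ccont (fun w => f w * g w) z.
Proof.
move=> F G e e0; pose k : R := 1 + nc (f z) + nc (g z).
have k0 : 0 < k by rewrite /k -addrA ltr_pwDl// addr_ge0 ?nc_ge0.
(* The cap 1 bounds the product of the two increments by [e']; the three terms then add up to
   [e' * k]. *)
pose e' := Num.min 1 (e / k).
have e'0 : 0 < e' by rewrite lt_min ltr01 divr_gt0.
have [r r0 Hr] := F _ e'0; have [s s0 Hs] := G _ e'0.
exists (Num.min r s); first by rewrite lt_min r0.
move=> h; rewrite lt_min => /andP[/Hr hr /Hs hs].
set A := f (z + h) in hr *; set B := g (z + h) in hs *.
have -> : A * B - f z * g z = (A - f z) * (B - g z) + f z * (B - g z) + g z * (A - f z).
  by ring.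
have e'1 : e' <= 1 by rewrite ge_min lexx.
have e'k : e' * k <= e by rewrite -ler_pdivlMr// ge_min lexx orbT.
apply: le_trans e'k; rewrite (le_trans (ncD _ _))//.
rewrite (le_trans (lerD (ncD _ _) (lexx _)))// !ncM /k !mulrDr mulr1.
rewrite !lerD//.
- by rewrite -[leRHS]mulr1 ler_pM ?nc_ge0// (le_trans hs).
- by rewrite mulrC ler_wpM2r// nc_ge0.
- by rewrite mulrC ler_wpM2r// nc_ge0.
Qed.

Lemma ccontN f z : ccont f z -> ccont (fun w => - f w) z.
Proof.
by move=> F e e0; have [r r0 Hr] := F _ e0; exists r => // h /Hr; rewrite -opprD ncN.
Qed.

Lemma ccontB f g z : ccont f z -> ccont g z -> ccont (fun w => f w - g w) z.
Proof. by move=> F G; apply: ccontD => //; exact: ccontN. Qed.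

Lemma ccontV f z : f z != 0 -> ccont f z -> ccont (fun w => (f w)^-1) z.
Proof.
move=> fz F e e0; have n0 : 0 < nc (f z) by rewrite nc_gt0.
pose e' := Num.min (nc (f z) / 2) (e * nc (f z) ^+ 2 / 2).
have e'0 : 0 < e' by rewrite lt_min !divr_gt0// mulr_gt0// exprn_gt0.
have [r r0 Hr] := F _ e'0; exists r => // h /Hr.
set A := f (z + h); rewrite /e' le_min => /andP[h1 h2].
have hA : nc (f z) / 2 <= nc A.
  have := nc_lowerB (f z) A; rewrite ncBC => H.
  by rewrite {1}[nc (f z)]splitr in H; lra.
have A0 : A != 0 by rewrite -nc_gt0; apply: lt_le_trans hA; rewrite divr_gt0.
have -> : A^-1 - (f z)^-1 = - (A - f z) * (A^-1 * (f z)^-1).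
  by field; apply/andP; split.
rewrite ncM ncN ncM !ncV -invfM ler_pdivrMr ?mulr_gt0 ?nc_gt0//.
rewrite (le_trans h2)// -mulrA (ler_wpM2l (ltW e0))//.
have -> : nc (f z) ^+ 2 / 2 = nc (f z) / 2 * nc (f z) by ring.
by rewrite ler_pM2r.
Qed.

End ComplexDerivative.

(** * Integrals of complex-valued functions over real segments *)

Section SegmentIntegral.
Variable R : realType.
Local Notation C := (R[i])^o.
Local Notation mu := (@lebesgue_measure R).

Definition rcont (g : R -> C) (x : R) := forall e : R, 0 < e -> exists2 r : R, 0 < r &
  forall h : R, `|h| < r -> nc (g (x + h) - g x) <= e.

Definition cint (g : R -> C) (a b : R) :=
  mu.-integrable `[a, b] (EFin \o (fun x => complex.Re (g x))) /\
  mu.-integrable `[a, b] (EFin \o (fun x => complex.Im (g x))).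

Definition CI (g : R -> C) (a b : R) : C :=
  ((\int[mu]_(x in `[a, b]) complex.Re (g x)) +i*
   (\int[mu]_(x in `[a, b]) complex.Im (g x)))%C.

Lemma ReD (x y : C) : complex.Re (x + y) = complex.Re x + complex.Re y.
Proof. by case: x; case: y. Qed.
Lemma ImD (x y : C) : complex.Im (x + y) = complex.Im x + complex.Im y.
Proof. by case: x; case: y. Qed.
Lemma ReN (x : C) : complex.Re (- x) = - complex.Re x.
Proof. by case: x. Qed.
Lemma ImN (x : C) : complex.Im (- x) = - complex.Im x.
Proof. by case: x. Qed.
Lemma ReM (x y : C) : complex.Re (x * y) =
  complex.Re x * complex.Re y - complex.Im x * complex.Im y.
Proof. by case: x; case: y. Qed.
Lemma ImM (x y : C) : complex.Im (x * y) =
  complex.Re x * complex.Im y + complex.Im x * complex.Re y.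
Proof. by case: x; case: y. Qed.
Lemma complex_eqP (x y : C) : complex.Re x = complex.Re y ->
  complex.Im x = complex.Im y -> x = y.
Proof. by case: x => a b; case: y => c d /= -> ->. Qed.

Let real_within (f : R -> R) (a b : R) :
  (forall x, a <= x <= b -> forall e : R, 0 < e -> exists2 r : R, 0 < r &
    forall h : R, `|h| < r -> `|f (x + h) - f x| <= e) ->
  mu.-integrable `[a, b] (EFin \o f).
Proof.
move=> H; apply: continuous_compact_integrable; first exact: segment_compact.
apply: continuous_in_subspaceT => x; rewrite inE/= in_itv/= => xab.
apply/(@cvgrPdist_le _ _ _ (nbhs x)) => e e0.
have [r r0 Hr] := H x xab e e0.
rewrite nearE; apply: (proj2 (@nbhs_normP _ R^o x _)); exists r => //= y; rewrite /ball_/= => xy.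
by have := Hr (y - x); rewrite subrKC distrC (distrC (f y)); exact.
Qed.

Lemma cint_cont g a b : (forall x, a <= x <= b -> rcont g x) -> cint g a b.
Proof.
move=> H; split; apply: real_within => x xab e e0;
  have [r r0 Hr] := H x xab e e0; exists r => // h /Hr.
- by apply: le_trans; rewrite -ReN -ReD nc_Re.
- by apply: le_trans; rewrite -ImN -ImD nc_Im.
Qed.

Lemma cint_ext g g' a b : (forall x, a <= x <= b -> g x = g' x) ->
  cint g a b -> cint g' a b.
Proof.
move=> E [H1 H2]; split; [move: H1|move: H2]; apply: eq_integrable => //= x;
 by rewrite inE/= in_itv/= => /E ->.
Qed.

Lemma CI_ext g g' a b : (forall x, a <= x <= b -> g x = g' x) -> CI g a b = CI g' a b.
Proof.
by move=> E; congr Complex; apply: eq_Rintegral => x; rewrite inE/= in_itv/= => /E ->.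
Qed.

Lemma cintD g g' a b : cint g a b -> cint g' a b -> cint (fun x => g x + g' x) a b.
Proof.
move=> [H1 H2] [H3 H4]; split.
- rewrite (_ : EFin \o _ = (EFin \o (fun x => complex.Re (g x))) \+
    (EFin \o (fun x => complex.Re (g' x))))%E; first exact: integrableD.
  by apply/funext => x /=; rewrite ReD.
- rewrite (_ : EFin \o _ = (EFin \o (fun x => complex.Im (g x))) \+
    (EFin \o (fun x => complex.Im (g' x))))%E; first exact: integrableD.
  by apply/funext => x /=; rewrite ImD.
Qed.

Lemma CID g g' a b : cint g a b -> cint g' a b ->
  CI (fun x => g x + g' x) a b = CI g a b + CI g' a b.
Proof.
move=> [H1 H2] [H3 H4]; apply: complex_eqP => /=.
- by under eq_Rintegral do rewrite ReD; rewrite RintegralD.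
- by under eq_Rintegral do rewrite ImD; rewrite RintegralD.
Qed.

Let intZ (f : R -> R) (k : R) a b : mu.-integrable `[a, b] (EFin \o f) ->
  mu.-integrable `[a, b] (EFin \o (fun x => k * f x)).
Proof.
move=> H; rewrite (_ : EFin \o _ = fun x => k%:E * (EFin \o f) x)%E//.
exact: integrableZl.
Qed.

Let intB (f f' : R -> R) a b : mu.-integrable `[a, b] (EFin \o f) ->
  mu.-integrable `[a, b] (EFin \o f') ->
  mu.-integrable `[a, b] (EFin \o (fun x => f x - f' x)).
Proof.
move=> H H'; rewrite (_ : EFin \o _ = (EFin \o f) \- (EFin \o f'))%E//.
exact: integrableB.
Qed.

Let intD (f f' : R -> R) a b : mu.-integrable `[a, b] (EFin \o f) ->
  mu.-integrable `[a, b] (EFin \o f') ->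
  mu.-integrable `[a, b] (EFin \o (fun x => f x + f' x)).
Proof.
move=> H H'; rewrite (_ : EFin \o _ = (EFin \o f) \+ (EFin \o f'))%E//.
exact: integrableD.
Qed.

Lemma cintZ (k : C) g a b : cint g a b -> cint (fun x => k * g x) a b.
Proof.
move=> [H1 H2]; split.
- under [X in EFin \o X]funext do rewrite ReM; by apply: intB; exact: intZ.
- under [X in EFin \o X]funext do rewrite ImM; by apply: intD; exact: intZ.
Qed.

Lemma CIZ (k : C) g a b : cint g a b -> CI (fun x => k * g x) a b = k * CI g a b.
Proof.
move=> [H1 H2]; apply: complex_eqP; rewrite ?ReM ?ImM/=.
- under eq_Rintegral do rewrite ReM.
  by rewrite RintegralB//; [rewrite !RintegralZl|exact: intZ|exact: intZ].
- under eq_Rintegral do rewrite ImM.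
  by rewrite RintegralD//; [rewrite !RintegralZl|exact: intZ|exact: intZ].
Qed.

Lemma cintN g a b : cint g a b -> cint (fun x => - g x) a b.
Proof. by move=> /(cintZ (- 1)); apply: cint_ext => x _; rewrite mulN1r. Qed.

Lemma cintB g g' a b : cint g a b -> cint g' a b -> cint (fun x => g x - g' x) a b.
Proof. by move=> H H'; apply: cintD => //; exact: cintN. Qed.

Lemma CIB g g' a b : cint g a b -> cint g' a b ->
  CI (fun x => g x - g' x) a b = CI g a b - CI g' a b.
Proof.
move=> H H'; rewrite CID//; last exact: cintN.
congr (_ + _); rewrite -mulN1r -CIZ//; apply: CI_ext => x _; by rewrite mulN1r.
Qed.

Lemma CI_split g a m b : a <= m <= b -> cint g a b -> CI g a b = CI g a m + CI g m b.
Proof.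
move=> /andP[am mb] [H1 H2].
have K (f : R -> R) : mu.-integrable `[a, b] (EFin \o f) ->
  \int[mu]_(x in `[a, b]) f x = \int[mu]_(x in `[a, m]) f x + \int[mu]_(x in `[m, b]) f x.
  move=> H; have := @Rintegral_itvB R f (BLeft a) (BRight b) m H.
  rewrite !bnd_simp => /(_ am mb) /eqP; rewrite subr_eq => /eqP ->.
  rewrite addrC; congr (_ + _); apply: Rintegral_itv_obnd_cbnd.
  by apply: integrableS H => //; apply: subset_itv; rewrite bnd_simp.
by apply: complex_eqP; rewrite /= K.
Qed.

(** The factor 2 is the price of bounding the real and the imaginary part separately; it enters
    constants only and spares a rotation of the integrand. *)
Lemma CI_le g (phi : R -> R) a b : cint g a b -> mu.-integrable `[a, b] (EFin \o phi) ->
  (forall x, a <= x <= b -> nc (g x) <= phi x) ->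
  nc (CI g a b) <= 2 * \int[mu]_(x in `[a, b]) phi x.
Proof.
move=> [H1 H2] H3 le.
have K (f : R -> R) : mu.-integrable `[a, b] (EFin \o f) ->
    (forall x, a <= x <= b -> `|f x| <= phi x) ->
    `|\int[mu]_(x in `[a, b]) f x| <= \int[mu]_(x in `[a, b]) phi x.
  move=> Hf lef; apply: le_trans (le_normr_Rintegral _ Hf) _ => //.
  by apply: le_Rintegral => //; exact: (integrable_norm Hf).
apply: le_trans (nc_le_ReIm _) _; rewrite /= mulr_natl mulr2n lerD// K// => x /le.
- exact: le_trans (nc_Re _).
- exact: le_trans (nc_Im _).
Qed.

Lemma int_cst (k : R) a b : mu.-integrable `[a, b] (EFin \o (fun=> k)).
Proof.
apply: continuous_compact_integrable; first exact: segment_compact.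
by apply: continuous_subspaceT => x; exact: cvg_cst.
Qed.

Lemma Rint_cst (k : R) a b : a <= b -> \int[mu]_(_ in `[a, b]) k = k * (b - a).
Proof.
move=> ab; rewrite Rintegral_cst//= lebesgue_measure_itv/= lte_fin.
by move: ab; rewrite le_eqVlt => /predU1P[->|->]; rewrite ?ltxx ?subrr.
Qed.

Lemma CI_bound g (M : R) a b : a <= b -> cint g a b ->
  (forall x, a <= x <= b -> nc (g x) <= M) -> nc (CI g a b) <= 2 * (M * (b - a)).
Proof. by move=> ab H le; rewrite -Rint_cst//; apply: CI_le => //; exact: int_cst. Qed.

Lemma CI_cst (k : C) a b : a <= b -> CI (fun=> k) a b = k * ((b - a)%:C)%C.
Proof.
by move=> ab; apply: complex_eqP; rewrite ?ReM ?ImM/= Rint_cst// mulr0 ?subr0 ?add0r.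
Qed.

Lemma cint_cst (k : C) a b : cint (fun=> k) a b.
Proof. by split; exact: int_cst. Qed.

End SegmentIntegral.

(** * Contour integrals over boundaries of rectangles *)

Section RectangleIntegral.
Variable R : realType.
Local Notation C := (R[i])^o.
Local Notation pt x y := ((x +i* y)%C : C).
Implicit Types (f g : C -> C) (z w : C).

Definition inQ (a b c d : R) (z : C) : Prop :=
  a <= complex.Re z <= b /\ c <= complex.Im z <= d.

Definition bdQ (a b c d : R) (z : C) : Prop := inQ a b c d z /\
  [\/ complex.Re z = a, complex.Re z = b, complex.Im z = c | complex.Im z = d].

Definition RIok f (a b c d : R) := [/\ cint (fun x => f (pt x c)) a b,
  cint (fun x => f (pt x d)) a b,
  cint (fun y => f (pt b y)) c d & cint (fun y => f (pt a y)) c d].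

(** The counterclockwise contour integral, with opposite sides merged into one integral; the factor
    ['i] is dz/dy on the vertical sides. *)
Definition RI f (a b c d : R) : C :=
  CI (fun x => f (pt x c) - f (pt x d)) a b +
  'i%C * CI (fun y => f (pt b y) - f (pt a y)) c d.

Lemma nc_i : nc ('i%C : C) = 1.
Proof. by rewrite /= expr0n expr1n add0r sqrtr1. Qed.

Lemma nc_horizontal (x h y : R) : nc (pt (x + h) y - pt x y) = `|h|.
Proof.
have -> : pt (x + h) y - pt x y = (h%:C)%C by apply: complex_eqP => /=; ring.
exact: nc_real.
Qed.

Lemma nc_vertical (x h y : R) : nc (pt x (y + h) - pt x y) = `|h|.
Proof.
have -> : pt x (y + h) - pt x y = 'i%C * (h%:C)%C by apply: complex_eqP => /=; ring.
by rewrite ncM nc_i mul1r nc_real.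
Qed.

Lemma rcont_hor f x y : ccont f (pt x y) -> rcont (fun x => f (pt x y)) x.
Proof.
move=> F e e0; have [r r0 Hr] := F e e0; exists r => // h hr.
rewrite -[pt (x + h) y](subrKC (pt x y)); apply: Hr.
by rewrite nc_horizontal.
Qed.

Lemma rcont_ver f x y : ccont f (pt x y) -> rcont (fun y => f (pt x y)) y.
Proof.
move=> F e e0; have [r r0 Hr] := F e e0; exists r => // h hr.
rewrite -[pt x (y + h)](subrKC (pt x y)); apply: Hr.
by rewrite nc_vertical.
Qed.

Lemma RIok_cont f a b c d : a <= b -> c <= d ->
  (forall z, bdQ a b c d z -> ccont f z) -> RIok f a b c d.
Proof.
move=> ab cd H; split; apply: cint_cont => x xab.
- apply: rcont_hor; apply: H; split; last exact: Or43.
  by split => //=; rewrite lexx.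
- apply: rcont_hor; apply: H; split; last exact: Or44.
  by split => //=; rewrite lexx cd.
- apply: rcont_ver; apply: H; split; last exact: Or42.
  by split => //=; rewrite lexx ab.
- apply: rcont_ver; apply: H; split; last exact: Or41.
  by split => //=; rewrite lexx.
Qed.

Lemma bdQ_bottom a b c d x : c <= d -> a <= x <= b -> bdQ a b c d (pt x c).
Proof. by move=> cd xab; split; [split=> //=; rewrite lexx|exact: Or43]. Qed.
Lemma bdQ_top a b c d x : c <= d -> a <= x <= b -> bdQ a b c d (pt x d).
Proof. by move=> cd xab; split; [split=> //=; rewrite lexx cd|exact: Or44]. Qed.
Lemma bdQ_right a b c d y : a <= b -> c <= y <= d -> bdQ a b c d (pt b y).
Proof. by move=> cd xab; split; [split=> //=; rewrite lexx cd|exact: Or42]. Qed.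
Lemma bdQ_left a b c d y : a <= b -> c <= y <= d -> bdQ a b c d (pt a y).
Proof. by move=> cd xab; split; [split=> //=; rewrite lexx|exact: Or41]. Qed.

Lemma RI_ext f g a b c d : a <= b -> c <= d -> (forall z, bdQ a b c d z -> f z = g z) ->
  RI f a b c d = RI g a b c d.
Proof.
move=> ab cd E; congr (_ + _ * _); apply: CI_ext => x xab.
- by rewrite !E//; [exact: bdQ_top|exact: bdQ_bottom].
- by rewrite !E//; [exact: bdQ_left|exact: bdQ_right].
Qed.

Lemma RIokD f g a b c d : RIok f a b c d -> RIok g a b c d ->
  RIok (fun z => f z + g z) a b c d.
Proof. by move=> [H1 H2 H3 H4] [? ? ? ?]; split; exact: cintD. Qed.

Lemma RIokZ k f a b c d : RIok f a b c d -> RIok (fun z => k * f z) a b c d.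
Proof. by move=> [H1 H2 H3 H4]; split; exact: cintZ. Qed.

Lemma RID f g a b c d : RIok f a b c d -> RIok g a b c d ->
  RI (fun z => f z + g z) a b c d = RI f a b c d + RI g a b c d.
Proof.
move=> [H1 H2 H3 H4] [K1 K2 K3 K4]; rewrite /RI.
have -> : (fun x => f (pt x c) + g (pt x c) - (f (pt x d) + g (pt x d))) =
   (fun x => (f (pt x c) - f (pt x d)) + (g (pt x c) - g (pt x d))).
  by apply/funext => x; rewrite opprD addrACA.
have -> : (fun x => f (pt b x) + g (pt b x) - (f (pt a x) + g (pt a x))) =
   (fun x => (f (pt b x) - f (pt a x)) + (g (pt b x) - g (pt a x))).
  by apply/funext => x; rewrite opprD addrACA.
rewrite (CID (cintB H1 H2) (cintB K1 K2)) (CID (cintB H3 H4) (cintB K3 K4)).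
ring.
Qed.

Lemma RIZ k f a b c d : RIok f a b c d ->
  RI (fun z => k * f z) a b c d = k * RI f a b c d.
Proof.
move=> [H1 H2 H3 H4]; rewrite /RI.
have -> : (fun x => k * f (pt x c) - k * f (pt x d)) = (fun x => k * (f (pt x c) - f (pt x d))).
  by apply/funext => x; rewrite mulrBr.
have -> : (fun x => k * f (pt b x) - k * f (pt a x)) = (fun x => k * (f (pt b x) - f (pt a x))).
  by apply/funext => x; rewrite mulrBr.
rewrite (CIZ _ (cintB H1 H2)) (CIZ _ (cintB H3 H4)); ring.
Qed.

Lemma RIB f g a b c d : RIok f a b c d -> RIok g a b c d ->
  RI (fun z => f z - g z) a b c d = RI f a b c d - RI g a b c d.
Proof.
move=> F G; have -> : (fun z => f z - g z) = (fun z => f z + (- 1) * g z).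
  by apply/funext => z; rewrite mulN1r.
by rewrite (RID F (RIokZ _ G)) (RIZ _ G) mulN1r.
Qed.

Lemma RI_bound f (M : R) a b c d : a <= b -> c <= d -> RIok f a b c d ->
  (forall z, bdQ a b c d z -> nc (f z) <= M) ->
  nc (RI f a b c d) <= 4 * M * ((b - a) + (d - c)).
Proof.
move=> ab cd [H1 H2 H3 H4] B.
rewrite (le_trans (ncD _ _))// ncM nc_i mul1r.
have -> : 4 * M * (b - a + (d - c)) = 2 * ((M + M) * (b - a)) + 2 * ((M + M) * (d - c)).
  by ring.
apply: lerD; apply: CI_bound => //; try exact: cintB; move=> x xab.
- rewrite (le_trans (ncB _ _))// lerD// B//; [exact: bdQ_bottom|exact: bdQ_top].
- rewrite (le_trans (ncB _ _))// lerD// B//; [exact: bdQ_right|exact: bdQ_left].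
Qed.

Lemma RI_cst (k : C) a b c d : a <= b -> c <= d -> RI (fun=> k) a b c d = 0.
Proof.
by move=> ab cd; rewrite /RI subrr !CI_cst// !mul0r mulr0 addr0.
Qed.

Lemma RI_id a b c d : a <= b -> c <= d -> RI id a b c d = 0.
Proof.
move=> ab cd; rewrite /RI.
have -> : (fun x : R => id (pt x c) - id (pt x d)) = (fun=> pt 0 (c - d)).
  by apply/funext => x; apply: complex_eqP => /=; ring.
have -> : (fun y : R => id (pt b y) - id (pt a y)) = (fun=> pt (b - a) 0).
  by apply/funext => x; apply: complex_eqP => /=; ring.
by rewrite !CI_cst//; apply: complex_eqP => /=; ring.
Qed.

Lemma RIok_cst k a b c d : RIok (fun=> k) a b c d.
Proof. by split; exact: cint_cst. Qed.

Lemma RIok_id a b c d : a <= b -> c <= d -> RIok id a b c d.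
Proof. by move=> ab cd; apply: RIok_cont => // z _; exact: ccont_id. Qed.

Lemma RI_affine (k l : C) a b c d : a <= b -> c <= d ->
  RI (fun z => k + l * z) a b c d = 0.
Proof.
move=> ab cd; have I := RIok_id ab cd.
by rewrite (RID (RIok_cst k a b c d) (RIokZ l I)) (RIZ l I) RI_cst// RI_id// mulr0 addr0.
Qed.

Lemma RI_splitx f a m b c d : a <= m <= b -> RIok f a b c d ->
  cint (fun y => f (pt m y)) c d ->
  RI f a b c d = RI f a m c d + RI f m b c d.
Proof.
move=> amb [H1 H2 H3 H4] H5; rewrite /RI (CI_split amb (cintB H1 H2)).
have -> : CI (fun y => f (pt b y) - f (pt a y)) c d =
  CI (fun y => f (pt m y) - f (pt a y)) c d + CI (fun y => f (pt b y) - f (pt m y)) c d.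
  rewrite -(CID (cintB H5 H4) (cintB H3 H5)); apply: CI_ext => y _.
  by rewrite [RHS]addrC addrA subrK.
ring.
Qed.

Lemma RI_splity f a b c m d : c <= m <= d -> RIok f a b c d ->
  cint (fun x => f (pt x m)) a b ->
  RI f a b c d = RI f a b c m + RI f a b m d.
Proof.
move=> cmd [H1 H2 H3 H4] H5; rewrite /RI (CI_split cmd (cintB H3 H4)).
have -> : CI (fun x => f (pt x c) - f (pt x d)) a b =
  CI (fun x => f (pt x c) - f (pt x m)) a b + CI (fun x => f (pt x m) - f (pt x d)) a b.
  rewrite -(CID (cintB H1 H5) (cintB H5 H2)); apply: CI_ext => y _.
  by rewrite addrA subrK.
ring.
Qed.

Lemma inQ_sub a b c d a' b' c' d' z : a <= a' -> b' <= b -> c <= c' -> d' <= d ->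
  inQ a' b' c' d' z -> inQ a b c d z.
Proof.
move=> h1 h2 h3 h4 [/andP[h5 h6] /andP[h7 h8]].
by split; apply/andP; split; apply: le_trans; eassumption.
Qed.

Lemma cint_hor f a b c d a' b' y : (forall z, inQ a b c d z -> ccont f z) ->
  a <= a' -> b' <= b -> c <= y <= d -> cint (fun x => f (pt x y)) a' b'.
Proof.
move=> H aa bb cyd; apply: cint_cont => x /andP[h1 h2]; apply: rcont_hor; apply: H; split => //=.
by rewrite (le_trans aa)// (le_trans h2).
Qed.

Lemma cint_ver f a b c d c' d' x : (forall z, inQ a b c d z -> ccont f z) ->
  c <= c' -> d' <= d -> a <= x <= b -> cint (fun y => f (pt x y)) c' d'.
Proof.
move=> H aa bb cyd; apply: cint_cont => y /andP[h1 h2]; apply: rcont_ver; apply: H; split => //=.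
by rewrite (le_trans aa)// (le_trans h2).
Qed.

Lemma inQ_dist a b c d z w : inQ a b c d z -> inQ a b c d w ->
  nc (z - w) <= (b - a) + (d - c).
Proof.
move=> [/andP[h1 h2] /andP[h3 h4]] [/andP[k1 k2] /andP[k3 k4]].
apply: le_trans (nc_le_ReIm _) _; rewrite ReD ImD ReN ImN lerD// ler_norml.
  by apply/andP; split; lra.
by apply/andP; split; lra.
Qed.

End RectangleIntegral.

(** * Cauchy's theorem and its consequences *)

Section Goursat.
Variable R : realType.
Local Notation C := (R[i])^o.
Local Notation pt x y := ((x +i* y)%C : C).
Implicit Types (f g : C -> C) (z w : C).

Let rect := (R * R * R * R)%type.
Let ra (r : rect) := r.1.1.1.
Let rb (r : rect) := r.1.1.2.
Let rc (r : rect) := r.1.2.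
Let rd (r : rect) := r.2.
Let side (r : rect) := (rb r - ra r) + (rd r - rc r).
Let proper (r : rect) := ra r <= rb r /\ rc r <= rd r.
Let sub (r r' : rect) := [/\ ra r <= ra r', rb r' <= rb r, rc r <= rc r' & rd r' <= rd r].
Let I f (r : rect) := RI f (ra r) (rb r) (rc r) (rd r).

Let four_parts (x p q u v : R) : x <= p + q + (u + v) ->
  [\/ x <= 4 * p, x <= 4 * q, x <= 4 * u | x <= 4 * v].
Proof.
move=> H; have [|h1] := leP x (4 * p); first by move=> h; exact: Or41.
have [|h2] := leP x (4 * q); first by move=> h; exact: Or42.
have [|h3] := leP x (4 * u); first by move=> h; exact: Or43.
by apply: Or44; lra.
Qed.

(** Quadrisection: some quarter carries at least a fourth of the modulus. The nested quarters shrink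
    to a point near which [f] is affine up to [e' * nc (z - z0)]. Affine functions integrate to 0,
    and the error is of the order of the squared perimeter, which compensates the factor
    [4 ^+ n]. *)
Lemma goursat f a b c d : a <= b -> c <= d ->
  (forall z, inQ a b c d z -> exists l, cdiff f z l) -> RI f a b c d = 0.
Proof.
move=> ab cd H; pose Q : rect := (a, b, c, d).
have Hc z : inQ a b c d z -> ccont f z by move=> /H [l]; exact: cdiff_cont.
(* The conditions on [r] stand inside the existential, so that a choice function exists on all
   quadruples. *)
have step r : exists r', proper r -> sub Q r ->
   [/\ proper r', sub r r', side r' = side r / 2 & nc (I f r) <= 4 * nc (I f r')].
  have [pr|npr] := pselect (proper r); last by exists r => /npr.
  have [sr|nsr] := pselect (sub Q r); last by exists r => _ /nsr.
  case: r => [[[x1 x2] y1] y2] in pr sr *.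
  have [x12 y12] : x1 <= x2 /\ y1 <= y2 := pr.
  have [s1 s2 s3 s4] : [/\ a <= x1, x2 <= b, c <= y1 & y2 <= d] := sr.
  pose m := (x1 + x2) / 2; pose k := (y1 + y2) / 2.
  have mE : m - x1 = x2 - m by rewrite /m; lra.
  have kE : k - y1 = y2 - k by rewrite /k; lra.
  have xm : x1 <= m <= x2 by rewrite /m; apply/andP; split; lra.
  have yk : y1 <= k <= y2 by rewrite /k; apply/andP; split; lra.
  have [xm1 xm2] := andP xm; have [yk1 yk2] := andP yk.
  have ok u v p q : a <= u -> v <= b -> c <= p -> q <= d -> u <= v -> p <= q -> RIok f u v p q.
    move=> *; apply: RIok_cont => // z [zQ _]; apply: Hc; exact: inQ_sub zQ.
  have E : RI f x1 x2 y1 y2 = RI f x1 m y1 k + RI f x1 m k y2 + (RI f m x2 y1 k + RI f m x2 k y2).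
    rewrite (@RI_splitx _ f x1 m x2)//; last 2 first.
    - exact: ok.
    - by apply: (cint_ver Hc) => //; apply/andP; split; lra.
    congr (_ + _); apply: RI_splity => //.
    - by apply: ok => //; lra.
    - by apply: (cint_hor Hc) => //; try lra; apply/andP; split; lra.
    - by apply: ok => //; lra.
    - by apply: (cint_hor Hc) => //; try lra; apply/andP; split; lra.
  have S : nc (RI f x1 x2 y1 y2) <= nc (RI f x1 m y1 k) + nc (RI f x1 m k y2) +
      (nc (RI f m x2 y1 k) + nc (RI f m x2 k y2)).
    by rewrite E (le_trans (ncD _ _))// lerD// ncD.
  have [h|h|h|h] := four_parts S.
  - exists (x1, m, y1, k) => _ _; split; [split|split|rewrite /side|exact: h];
    rewrite /ra /rb /rc /rd/=; clear -s1 s2 s3 s4 xm1 xm2 yk1 yk2 mE kE; lra.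
  - exists (x1, m, k, y2) => _ _; split; [split|split|rewrite /side|exact: h];
    rewrite /ra /rb /rc /rd/=; clear -s1 s2 s3 s4 xm1 xm2 yk1 yk2 mE kE; lra.
  - exists (m, x2, y1, k) => _ _; split; [split|split|rewrite /side|exact: h];
    rewrite /ra /rb /rc /rd/=; clear -s1 s2 s3 s4 xm1 xm2 yk1 yk2 mE kE; lra.
  - exists (m, x2, k, y2) => _ _; split; [split|split|rewrite /side|exact: h];
    rewrite /ra /rb /rc /rd/=; clear -s1 s2 s3 s4 xm1 xm2 yk1 yk2 mE kE; lra.
have [h Hh] := choice step.
pose r n := iter n h Q.
have rP n : [/\ proper (r n), sub Q (r n), side (r n) = side Q / 2 ^+ n &
    nc (I f Q) <= 4 ^+ n * nc (I f (r n))].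
  elim: n => [|n [p s l u]].
    by split => //=; rewrite ?expr0 ?divr1 ?mul1r//; split => /=.
  have [p' s' l' u'] := Hh (r n) p s.
  split => //=.
  - by case: s s' => ? ? ? ? [? ? ? ?]; split; apply: le_trans; eassumption.
  - by rewrite l' l exprSr; field; exact: expf_neq0.
  - by rewrite (le_trans u)// exprSr -mulrA ler_wpM2l// exprn_ge0.
have rS n k : sub (r n) (r (n + k)%N).
  elim: k => [|k [? ? ? ?]]; first by rewrite addn0.
  have [p s _ _] := rP (n + k)%N; have [_ [? ? ? ?] _ _] := Hh _ p s.
  by rewrite addnS; split; apply: le_trans; eassumption.
have cross n m : ra (r n) <= rb (r m) /\ rc (r n) <= rd (r m).
  have [[p1 p2] _ _ _] := rP (n + m)%N.
  have [h1 _ h2 _] := rS n m; have := rS m n; rewrite addnC => -[_ h3 _ h4].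
  split; [exact: le_trans h1 (le_trans p1 h3)|exact: le_trans h2 (le_trans p2 h4)].
(* The common point of the nested rectangles: the suprema of the left and of the lower edges. *)
pose x0 := sup (range (fun n => ra (r n))); pose y0 := sup (range (fun n => rc (r n))).
have inr n : inQ (ra (r n)) (rb (r n)) (rc (r n)) (rd (r n)) (pt x0 y0).
  split; apply/andP; split => /=.
  - apply: ub_le_sup; last by exists n.
    by exists (rb (r 0%N)) => _ [m _ <-]; have [] := cross m 0%N.
  - by apply: ge_sup; [exists (ra (r 0%N)), 0%N|move=> _ [m _ <-]; have [] := cross m n].
  - apply: ub_le_sup; last by exists n.
    by exists (rd (r 0%N)) => _ [m _ <-]; have [] := cross m 0%N.
  - by apply: ge_sup; [exists (rc (r 0%N)), 0%N|move=> _ [m _ <-]; have [] := cross m n].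
set z0 := pt x0 y0 in inr *.
have [l Hl] := H z0 (inr 0%N).
apply/eqP; rewrite -nc_eq0 eq_le nc_ge0 andbT; apply/ler_addgt0Pl => e e0; rewrite addr0.
pose s0 := side Q; have s00 : 0 <= s0 by rewrite /s0 /side addr_ge0// subr_ge0.
(* The final bound is [4 * s0 ^+ 2 * e']; the summand 1 covers the degenerate rectangle, where [s0]
   is 0. *)
pose e' := e / (4 * (s0 ^+ 2 + 1)).
have k0 : 0 < 4 * (s0 ^+ 2 + 1) by rewrite mulr_gt0// ltr_wpDl// sqr_ge0.
have e'0 : 0 < e' by rewrite divr_gt0.
have [rr rr0 Hr] := Hl e' e'0.
have [n Hn] : exists n, s0 / 2 ^+ n < rr.
  have := @cvg_geometric _ s0 (2^-1 : R); rewrite ger0_norm ?invr_ge0// invf_lt1// ltr1n.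
  move=> /(_ isT) /cvgrPdist_lt /(_ rr rr0) [N _ /(_ N (leqnn N))].
  rewrite /= sub0r normrN ger0_norm ?mulr_ge0// ?exprn_ge0 ?invr_ge0//.
  by rewrite exprVn => ?; exists N.
have [[p1 p2] sQ sE nE] := rP n.
rewrite (le_trans nE)//.
have zin z : inQ (ra (r n)) (rb (r n)) (rc (r n)) (rd (r n)) z -> inQ a b c d z.
  by case: sQ => /= ? ? ? ?; exact: inQ_sub.
pose A z := f z0 - l * z0 + l * z.
have okf : RIok f (ra (r n)) (rb (r n)) (rc (r n)) (rd (r n)).
  by apply: RIok_cont => // z [/zin /Hc].
have okA : RIok A (ra (r n)) (rb (r n)) (rc (r n)) (rd (r n)).
  by apply: RIokD; [exact: RIok_cst|apply: RIokZ; exact: RIok_id].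
have IE : I f (r n) = RI (fun z => f z - A z) (ra (r n)) (rb (r n)) (rc (r n)) (rd (r n)).
  by rewrite (RIB okf okA) RI_affine// subr0.
have IB : nc (I f (r n)) <= 4 * (e' * side (r n)) * side (r n).
  rewrite IE; apply: RI_bound => //.
    by case: okf okA => ? ? ? ? [? ? ? ?]; split; exact: cintB.
  move=> z [zr _]; have dz := inQ_dist zr (inr n).
  have -> : f z - A z = f (z0 + (z - z0)) - f z0 - l * (z - z0).
    by rewrite subrKC /A; ring.
  apply: le_trans (Hr _ _) _; last by rewrite ler_wpM2l// ltW.
  by apply: (le_lt_trans dz); rewrite -/(side (r n)) sE.
apply: le_trans (_ : 4 ^+ n * (4 * (e' * side (r n)) * side (r n)) <= _).
  by rewrite ler_wpM2l// exprn_ge0.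
rewrite sE -/s0.
have -> : 4 ^+ n * (4 * (e' * (s0 / 2 ^+ n)) * (s0 / 2 ^+ n)) = 4 * s0 ^+ 2 * e'.
  have -> : (4 : R) ^+ n = 2 ^+ n * 2 ^+ n by rewrite -exprMn -natrM.
  by field; exact: expf_neq0.
rewrite /e' mulrA ler_pdivrMr// mulrC ler_pM2l// ler_pM2l//; lra.
Qed.

End Goursat.

(** * Boundedness of continuous functions on rectangles *)

Section RealPlaneContinuity.
Variable R : realType.
Local Notation C := (R[i])^o.

Lemma continuous_lip_comp (f : C -> C) (phi : C -> R) (xy : R * R) :
  (forall z w, `|phi z - phi w| <= nc (z - w)) -> ccont f (cpt xy) ->
  {for xy, continuous (fun t : R * R => phi (f (cpt t)))}.
Proof.
move=> L F; apply/(@cvgrPdist_le _ _ _ (nbhs xy)) => e e0.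
have [r r0 Hr] := F e e0; have r20 : 0 < r / 2 by rewrite divr_gt0.
rewrite nearE /=; exists (ball xy.1 (r / 2), ball xy.2 (r / 2)); rewrite /=.
  by split; exact: nbhsx_ballx.
move=> [x y]/= [bx b_y]; rewrite distrC (le_trans (L _ _))//.
rewrite -[cpt (x, y)](subrKC (cpt xy)); apply: Hr.
apply: le_lt_trans (nc_le_ReIm _) _; rewrite ReD ImD ReN ImN /=.
by rewrite (splitr r) ltrD// distrC.
Qed.

Lemma lip_nc (z w : C) : `|nc z - nc w| <= nc (z - w).
Proof. by rewrite ler_norml lerNl opprB nc_lowerB ncBC nc_lowerB. Qed.

Lemma lip_Re (z w : C) : `|complex.Re z - complex.Re w| <= nc (z - w).
Proof. by rewrite -ReN -ReD nc_Re. Qed.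

Lemma lip_Im (z w : C) : `|complex.Im z - complex.Im w| <= nc (z - w).
Proof. by rewrite -ImN -ImD nc_Im. Qed.

Lemma bounded_on_rect (f : C -> C) a b c d : a <= b -> c <= d ->
  (forall z, inQ a b c d z -> ccont f z) ->
  exists2 M, 0 <= M & forall z, inQ a b c d z -> nc (f z) <= M.
Proof.
move=> ab cd H; pose A : set (R * R) := `[a, b]%classic `*` `[c, d]%classic.
have cA : compact A by apply: compact_setX; exact: segment_compact.
have A0 : A !=set0 by exists (a, c); split; rewrite /= in_itv/= lexx.
have cf : {within A, continuous (fun t : R * R => nc (f (cpt t)))}.
  apply: continuous_in_subspaceT => t; rewrite inE => -[/=]; rewrite !in_itv/= => h1 h2.
  by apply: continuous_lip_comp; [exact: lip_nc|apply: H].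
have [t _ Ht] := compact_EVT_max A0 cA cf.
exists (nc (f (cpt t))) => [|[x y] [/= h1 h2]]; first exact: nc_ge0.
by apply: (Ht (x, y)); rewrite inE; split; rewrite /= in_itv.
Qed.

End RealPlaneContinuity.

(** * Cauchy's integral formula on rectangles *)

Section CauchyTheory.
Variable R : realType.
Local Notation C := (R[i])^o.
Local Notation pt x y := ((x +i* y)%C : C).
Local Notation Re := complex.Re.
Local Notation Im := complex.Im.
Implicit Types (f g : C -> C) (z w : C).

(** Cutting a small square about [w] out of the rectangle leaves four rectangles to which Goursat's
    theorem applies. Continuity at [w] bounds [g] on the square, whose perimeter tends to 0. *)
Lemma goursat_punctured g a b c d w : a < Re w < b -> c < Im w < d ->
  (forall z, inQ a b c d z -> ccont g z) ->
  (forall z, inQ a b c d z -> z <> w -> exists l, cdiff g z l) ->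
  RI g a b c d = 0.
Proof.
case: w => x0 y0 /= /andP[ax xb] /andP[cy yd] Hc Hd.
have win : inQ a b c d (pt x0 y0) by split; rewrite /= !ltW.
have [r r0 Hr] := Hc _ win 1 ltr01.
pose M := 1 + nc (g (pt x0 y0)); have M0 : 0 < M by rewrite /M ltr_pwDl// nc_ge0.
apply/eqP; rewrite -nc_eq0 eq_le nc_ge0 andbT; apply/ler_addgt0Pl => e e0; rewrite addr0.
pose m := Num.min (Num.min (x0 - a) (b - x0)) (Num.min (y0 - c) (d - y0)).
(* [m] keeps the square inside the rectangle, [r / 8] keeps it where [g] is bounded by [M], and
   [16 * M * t] is the resulting bound of the integral. *)
pose t := Num.min m (Num.min (r / 8) (e / (16 * M))).
have t0 : 0 < t by rewrite !lt_min !subr_gt0 ax xb cy yd !divr_gt0// mulr_gt0.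
have [ta tb tc td] : [/\ t <= x0 - a, t <= b - x0, t <= y0 - c & t <= d - y0].
  by split; rewrite !ge_min lexx ?orbT.
have tr : t <= r / 8 by rewrite !ge_min lexx ?orbT.
have te : t <= e / (16 * M) by rewrite !ge_min lexx ?orbT.
have ok u v p q : a <= u -> v <= b -> c <= p -> q <= d -> u <= v -> p <= q -> RIok g u v p q.
  by move=> *; apply: RIok_cont => // z [zQ _]; apply: Hc; exact: inQ_sub zQ.
have zero u v p q : a <= u -> v <= b -> c <= p -> q <= d -> u <= v -> p <= q ->
   ~ inQ u v p q (pt x0 y0) -> RI g u v p q = 0.
  move=> *; apply: goursat => // z zQ; apply: Hd; first exact: inQ_sub zQ.
  by move=> zE; rewrite zE in zQ.
have ver x p q : c <= p -> q <= d -> a <= x <= b -> cint (fun y => g (pt x y)) p q.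
  by move=> *; exact: (cint_ver Hc).
have hor y p q : a <= p -> q <= b -> c <= y <= d -> cint (fun x => g (pt x y)) p q.
  by move=> *; exact: (cint_hor Hc).
clearbody t; clear m ax xb cy yd.
rewrite (@RI_splitx _ g a (x0 - t) b); last 3 first.
- by apply/andP; split; clear -ta tb t0; lra.
- by apply: ok => //; clear -ta tb tc td t0; lra.
- by apply: ver => //; apply/andP; split; clear -ta tb t0; lra.
rewrite (@RI_splitx _ g (x0 - t) (x0 + t) b); last 3 first.
- by apply/andP; split; clear -ta tb t0; lra.
- by apply: ok => //; clear -ta tb tc td t0; lra.
- by apply: ver => //; apply/andP; split; clear -ta tb t0; lra.
rewrite (@RI_splity _ g (x0 - t) (x0 + t) c (y0 - t) d); last 3 first.
- by apply/andP; split; clear -tc td t0; lra.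
- by apply: ok => //; clear -ta tb tc td t0; lra.
- by apply: hor => //; clear -ta tb tc td t0; try lra; apply/andP; split; lra.
rewrite (@RI_splity _ g (x0 - t) (x0 + t) (y0 - t) (y0 + t) d); last 3 first.
- by apply/andP; split; clear -tc td t0; lra.
- by apply: ok => //; clear -ta tb tc td t0; lra.
- by apply: hor => //; clear -ta tb tc td t0; try lra; apply/andP; split; lra.
rewrite (zero a (x0 - t) c d); last 7 first.
1-6: by rewrite ?lexx//; clear -ta tb tc td t0; lra.
  by case=> /= /andP[]; clear -t0; lra.
rewrite (zero (x0 + t) b c d); last 7 first.
1-6: by rewrite ?lexx//; clear -ta tb tc td t0; lra.
  by case=> /= /andP[]; clear -t0; lra.
rewrite (zero (x0 - t) (x0 + t) c (y0 - t)); last 7 first.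
1-6: by rewrite ?lexx//; clear -ta tb tc td t0; lra.
  by case=> /= _ /andP[]; clear -t0; lra.
rewrite (zero (x0 - t) (x0 + t) (y0 + t) d); last 7 first.
1-6: by rewrite ?lexx//; clear -ta tb tc td t0; lra.
  by case=> /= _ /andP[]; clear -t0; lra.
rewrite !add0r !addr0.
apply: le_trans (_ : 4 * M * ((x0 + t - (x0 - t)) + (y0 + t - (y0 - t))) <= _).
  apply: RI_bound.
  - by clear -t0; lra.
  - by clear -t0; lra.
  - by apply: ok => //; clear -ta tb tc td t0; lra.
  move=> z [zQ _].
  have wQ : inQ (x0 - t) (x0 + t) (y0 - t) (y0 + t) (pt x0 y0).
    by split => /=; apply/andP; split; clear -t0; lra.
  have dz := inQ_dist zQ wQ.
  have /Hr : nc (z - pt x0 y0) < r by apply: le_lt_trans dz _; clear -tr t0 r0; lra.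
  by rewrite subrKC /M => H; rewrite -lerBlDr (le_trans (nc_lowerB _ _)).
move: te; rewrite ler_pdivlMr ?mulr_gt0// => te; apply: le_trans te.
by rewrite le_eqVlt; apply/orP; left; apply/eqP; ring.
Qed.

Definition Qrect w (s : R) (z : C) := inQ (Re w - s) (Re w + s) (Im w - s) (Im w + s) z.

Lemma inQ_interior_neq a b c d w z : a < Re w < b -> c < Im w < d ->
  bdQ a b c d z -> z != w.
Proof.
move=> /andP[h1 h2] /andP[h3 h4] [_ H]; apply/eqP => zw; move: h1 h2 h3 h4; rewrite -zw.
by case: H => ->; rewrite ltxx.
Qed.

(** The Cauchy integral, not divided by 2 pi i; the role of that number is taken over by
    [cauchyJ (fun=> 1)]. *)
Definition cauchyJ f a b c d w := RI (fun z => f z * (z - w)^-1) a b c d.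

Lemma ccont_subV z w : z != w -> ccont (fun z => (z - w)^-1) z.
Proof.
move=> zw; apply: ccontV; first by rewrite subr_eq0.
by apply: ccontB; [exact: ccont_id|exact: ccont_cst].
Qed.

Lemma RIok_kernel f a b c d w n : a < Re w < b -> c < Im w < d ->
  (forall z, bdQ a b c d z -> ccont f z) ->
  RIok (fun z => f z * (z - w)^-1 ^+ n) a b c d.
Proof.
move=> aw cw H; have [h1 h2] := andP aw; have [h3 h4] := andP cw.
apply: RIok_cont; [exact: ltW (lt_trans h1 h2)|exact: ltW (lt_trans h3 h4)|].
move=> z zQ; apply: ccontM; first exact: H.
have zw := inQ_interior_neq aw cw zQ.
elim: n => [|n IH]; first exact: ccont_cst.
have -> : (fun u => (u - w)^-1 ^+ n.+1) = (fun u => (u - w)^-1 * (u - w)^-1 ^+ n).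
  by apply/funext => u; rewrite exprS.
exact: (ccontM (ccont_subV zw) IH).
Qed.

(** The difference quotient, extended by the derivative at [w], is continuous, and differentiable
    away from [w], so the punctured form of Goursat's theorem makes its integral vanish. The winding
    integral on the right stays unevaluated. *)
Lemma cauchy_formula f a b c d w : a < Re w < b -> c < Im w < d ->
  (forall z, inQ a b c d z -> exists l, cdiff f z l) ->
  cauchyJ f a b c d w = f w * cauchyJ (fun=> 1) a b c d w.
Proof.
move=> aw cw H; have [h1 h2] := andP aw; have [h3 h4] := andP cw.
have ab := ltW (lt_trans h1 h2); have cd := ltW (lt_trans h3 h4).
have wQ : inQ a b c d w by split; rewrite !ltW.
have [l Hl] := H w wQ.
pose g z := if z == w then l else (f z - f w) * (z - w)^-1.
have gE z : z != w -> (f z - f w) * (z - w)^-1 = g z by rewrite /g => /negPf ->.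
have near_w z : z != w -> exists2 s : R, 0 < s & forall u, nc (u - z) < s ->
    (f u - f w) * (u - w)^-1 = g u.
  move=> zw; exists (nc (z - w)); first by rewrite nc_gt0 subr_eq0.
  by move=> u; rewrite ncBC => uz; apply: gE; apply: contraTneq uz => ->; rewrite ltxx.
have gd z : inQ a b c d z -> z != w -> exists l, cdiff g z l.
  move=> zQ zw; have [k Hk] := H z zQ; have [s s0 Es] := near_w z zw.
  have D1 := cdiffB Hk (cdiff_cst (f w) z).
  have D2 := cdiffB (cdiff_id z) (cdiff_cst w z).
  have zw' : z - w != 0 by rewrite subr_eq0.
  have D3 := cdiffM D1 (@cdiffV _ (fun u => u - w) z _ zw' D2).
  by eexists; exact: (cdiff_near s0 Es D3).
have gc z : inQ a b c d z -> ccont g z.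
  move=> zQ; have [->|zw] := eqVneq z w; last first.
    by have [k] := gd z zQ zw; exact: cdiff_cont.
  move=> e e0; have [r r0 Hr] := Hl e e0; exists r => // h hr.
  have [->|h0] := eqVneq h 0; first by rewrite addr0 subrr nc0 ltW.
  have wh : w + h != w by rewrite -subr_eq0 addrC addKr.
  have -> : g (w + h) - g w = h^-1 * (f (w + h) - f w - l * h).
    rewrite -gE// /g eqxx [w + h - w]addrC addKr; field; exact: h0.
  by rewrite ncM ncV mulrC ler_pdivrMr ?nc_gt0// Hr.
have G0 : RI g a b c d = 0.
  by apply: (goursat_punctured aw cw) => // z zQ /eqP zw; exact: gd.
have fc z : bdQ a b c d z -> ccont f z.
  by move=> [zQ _]; have [k] := H z zQ; exact: cdiff_cont.
have ok1 : RIok (fun z => f z * (z - w)^-1) a b c d by exact: (RIok_kernel 1 aw cw fc).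
have ok2 : RIok (fun z => 1 * (z - w)^-1) a b c d.
  by apply: (RIok_kernel 1 aw cw) => z _; exact: ccont_cst.
apply/eqP; rewrite -subr_eq0 /cauchyJ -RIZ// -RIB//; last exact: RIokZ.
rewrite -G0; apply/eqP; apply: RI_ext => // z zQ.
by rewrite -gE ?(inQ_interior_neq aw cw zQ)// mul1r mulrBl.
Qed.

(** A lower bound replaces the value 2 pi of the imaginary part. The two horizontal sides together
    contribute an integrand of at least [d - c] over the squared diagonal, because [w] lies between
    them; the vertical sides contribute a nonnegative one. *)
Lemma winding_lower a b c d w : a < Re w < b -> c < Im w < d ->
  (b - a) * (d - c) / ((b - a) ^+ 2 + (d - c) ^+ 2) <= nc (cauchyJ (fun=> 1) a b c d w).
Proof.
move=> aw cw; apply: le_trans (nc_Im _); apply: le_trans (ler_norm _).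
have ok : RIok (fun z => 1 * (z - w)^-1) a b c d.
  by apply: (RIok_kernel 1 aw cw) => z _; exact: ccont_cst.
move: w aw cw ok => [x0 y0] /= /andP[ax xb] /andP[cy yd] ok.
have ab := ltW (lt_trans ax xb); have cd := ltW (lt_trans cy yd).
rewrite /cauchyJ /RI /= mul0r add0r mul1r.
set D := (b - a) ^+ 2 + _.
have D0 : 0 < D by rewrite addr_gt0// exprn_gt0// subr_gt0; [exact: lt_trans xb|exact: lt_trans yd].
case: ok => ok1 ok2 ok3 ok4.
have sq_le (u v : R) : - v <= u <= v -> u ^+ 2 <= v ^+ 2.
  move=> uv; rewrite -real_normK ?num_real// ler_sqr ?nnegrE//; first by rewrite ler_norml.
  by move: uv => /andP[] h1 h2; have := le_trans h1 h2; lra.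
rewrite -[leLHS]addr0; apply: lerD.
  have -> : (b - a) * (d - c) / D = (d - c) / D * (b - a) by ring.
  rewrite -(Rint_cst _ ab); apply: le_Rintegral => //; first exact: int_cst.
    by have [] := cintB ok1 ok2.
  move=> x; rewrite /= in_itv/= => /andP[ax' xb'].
  have N t : c <= t <= d -> t != y0 ->
      (x - x0) ^+ 2 + (t - y0) ^+ 2 <= D /\ 0 < (x - x0) ^+ 2 + (t - y0) ^+ 2.
    move=> /andP[ct td] ty; split.
      by apply: lerD; apply: sq_le; apply/andP; split; clear -ax xb cy yd ax' xb' ct td; lra.
    by rewrite ltr_wpDl ?sqr_ge0// exprn_even_gt0//= subr_eq0.
  have [||N1 N1p] := N c; [by rewrite lexx|by rewrite lt_eqF|].
  have [||N2 N2p] := N d; [by rewrite lexx cd|by rewrite gt_eqF|].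
  rewrite !mul1r !mul0r !addr0 -!mulNr !opprB.
  have -> : d - c = (y0 - c) + (d - y0) by ring.
  rewrite mulrDl; apply: lerD; apply: ler_wpM2l; rewrite ?subr_ge0 ?lef_pV2 ?posrE//; exact: ltW.
apply: Rintegral_ge0 => y; rewrite /= in_itv/= => /andP[h1 h2].
rewrite !mul1r !mul0r !subr0 -mulNr opprB addr_ge0// divr_ge0 ?subr_ge0 ?addr_ge0 ?sqr_ge0//;
  exact: ltW.
Qed.

Lemma Qrect_center w (s : R) : 0 < s -> Qrect w s w.
Proof. by move=> s0; split; apply/andP; split; clear -s0; lra. Qed.

Lemma Qrect_near w (s : R) z : nc (z - w) <= s -> Qrect w s z.
Proof.
move=> H; have := le_trans (nc_Re (z - w)) H; have := le_trans (nc_Im (z - w)) H.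
rewrite ReD ImD ReN ImN !ler_norml => /andP[h1 h2] /andP[h3 h4].
by split; apply/andP; split; clear -h1 h2 h3 h4; lra.
Qed.

Lemma Qrect_bd_dist w (s : R) z : 0 < s ->
  bdQ (Re w - s) (Re w + s) (Im w - s) (Im w + s) z -> s <= nc (z - w).
Proof.
move=> s0 [_ H]; have hR := nc_Re (z - w); have hI := nc_Im (z - w).
move: hR hI; rewrite ReD ImD ReN ImN => hR hI.
case: H => E; [apply: le_trans hR|apply: le_trans hR|apply: le_trans hI|apply: le_trans hI].
- by rewrite E addrAC subrr add0r normrN ger0_norm// ltW.
- by rewrite E addrAC subrr add0r ger0_norm// ltW.
- by rewrite E addrAC subrr add0r normrN ger0_norm// ltW.
- by rewrite E addrAC subrr add0r ger0_norm// ltW.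
Qed.

Let quarter_lt (s : R) : 0 < s -> s / 4 < s.
Proof. by move=> ?; lra. Qed.

Let oppr_le_pos (s : R) : 0 < s -> - s <= s.
Proof. by move=> ?; lra. Qed.

Let half_lower (s h x : R) : s <= x -> h <= s / 4 -> 0 < s -> s / 2 <= x - h.
Proof. by move=> ? ? ?; lra. Qed.

Definition cauchyJ2 f a b c d w := RI (fun z => f z * (z - w)^-1 ^+ 2) a b c d.

Section Expansion.
Variables (F : C -> C) (w : C) (s M : R).
Hypothesis s0 : 0 < s.
Local Notation bd := (bdQ (Re w - s) (Re w + s) (Im w - s) (Im w + s)).
Local Notation J := (cauchyJ F (Re w - s) (Re w + s) (Im w - s) (Im w + s)).
Local Notation J2 := (cauchyJ2 F (Re w - s) (Re w + s) (Im w - s) (Im w + s)).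
Hypothesis Fc : forall z, bd z -> ccont F z.
Hypothesis FM : forall z, bd z -> nc (F z) <= M.

Let near_in h : nc h <= s / 4 ->
  Re w - s < Re (w + h) < Re w + s /\ Im w - s < Im (w + h) < Im w + s.
Proof.
move=> H; have := le_trans (nc_Re h) H; have := le_trans (nc_Im h) H.
rewrite ReD ImD !ler_norml => /andP[h1 h2] /andP[h3 h4].
have s4 := quarter_lt s0.
split; apply/andP; split; rewrite ltrD2l.
- by apply: lt_le_trans h3; rewrite ltrN2.
- exact: le_lt_trans h4 s4.
- by apply: lt_le_trans h1; rewrite ltrN2.
- exact: le_lt_trans h2 s4.

Qed.

Let w_in : Re w - s < Re w < Re w + s /\ Im w - s < Im w < Im w + s.
Proof. by split; rewrite ltrDl s0 andbT ltrBlDr ltrDl. Qed.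

Let bdp z : bd z -> 0 < nc (z - w).
Proof. by move=> /(Qrect_bd_dist s0); exact: lt_le_trans. Qed.

Let xs : Re w - s <= Re w + s. Proof. by rewrite lerD2l oppr_le_pos. Qed.
Let ys : Im w - s <= Im w + s. Proof. by rewrite lerD2l oppr_le_pos. Qed.

Let perim : (Re w + s - (Re w - s)) + (Im w + s - (Im w - s)) = 4 * s.
Proof. by ring. Qed.

Lemma cauchyJ_bound : nc (J w) <= 16 * M.
Proof.
have [w1 w2] := w_in.
apply: le_trans (_ : 4 * (M / s) * (4 * s) <= _); last first.
  by rewrite le_eqVlt; apply/orP; left; apply/eqP; field; exact: lt0r_neq0.
rewrite -perim; apply: RI_bound => //; first exact: (RIok_kernel 1 w1 w2 Fc).
move=> z zb; rewrite ncM ncV; apply: ler_pM; rewrite ?invr_ge0 ?nc_ge0 ?FM//.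
by rewrite lef_pV2 ?posrE ?bdp// (Qrect_bd_dist s0 zb).
Qed.

Lemma cauchyJ2_bound : nc (J2 w) <= 16 * M / s.
Proof.
have [w1 w2] := w_in.
apply: le_trans (_ : 4 * (M / s ^+ 2) * (4 * s) <= _); last first.
  by rewrite le_eqVlt; apply/orP; left; apply/eqP; field; exact: lt0r_neq0.
rewrite -perim; apply: RI_bound => //; first exact: (RIok_kernel 2 w1 w2 Fc).
move=> z zb; rewrite ncM ncX ncV exprVn; apply: ler_pM; rewrite ?invr_ge0 ?exprn_ge0 ?nc_ge0 ?FM//.
rewrite lef_pV2 ?posrE ?exprn_gt0 ?bdp// ler_sqr ?nnegrE ?nc_ge0 ?(ltW s0)//.
exact: (Qrect_bd_dist s0 zb).
Qed.

(** With u = z - w, the identity 1/(u - h) - 1/u - h/u^2 = h^2 / (u^2 (u - h)) is used under the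
    integral; on the contour |u| >= s and |u - h| >= s/2. *)
Lemma cauchyJ_taylor h : nc h <= s / 4 ->
  nc (J (w + h) - J w - h * J2 w) <= 32 * M / s ^+ 2 * nc h ^+ 2.
Proof.
move=> hs; have [w1 w2] := w_in; have [h1 h2] := near_in hs.
have ok1 := RIok_kernel 1 w1 w2 Fc; have ok2 := RIok_kernel 2 w1 w2 Fc.
have ok3 := RIok_kernel 1 h1 h2 Fc.
have okZ := RIokZ h ok2.
have okB : forall f g, RIok f (Re w - s) (Re w + s) (Im w - s) (Im w + s) ->
    RIok g (Re w - s) (Re w + s) (Im w - s) (Im w + s) ->
    RIok (fun z => f z - g z) (Re w - s) (Re w + s) (Im w - s) (Im w + s).
  by move=> f g [? ? ? ?] [? ? ? ?]; split; exact: cintB.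
rewrite /cauchyJ /cauchyJ2 -(RIZ h ok2) -(RIB ok3 ok1) -(RIB (okB _ _ ok3 ok1) okZ).
apply: le_trans (_ : 4 * (M * (nc h ^+ 2 * (s ^- 2 * (s / 2)^-1))) * (4 * s) <= _); last first.
  by rewrite le_eqVlt; apply/orP; left; apply/eqP; field; exact: lt0r_neq0.
rewrite -perim; apply: RI_bound => //; first exact: (okB _ _ (okB _ _ ok3 ok1) okZ).
move=> z zb; have zw := Qrect_bd_dist s0 zb.
have zwh : s / 2 <= nc (z - (w + h)).
  rewrite opprD addrA; apply: le_trans (nc_lowerB _ _).
  exact: half_lower.
have n1 : z - w != 0 by rewrite -nc_gt0 bdp.
have n2 : z - (w + h) != 0 by rewrite -nc_gt0; apply: lt_le_trans zwh; rewrite divr_gt0.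
have -> : F z * (z - (w + h))^-1 ^+ 1 - F z * (z - w)^-1 ^+ 1 - h * (F z * (z - w)^-1 ^+ 2) =
   F z * (h ^+ 2 * ((z - w) ^- 2 * (z - (w + h))^-1)).
  by field; apply/andP; split.
rewrite ncM ncM ncX ncM !ncV ncX; apply: ler_pM; [exact: nc_ge0| |exact: FM|].
  by apply: mulr_ge0; [|apply: mulr_ge0]; rewrite ?invr_ge0 ?exprn_ge0 ?nc_ge0.
apply: ler_wpM2l; first by rewrite exprn_ge0 ?nc_ge0.
apply: ler_pM; rewrite ?invr_ge0 ?exprn_ge0 ?nc_ge0//.
  by rewrite lef_pV2 ?posrE ?exprn_gt0 ?bdp// ler_sqr ?nnegrE ?nc_ge0 ?(ltW s0).
by rewrite lef_pV2 ?posrE ?divr_gt0 ?nc_gt0.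
Qed.

End Expansion.

End CauchyTheory.

(** * Quadratic Taylor remainders and limits of bounded families *)

Section Regularity.
Variable R : realType.
Local Notation C := (R[i])^o.
Local Notation Re := complex.Re.
Local Notation Im := complex.Im.
Implicit Types (f g : C -> C) (z w : C).

Let half_of_square (s : R) : 0 < s ->
  (s + s) * (s + s) / ((s + s) ^+ 2 + (s + s) ^+ 2) = 1 / 2.
Proof. by move=> s0; field; rewrite lt0r_neq0// addr_gt0 ?exprn_gt0 ?addr_gt0. Qed.

Let width (x s : R) : x + s - (x - s) = s + s. Proof. by ring. Qed.

Let lt_width_shift (x y s : R) : 0 < s -> `|y| <= s / 4 -> x - s < x + y < x + s.
Proof. by move=> s0; rewrite ler_norml => /andP[h1 h2]; apply/andP; split; lra. Qed.

Lemma winding_ge_half w h (s : R) : 0 < s -> nc h <= s / 4 ->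
  1 / 2 <= nc (cauchyJ (fun=> 1) (Re w - s) (Re w + s) (Im w - s) (Im w + s) (w + h)).
Proof.
move=> s0 hs.
have := @winding_lower R (Re w - s) (Re w + s) (Im w - s) (Im w + s) (w + h).
rewrite !width half_of_square//; apply.
  by rewrite ReD lt_width_shift// (le_trans (nc_Re h)).
by rewrite ImD lt_width_shift// (le_trans (nc_Im h)).
Qed.

Lemma ler_mul_le (x y a b : R) : 0 <= x -> 0 <= y -> x <= a -> y <= b -> x * y <= a * b.
Proof. by move=> *; rewrite ler_pM. Qed.

(** The quotient rule with an explicit quadratic remainder. It serves for f written as the quotient
    of two Cauchy integrals: [A] and [B] are their values at [w], [A'] and [B'] their derivatives,
    [RA] and [RB] their remainders at [w + h]. The two lower bounds 1/2 are winding bounds. *)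
Lemma quotient_taylor (A A' RA B B' RB h : C) (s M t : R) : 0 < s -> 0 <= M -> 0 <= t ->
  t <= s / 4 -> nc h = t ->
  nc A <= 16 * M -> nc A' <= 16 * M / s -> nc RA <= 32 * M / s ^+ 2 * t ^+ 2 ->
  nc B <= 16 -> nc B' <= 16 / s -> nc RB <= 32 / s ^+ 2 * t ^+ 2 ->
  1 / 2 <= nc B -> 1 / 2 <= nc (B + h * B' + RB) ->
  nc ((A + h * A' + RA) / (B + h * B' + RB) - A / B - h * ((A' * B - A * B') / B ^+ 2)) <=
    7 * 2 ^+ 15 * M / s ^+ 2 * t ^+ 2.
Proof.
move=> s0 M0 t0 ts ht hA hA' hRA hB hB' hRB lB lBh.
have B0 : B != 0 by rewrite -nc_gt0; apply: lt_le_trans lB; rewrite divr_gt0.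
set Bh := B + h * B' + RB in lBh *.
have Bh0 : Bh != 0 by rewrite -nc_gt0; apply: lt_le_trans lBh; rewrite divr_gt0.
set D := A' * B - A * B'.
have hD : nc D <= 2 ^+ 9 * M / s.
  rewrite (le_trans (ncB _ _))// !ncM.
  have -> : 2 ^+ 9 * M / s = (16 * M / s) * 16 + (16 * M) * (16 / s) by field; exact: lt0r_neq0.
  by rewrite lerD// ler_mul_le ?nc_ge0.
have E : (A + h * A' + RA) / Bh - A / B - h * (D / B ^+ 2) =
    (RA * B ^+ 2 - h ^+ 2 * (B' * D) - RB * (A * B + h * D)) * (B ^- 2 * Bh^-1).
  by rewrite /D /Bh; field; apply/andP; split.
rewrite E ncM.
have n1 : nc (B ^- 2 * Bh^-1) <= 8.
  rewrite ncM !ncV ncX; have -> : (8 : R) = (1 / 2) ^- 2 * (1 / 2)^-1 by field.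
  apply: ler_mul_le; rewrite ?invr_ge0 ?exprn_ge0 ?nc_ge0//.
    by rewrite lef_pV2 ?posrE ?exprn_gt0 ?(lt_le_trans _ lB)// ler_sqr ?nnegrE ?nc_ge0.
  by rewrite lef_pV2 ?posrE ?(lt_le_trans _ lBh).
have i1 : nc (RA * B ^+ 2) <= 2 ^+ 13 * M / s ^+ 2 * t ^+ 2.
  rewrite ncM ncX; have -> : 2 ^+ 13 * M / s ^+ 2 * t ^+ 2 = (32 * M / s ^+ 2 * t ^+ 2) * 16 ^+ 2.
    by field; exact: lt0r_neq0.
  by apply: ler_mul_le; rewrite ?exprn_ge0 ?nc_ge0// ler_sqr ?nnegrE ?nc_ge0.
have i2 : nc (h ^+ 2 * (B' * D)) <= 2 ^+ 13 * M / s ^+ 2 * t ^+ 2.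
  rewrite ncM ncX ncM ht.
  have -> : 2 ^+ 13 * M / s ^+ 2 * t ^+ 2 = t ^+ 2 * ((16 / s) * (2 ^+ 9 * M / s)).
    by field; exact: lt0r_neq0.
  by rewrite ler_wpM2l ?exprn_ge0// ler_mul_le ?nc_ge0.
have i3 : nc (RB * (A * B + h * D)) <= 3 * 2 ^+ 12 * M / s ^+ 2 * t ^+ 2.
  rewrite ncM; have -> : 3 * 2 ^+ 12 * M / s ^+ 2 * t ^+ 2 =
     (32 / s ^+ 2 * t ^+ 2) * ((16 * M) * 16 + s / 4 * (2 ^+ 9 * M / s)).
    by field; exact: lt0r_neq0.
  apply: ler_mul_le; rewrite ?nc_ge0// (le_trans (ncD _ _))// !ncM ht.
  by rewrite lerD// ler_mul_le ?nc_ge0.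
have -> : 7 * 2 ^+ 15 * M / s ^+ 2 * t ^+ 2 = (2 ^+ 13 * M / s ^+ 2 * t ^+ 2 +
   2 ^+ 13 * M / s ^+ 2 * t ^+ 2 + 3 * 2 ^+ 12 * M / s ^+ 2 * t ^+ 2) * 8.
  by field; exact: lt0r_neq0.
apply: ler_mul_le; rewrite ?nc_ge0//.
by rewrite (le_trans (ncB _ _))// lerD// (le_trans (ncB _ _))// lerD.
Qed.

(** Mere differentiability on a square improves to a quadratic remainder with a constant depending
    only on [M] and [s]. This uniformity is the source of the analyticity of derivatives, of the
    Cauchy estimates and of the passage to limits of bounded families. *)
Lemma cauchy_taylor f w (s M : R) : 0 < s ->
  (forall z, Qrect w s z -> exists l, cdiff f z l) ->
  (forall z, Qrect w s z -> nc (f z) <= M) ->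
  exists d, [/\ cdiff f w d, nc d <= 2 ^+ 11 * M / s &
    forall h, nc h <= s / 4 ->
      nc (f (w + h) - f w - d * h) <= 7 * 2 ^+ 15 * M / s ^+ 2 * nc h ^+ 2].
Proof.
move=> s0 fd fM.
have M0 : 0 <= M by apply: le_trans (fM w (Qrect_center w s0)); exact: nc_ge0.
have fc z : bdQ (Re w - s) (Re w + s) (Im w - s) (Im w + s) z -> ccont f z.
  by move=> [zQ _]; have [l Hl] := fd z zQ; exact: cdiff_cont Hl.
have fm z : bdQ (Re w - s) (Re w + s) (Im w - s) (Im w + s) z -> nc (f z) <= M.
  by move=> [zQ _]; exact: fM.
have onec z : bdQ (Re w - s) (Re w + s) (Im w - s) (Im w + s) z -> ccont (fun=> 1 : C) z.
  by move=> _; exact: ccont_cst.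
have onem z : bdQ (Re w - s) (Re w + s) (Im w - s) (Im w + s) z -> nc (1 : C) <= 1.
  by move=> _; rewrite nc1.
pose J F := cauchyJ F (Re w - s) (Re w + s) (Im w - s) (Im w + s).
pose J2 F := cauchyJ2 F (Re w - s) (Re w + s) (Im w - s) (Im w + s).
pose A := J f w; pose A' := J2 f w; pose B := J (fun=> 1) w; pose B' := J2 (fun=> 1) w.
have F h : nc h <= s / 4 -> J f (w + h) = f (w + h) * J (fun=> 1) (w + h).
  move=> hs; apply: cauchy_formula fd.
    by rewrite ReD lt_width_shift// (le_trans (nc_Re h)).
  by rewrite ImD lt_width_shift// (le_trans (nc_Im h)).
have s4 : 0 <= s / 4 by rewrite divr_ge0// ltW.
have hA : nc A <= 16 * M := cauchyJ_bound s0 fc fm.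
have hA' : nc A' <= 16 * M / s := cauchyJ2_bound s0 fc fm.
have hB : nc B <= 16 by rewrite -[leRHS]mulr1; exact: cauchyJ_bound s0 onec onem.
have hB' : nc B' <= 16 / s by rewrite -[16 in leRHS]mulr1; exact: cauchyJ2_bound s0 onec onem.
have lB : 1 / 2 <= nc B by have := @winding_ge_half w 0 s s0; rewrite nc0 addr0; exact.
have B0 : B != 0 by rewrite -nc_gt0; apply: lt_le_trans lB; rewrite divr_gt0.
pose d := (A' * B - A * B') / B ^+ 2.
have fE h : nc h <= s / 4 -> f (w + h) = J f (w + h) / J (fun=> 1) (w + h).
  move=> hs; rewrite F// mulfK// -nc_gt0; apply: lt_le_trans (winding_ge_half w s0 hs).
  by rewrite divr_gt0.
have T h : nc h <= s / 4 ->
    nc (f (w + h) - f w - d * h) <= 7 * 2 ^+ 15 * M / s ^+ 2 * nc h ^+ 2.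
  move=> hs; rewrite fE// [f w](_ : _ = A / B); last first.
    by have := fE 0; rewrite addr0 nc0; exact.
  pose RA := J f (w + h) - A - h * A'; pose RB := J (fun=> 1) (w + h) - B - h * B'.
  have EA : J f (w + h) = A + h * A' + RA by rewrite /RA; ring.
  have EB : J (fun=> 1) (w + h) = B + h * B' + RB by rewrite /RB; ring.
  rewrite [d * h]mulrC EA EB; apply: quotient_taylor => //.
  - exact: nc_ge0.
  - exact: cauchyJ_taylor s0 fc fm _ hs.
  - by have := cauchyJ_taylor s0 onec onem hs; rewrite mulr1.
  - by rewrite -EB; exact: winding_ge_half.
exists d; split => //.
  move=> e e0; pose K : R := 7 * 2 ^+ 15 * M / s ^+ 2 + 1.
  have K0 : 0 < K by rewrite /K ltr_wpDl// divr_ge0 ?mulr_ge0 ?exprn_ge0// ltW.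
  exists (Num.min (s / 4) (e / K)); first by rewrite lt_min !divr_gt0.
  move=> h; rewrite lt_min => /andP[/ltW h1 /ltW]; rewrite ler_pdivlMr// => h2.
  rewrite (le_trans (T h h1))// expr2 mulrA ler_wpM2r ?nc_ge0//.
  apply: le_trans h2; rewrite mulrC ler_wpM2l ?nc_ge0//.
  by rewrite /K lerDl.
rewrite /d ncM ncV ncX.
have -> : 2 ^+ 11 * M / s = ((16 * M / s) * 16 + (16 * M) * (16 / s)) * (1 / 2) ^- 2.
  by field; exact: lt0r_neq0.
apply: ler_mul_le; rewrite ?invr_ge0 ?exprn_ge0 ?nc_ge0//.
  by rewrite (le_trans (ncB _ _))// !ncM lerD// ler_mul_le ?nc_ge0.
by rewrite lef_pV2 ?posrE ?exprn_gt0 ?(lt_le_trans _ lB)// ler_sqr ?nnegrE ?nc_ge0.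
Qed.

Lemma real_cauchy_lim (u : nat -> R) :
  (forall e, 0 < e -> exists N, forall n m, (N <= n)%N -> (N <= m)%N -> `|u n - u m| <= e) ->
  exists l, forall e, 0 < e -> exists N, forall n, (N <= n)%N -> `|u n - l| <= e.
Proof.
(* The limit is found as the lower limit, the supremum of the eventual lower bounds. *)
move=> H; pose S := [set x | exists N, forall n, (N <= n)%N -> x <= u n].
exists (sup S) => e e0; have [N HN] := H _ (divr_gt0 e0 (ltr0n _ 2)); exists N => n Nn.
have inS : S (u n - e / 2).
  by exists N => m Nm; have := HN _ _ Nn Nm; rewrite ler_norml => /andP[_]; lra.
have ubS : ubound S (u n + e / 2).
  move=> x [N' HN']; apply: le_trans (HN' (maxn N N') (leq_maxr _ _)) _.
  by have := HN _ _ Nn (leq_maxl N N'); rewrite ler_norml => /andP[+ _]; lra.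
have h1 : u n - e / 2 <= sup S by apply: ub_le_sup => //; exists (u n + e / 2).
have h2 : sup S <= u n + e / 2 by apply: ge_sup => //; exists (u n - e / 2).
by rewrite ler_norml; apply/andP; split; lra.
Qed.

Lemma complex_cauchy_lim (u : nat -> C) :
  (forall e : R, 0 < e -> exists N, forall n m, (N <= n)%N -> (N <= m)%N -> nc (u n - u m) <= e) ->
  exists l, forall e : R, 0 < e -> exists N, forall n, (N <= n)%N -> nc (u n - l) <= e.
Proof.
move=> H.
have [|x Hx] := @real_cauchy_lim (fun n => Re (u n)).
  move=> e /H [N HN]; exists N => n m Nn Nm; apply: le_trans (HN n m Nn Nm).
  by rewrite -ReN -ReD nc_Re.
have [|y Hy] := @real_cauchy_lim (fun n => Im (u n)).
  move=> e /H [N HN]; exists N => n m Nn Nm; apply: le_trans (HN n m Nn Nm).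
  by rewrite -ImN -ImD nc_Im.
exists ((x +i* y)%C : C) => e e0; have e2 : 0 < e / 2 by rewrite divr_gt0.
have [N HN] := Hx _ e2; have [N' HN'] := Hy _ e2; exists (maxn N N') => n.
rewrite geq_max => /andP[/HN h1 /HN' h2]; apply: le_trans (nc_le_ReIm _) _.
by rewrite ReD ImD ReN ImN /= (splitr e) lerD.
Qed.

Definition clim (u : nat -> C) (l : C) :=
  forall e : R, 0 < e -> exists N, forall n, (N <= n)%N -> nc (u n - l) <= e.

Lemma clim_le (u : nat -> C) l (K : R) : clim u l -> (forall n, nc (u n) <= K) -> nc l <= K.
Proof.
move=> L B; apply/ler_addgt0Pr => e /L [N /(_ N (leqnn N)) H].
have := nc_lowerB l (u N); rewrite ncBC lerBlDr => /le_trans; apply.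
by rewrite addrC lerD.
Qed.

(** At a fixed step [t] the derivatives are difference quotients up to [K * t], uniformly in [n], so
    pointwise convergence makes them a Cauchy sequence; the uniform quadratic remainder then passes
    to the limit. *)
Lemma bounded_limit_cdiff (fs : nat -> C -> C) f w (s M : R) : 0 < s ->
  (forall n z, Qrect w s z -> exists l, cdiff (fs n) z l) ->
  (forall n z, Qrect w s z -> nc (fs n z) <= M) ->
  (forall z, Qrect w s z -> clim (fs ^~ z) (f z)) ->
  exists d, cdiff f w d.
Proof.
move=> s0 fd fM lim.
have [ds Hds] := choice (fun n => cauchy_taylor s0 (fd n) (fM n)).
have M0 : 0 <= M by apply: le_trans (fM 0%N w (Qrect_center w s0)); exact: nc_ge0.
pose K : R := 7 * 2 ^+ 15 * M / s ^+ 2 + 1.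
have K0 : 0 < K by rewrite /K ltr_wpDl// divr_ge0 ?mulr_ge0 ?exprn_ge0// ltW.
have T n h : nc h <= s / 4 -> nc (fs n (w + h) - fs n w - ds n * h) <= K * nc h ^+ 2.
  move=> hs; have [_ _ H] := Hds n; rewrite (le_trans (H h hs))//.
  by rewrite ler_wpM2r ?exprn_ge0 ?nc_ge0// /K lerDl.
have inq h : nc h <= s / 4 -> Qrect w s (w + h).
  move=> hs; apply: Qrect_near; rewrite addrC addKr (le_trans hs)//.
  by rewrite ler_pdivrMr// ler_pMr// ler1n.
have [d Hd] : exists d, clim ds d.
  apply: complex_cauchy_lim => e e0.
  (* The two remainders at step [t] cost [e / 4] each; convergence at [w] and at [w + h] supplies
     the other half of [e]. *)
  pose t := Num.min (s / 4) (e / (4 * K)).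
  have t0 : 0 < t by rewrite lt_min !divr_gt0// mulr_gt0.
  have tK : K * t <= e / 4.
    have -> : e / 4 = K * (e / (4 * K)) by field; exact: lt0r_neq0.
    by rewrite ler_pM2l// ge_min lexx orbT.
  pose h : C := (t%:C)%C.
  have ht : nc h = t by rewrite nc_real ger0_norm// ltW.
  have hs : nc h <= s / 4 by rewrite ht ge_min lexx.
  have et0 : 0 < e / 8 * t by rewrite mulr_gt0// divr_gt0.
  have [N1 H1] := lim _ (inq _ hs) _ et0.
  have [N2 H2] := lim _ (Qrect_center w s0) _ et0.
  exists (maxn N1 N2) => n m; rewrite !geq_max => /andP[n1 n2] /andP[m1 m2].
  have {}H1 : nc (fs n (w + h) - fs m (w + h)) <= e / 4 * t.
    have -> : fs n (w + h) - fs m (w + h) =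
      (fs n (w + h) - f (w + h)) - (fs m (w + h) - f (w + h)) by ring.
    rewrite (le_trans (ncB _ _))//; have := H1 n n1; have := H1 m m1; lra.
  have {}H2 : nc (fs n w - fs m w) <= e / 4 * t.
    have -> : fs n w - fs m w = (fs n w - f w) - (fs m w - f w) by ring.
    rewrite (le_trans (ncB _ _))//; have := H2 n n2; have := H2 m m2; lra.
  have h0 : 0 < nc h by rewrite ht.
  rewrite -(ler_pM2r h0) -ncM.
  have -> : (ds n - ds m) * h = (fs m (w + h) - fs m w - ds m * h) -
    (fs n (w + h) - fs n w - ds n * h) + (fs n (w + h) - fs m (w + h)) - (fs n w - fs m w).
    by ring.
  rewrite (le_trans (ncB _ _))//; apply: le_trans (lerD (ncD _ _) (lexx _)) _.
  apply: le_trans (lerD (lerD (ncB _ _) (lexx _)) (lexx _)) _.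
  have Tn := T n h hs; have Tm := T m h hs; rewrite ht in Tn Tm *.
  have tK2 : K * t ^+ 2 <= e / 4 * t by rewrite expr2 mulrA ler_pM2r.
  move: H1 H2 Tn Tm tK2.
  set u1 := nc _; set u2 := nc _; set u3 := nc _; set u4 := nc _; set v := K * _.
  by clearbody u1 u2 u3 u4 v; clear; lra.
exists d => e e0.
exists (Num.min (s / 4) (e / K)); first by rewrite lt_min !divr_gt0.
move=> h; rewrite lt_min => /andP[/ltW hs /ltW]; rewrite ler_pdivlMr// => h2.
apply: le_trans (_ : K * nc h ^+ 2 <= _); last first.
  rewrite expr2 mulrA ler_wpM2r ?nc_ge0//.
  by apply: le_trans h2; rewrite mulrC.
apply: (@clim_le (fun n => fs n (w + h) - fs n w - ds n * h)); last by move=> n; exact: T.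
move=> e1 e10; have e3 : 0 < e1 / 3 by rewrite divr_gt0.
have k0 : 0 < nc h + 1 by rewrite ltr_wpDl ?nc_ge0.
have [N1 H1] := lim _ (inq _ hs) _ e3.
have [N2 H2] := lim _ (Qrect_center w s0) _ e3.
have [N3 H3] := Hd _ (divr_gt0 e3 k0).
exists (maxn N1 (maxn N2 N3)) => n; rewrite !geq_max => /and3P[/H1 n1 /H2 n2 /H3 n3].
have -> : fs n (w + h) - fs n w - ds n * h - (f (w + h) - f w - d * h) =
  (fs n (w + h) - f (w + h)) - (fs n w - f w) - (ds n - d) * h by ring.
rewrite (le_trans (ncB _ _))//; apply: le_trans (lerD (ncB _ _) (lexx _)) _.
have n4 : nc ((ds n - d) * h) <= e1 / 3.
  rewrite ncM; apply: le_trans (_ : e1 / 3 / (nc h + 1) * (nc h + 1) <= _).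
    by apply: ler_mul_le; rewrite ?nc_ge0// lerDl.
  by rewrite divfK// lt0r_neq0.
have -> : e1 = e1 / 3 + e1 / 3 + e1 / 3 by field.
by rewrite !lerD.
Qed.

End Regularity.

(** * Holomorphic functions in the disc and Cauchy estimates *)

Section HolomorphicDisc.
Variable R : realType.
Local Notation C := (R[i])^o.
Local Notation Re := complex.Re.
Local Notation Im := complex.Im.
Implicit Types (f g : C -> C) (z w : C).

Definition eta (z : C) : R := 1 - nc z.

Lemma eta_gt0 z : (0 < eta z) = (nc z < 1).
Proof. by rewrite subr_gt0. Qed.

Lemma eta_le1 z : eta z <= 1.
Proof. by rewrite lerBlDr lerDl nc_ge0. Qed.

Lemma eta_dist z w : eta w - nc (z - w) <= eta z.
Proof.
by rewrite /eta; have := nc_lowerB z w; lra.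
Qed.

Lemma Qrect_dist w (s : R) z : Qrect w s z -> nc (z - w) <= 2 * s.
Proof.
move=> [/andP[h1 h2] /andP[h3 h4]]; apply: le_trans (nc_le_ReIm _) _.
rewrite ReD ImD ReN ImN mulr_natl mulr2n lerD// ler_norml lerBrDr lerBlDr addrC.
  by rewrite h1 addrC h2.
by rewrite h3 addrC h4.
Qed.

Lemma Qrect_eta w (s : R) z : Qrect w s z -> eta w - 2 * s <= eta z.
Proof. by move=> /Qrect_dist H; apply: le_trans (eta_dist z w); rewrite lerD2l lerN2. Qed.

Lemma Qrect_disc w (s : R) z : 2 * s < eta w -> Qrect w s z -> disc z.
Proof. by move=> sw /Qrect_eta H; rewrite /disc /= -eta_gt0; apply: lt_le_trans H;
  rewrite subr_gt0. Qed.

Lemma Qrect_trans w z u (s t : R) : Qrect w s z -> Qrect z t u -> Qrect w (s + t) u.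
Proof.
move=> [/andP[h1 h2] /andP[h3 h4]] [/andP[k1 k2] /andP[k3 k4]].
by split; apply/andP; split; lra.
Qed.

Lemma holo_cdiff f z : holo f -> disc z -> cdiff f z (derive1 f z).
Proof. by move=> H zD; apply/derivable_cdiff/H. Qed.

Lemma holo_cdiff_ex f z : holo f -> disc z -> exists l, cdiff f z l.
Proof. by move=> H zD; exists (derive1 f z); exact: holo_cdiff. Qed.

Lemma holoP f : (forall z, disc z -> exists l, cdiff f z l) -> holo f.
Proof. by move=> H z /H[l]; exact: cdiff_derivable. Qed.

Lemma holo_ccont f z : holo f -> disc z -> ccont f z.
Proof. by move=> H zD; exact: cdiff_cont (holo_cdiff H zD). Qed.

Lemma disc_nbhs z w : disc z -> nc (w - z) < eta z -> disc w.
Proof.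
move=> _ H; rewrite /disc/= -eta_gt0; apply: lt_le_trans (eta_dist w z).
by rewrite subr_gt0.
Qed.

(** Functions are total on [C] but only their values in the disc are under control, so derivatives
    are compared through agreement near the point. *)
Lemma derive1_eq_disc f g z : disc z -> (forall w, disc w -> f w = g w) ->
  holo g -> derive1 f z = derive1 g z.
Proof.
move=> zD E hg; apply: cdiff_derive1; have e0 : 0 < eta z by rewrite eta_gt0.
by apply: (cdiff_near e0 _ (holo_cdiff hg zD)) => w wz; rewrite E//; exact: disc_nbhs zD wz.
Qed.

Lemma holo_ext f g : (forall w, disc w -> f w = g w) -> holo f -> holo g.
Proof.
move=> E hf; apply: holoP => z zD; have e0 : 0 < eta z by rewrite eta_gt0.
exists (derive1 f z).
by apply: (cdiff_near e0 _ (holo_cdiff hf zD)) => w wz; rewrite E//; exact: disc_nbhs zD wz.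
Qed.

(** The derivative is a limit of difference quotients with real steps, which [cauchy_taylor] bounds
    uniformly on a square; [bounded_limit_cdiff] then differentiates the limit. *)
Lemma holo_derive1 f : holo f -> holo (derive1 f).
Proof.
move=> hf; apply: holoP => w wD; have e0 : 0 < eta w by rewrite eta_gt0.
(* A square of half-side [s] about any point of [Qrect w s] has to remain in the disc, hence the
   room for half-side [s + s]. *)
pose s := eta w / 8; have s0 : 0 < s by rewrite divr_gt0.
have s2 : 2 * (s + s) < eta w by rewrite /s; lra.
have Qc z : Qrect w (s + s) z -> ccont f z.
  by move=> /(Qrect_disc s2); exact: holo_ccont.
have [|||M M0 HM] := @bounded_on_rect R f (Re w - (s + s)) (Re w + (s + s))
    (Im w - (s + s)) (Im w + (s + s)); [by clear -s0; lra|by clear -s0; lra|exact: Qc|].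
pose h n : R := s / 4 / n.+1%:R.
have h0 n : 0 < h n by rewrite !divr_gt0.
have hs n : h n <= s / 4 by rewrite ler_pdivrMr// ler_peMr ?ler1n// divr_ge0// ltW.
have nch n : nc ((h n)%:C%C : C) = h n by rewrite nc_real ger0_norm// ltW.
have hC0 n : (h n)%:C%C != 0 :> C by rewrite -nc_gt0 nch.
have T z : Qrect w s z -> nc (derive1 f z) <= 2 ^+ 11 * M / s /\
   forall k, nc k <= s / 4 ->
      nc (f (z + k) - f z - derive1 f z * k) <= 7 * 2 ^+ 15 * M / s ^+ 2 * nc k ^+ 2.
  move=> zQ; have [||d [Hd H1 H2]] := @cauchy_taylor R f z s M s0.
  - by move=> u /(Qrect_trans zQ) /(Qrect_disc s2); exact: holo_cdiff_ex.
  - by move=> u /(Qrect_trans zQ); exact: HM.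
  by rewrite (cdiff_derive1 Hd).
set K1 := 2 ^+ 11 * M / s in T; set K2 := 7 * 2 ^+ 15 * M / s ^+ 2 in T.
have K20 : 0 <= K2 by rewrite divr_ge0 ?mulr_ge0 ?exprn_ge0// ltW.
pose fs n z := (f (z + (h n)%:C%C) - f z) * ((h n)%:C%C)^-1.
have D n z : Qrect w s z -> nc (fs n z - derive1 f z) <= K2 * h n.
  move=> zQ; have [_ H] := T z zQ.
  have := H _ (_ : nc (h n)%:C%C <= s / 4); rewrite nch => /(_ (hs n)).
  have -> : fs n z - derive1 f z =
     (f (z + (h n)%:C%C) - f z - derive1 f z * (h n)%:C%C) * ((h n)%:C%C)^-1.
    by rewrite /fs [RHS]mulrBl mulfK.
  by rewrite ncM ncV nch ler_pdivrMr// expr2 mulrA.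
apply: (@bounded_limit_cdiff R fs (derive1 f) w s (K1 + K2 * (s / 4)) s0).
- move=> n z zQ; have zD : disc z by apply: Qrect_disc zQ; clear -s2 s0; lra.
  have zhD : disc (z + (h n)%:C%C).
    apply: (Qrect_disc s2); apply: (Qrect_trans zQ); apply: Qrect_near.
    by rewrite addrC addKr nch (le_trans (hs n))// ler_pdivrMr// ler_pMr// ler1n.
  have D1 := cdiffD (cdiff_id z) (cdiff_cst (h n)%:C%C z).
  have D2 := @cdiff_comp R f (fun u => u + (h n)%:C%C) z _ _ D1 (holo_cdiff hf zhD).
  by have := cdiffM (cdiffB D2 (holo_cdiff hf zD)) (cdiff_cst ((h n)%:C%C)^-1 z); eexists;
    eassumption.
- move=> n z zQ; have [H1 _] := T z zQ.
  rewrite -[fs n z](subrK (derive1 f z)) (le_trans (ncD _ _))// addrC lerD//.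
  by rewrite (le_trans (D n z zQ))// ler_wpM2l.
- move=> z zQ e e0'.
  have [N HN] : exists N, K2 * (s / 4) / e < N.+1%:R.
    exists (Num.truncn (K2 * (s / 4) / e)); apply: truncnS_gt.
  exists N => n Nn; rewrite (le_trans (D n z zQ))// /h mulrA ler_pdivrMr//.
  rewrite [leRHS]mulrC -ler_pdivrMr//; apply: le_trans (ltW HN) _.
  by rewrite ler_nat.
Qed.

Lemma holo_derive1n f l : holo f -> holo (derive1n l f).
Proof. by move=> hf; elim: l => [//|l IH]; rewrite /derive1n iterS; exact: holo_derive1. Qed.

Lemma cauchy_estimate f w (s M : R) : holo f -> 0 < s -> 2 * s < eta w ->
  (forall z, Qrect w s z -> nc (f z) <= M) -> nc (derive1 f w) <= 2 ^+ 11 * M / s.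
Proof.
move=> hf s0 sw B.
have [||d [Hd H1 H2]] := @cauchy_taylor R f w s M s0.
- by move=> u /(Qrect_disc sw); exact: holo_cdiff_ex.
- exact: B.
by rewrite (cdiff_derive1 Hd).
Qed.

Lemma cauchy_lipschitz f w (s M : R) h : holo f -> 0 < s -> 2 * s < eta w ->
  (forall z, Qrect w s z -> nc (f z) <= M) -> nc h <= s / 4 ->
  nc (f (w + h) - f w) <= 2 ^+ 17 * M / s * nc h.
Proof.
move=> hf s0 sw B hs.
have M0 : 0 <= M by apply: le_trans (B w (Qrect_center w s0)); exact: nc_ge0.
have [||d [Hd H1 H2]] := @cauchy_taylor R f w s M s0.
- by move=> u /(Qrect_disc sw); exact: holo_cdiff_ex.
- exact: B.
have -> : f (w + h) - f w = (f (w + h) - f w - d * h) + d * h by rewrite subrK.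
rewrite (le_trans (ncD _ _))// ncM.
apply: le_trans (lerD (H2 h hs) (ler_wpM2r (nc_ge0 h) H1)) _.
have X : 7 * 2 ^+ 15 * M / s ^+ 2 * nc h ^+ 2 <= 7 * 2 ^+ 13 * M / s * nc h.
  have -> : 7 * 2 ^+ 13 * M / s * nc h = 7 * 2 ^+ 15 * M / s ^+ 2 * nc h * (s / 4).
    by field; exact: lt0r_neq0.
  rewrite (expr2 (nc h)) [leLHS]mulrA ler_wpM2l//.
  by rewrite mulr_ge0 ?nc_ge0// divr_ge0 ?mulr_ge0 ?exprn_ge0// ltW.
apply: le_trans (lerD X (lexx _)) _; rewrite -mulrDl ler_wpM2r ?nc_ge0//.
rewrite -mulrDl ler_wpM2r ?invr_ge0 ?(ltW s0)// -mulrDl ler_wpM2r//.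
by rewrite !exprS expr0; lra.
Qed.

(** Each derivative gives up half of the square: the induction hypothesis bounds the [l]-th
    derivative on the square of half size, where the first-order estimate is applied to it. *)
Lemma cauchy_estimate_n l : exists2 K : R, 0 <= K & forall f w (s M : R),
  holo f -> 0 < s -> 2 * s < eta w -> (forall z, Qrect w s z -> nc (f z) <= M) ->
  nc (derive1n l f w) <= K * M / s ^+ l.
Proof.
elim: l => [|l [K K0 IH]].
  exists 1 => // f w s M hf s0 sw B; rewrite expr0 divr1 mul1r /derive1n/=.
  exact/B/Qrect_center.
exists (2 ^+ 11 * K * 2 ^+ l.+1); first by rewrite !mulr_ge0 ?exprn_ge0.
move=> f w s M hf s0 sw B; rewrite /derive1n iterS -/(derive1n l f).
have s20 : 0 < s / 2 by rewrite divr_gt0.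
have := @cauchy_estimate (derive1n l f) w (s / 2) (K * M / (s / 2) ^+ l) (holo_derive1n hf) s20.
have -> : 2 ^+ 11 * (K * M / (s / 2) ^+ l) / (s / 2) = 2 ^+ 11 * K * 2 ^+ l.+1 * M / s ^+ l.+1.
  rewrite expr_div_n !exprS.
  have h1 : 2 ^+ l != 0 :> R by exact: expf_neq0.
  have h2 : s ^+ l != 0 by rewrite expf_neq0// lt0r_neq0.
  have h3 : s != 0 by rewrite lt0r_neq0.
  by field; rewrite h1 h2 h3.
apply; first by apply: le_lt_trans sw; rewrite mulrC divfK// ler_peMl ?ler1n// ltW.
move=> z zQ; apply: IH => //.
  have := Qrect_eta zQ; rewrite mulrC divfK// => H; apply: lt_le_trans H.
  by rewrite ltrBrDr -mulr2n -mulr_natl.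
move=> u zu; apply: B; have := Qrect_trans zQ zu; by rewrite -splitr.
Qed.

End HolomorphicDisc.

(** * Integration over the plane and the mean value inequality *)

Section PlaneIntegral.
Variable R : realType.
Local Notation C := (R[i])^o.
Local Notation lam := (@leb2 R).
Implicit Types (A B : set (R * R)) (g h : C -> R).

Definition dcell (n : nat) (i j : int) : set (R * R) := [set t |
  (i%:~R <= 2 ^+ n * t.1 < (i + 1)%:~R) && (j%:~R <= 2 ^+ n * t.2 < (j + 1)%:~R)].

Let pow2_gt0 n : 0 < 2 ^+ n :> R. Proof. exact: exprn_gt0. Qed.

Lemma dcellE n i j : dcell n i j =
  `[i%:~R / 2 ^+ n, (i + 1)%:~R / 2 ^+ n[%classic `*`
  `[j%:~R / 2 ^+ n, (j + 1)%:~R / 2 ^+ n[%classic.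
Proof.
apply/seteqP; split => -[x y]; rewrite /dcell /= !in_itv/= !ler_pdivrMr// !ltr_pdivlMr//.
  by rewrite ![2 ^+ n * _]mulrC => /andP[-> ->].
by rewrite ![2 ^+ n * _]mulrC => -[-> ->].
Qed.

Lemma measurable_dcell n i j : measurable (dcell n i j).
Proof. by rewrite dcellE; apply: measurableX. Qed.

Lemma leb2_dcell n i j : lam (dcell n i j) = ((2 ^- n) ^+ 2)%:E.
Proof.
rewrite dcellE /leb2 product_measure1E//= !lebesgue_measure_itv/= !lte_fin.
rewrite !ltr_pM2r ?invr_gt0// !ltr_int !ltzD1 !lexx -!EFinB.
have E (k : int) : (k + 1)%:~R / 2 ^+ n - k%:~R / 2 ^+ n = 2 ^- n :> R.
  by rewrite -mulrBl intrD addrAC subrr add0r mul1r.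
by rewrite !E -EFinM expr2.
Qed.

Lemma mem_dcell n t : dcell n (Num.floor (2 ^+ n * t.1)) (Num.floor (2 ^+ n * t.2)) t.
Proof. by rewrite /dcell /= !floor_itv. Qed.

Lemma dcell_floor n i j t : dcell n i j t ->
  i = Num.floor (2 ^+ n * t.1) /\ j = Num.floor (2 ^+ n * t.2).
Proof. by move=> /andP[/floor_def -> /floor_def ->]. Qed.

Lemma dcell_dist n i j t u : dcell n i j t -> dcell n i j u ->
  `|t.1 - u.1| <= 2 ^- n /\ `|t.2 - u.2| <= 2 ^- n.
Proof.
have K (x y : R) (k : int) : k%:~R <= 2 ^+ n * x < (k + 1)%:~R ->
    k%:~R <= 2 ^+ n * y < (k + 1)%:~R -> `|x - y| <= 2 ^- n.
  rewrite intrD => /andP[h1 h2] /andP[h3 h4].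
  rewrite -(ler_pM2l (pow2_gt0 n)) mulfV ?lt0r_neq0//.
  rewrite -[2 ^+ n in leLHS]gtr0_norm// -normrM mulrBr ler_norml; apply/andP; split.
    by move: h1 h2 h3 h4; set a := 2 ^+ n * x; set b := 2 ^+ n * y; lra.
  by move: h1 h2 h3 h4; set a := 2 ^+ n * x; set b := 2 ^+ n * y; lra.
by move=> /andP[h1 h2] /andP[h3 h4]; split; [exact: K h1 h3|exact: K h2 h4].
Qed.

Lemma exists_pow2_lt (r : R) : 0 < r -> exists n, 2 ^- n < r.
Proof.
move=> r0; have [n Hn] : exists n, r^-1 < n%:R.
  by exists (Num.truncn r^-1).+1; exact: truncnS_gt.
exists n; rewrite invf_plt ?posrE//; apply: lt_le_trans Hn _.
rewrite -natrX ler_nat; exact: ltnW (ltn_expl _ _).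
Qed.

Definition planar_open A := forall t, A t -> exists2 r : R, 0 < r &
  forall u : R * R, `|u.1 - t.1| < r -> `|u.2 - t.2| < r -> A u.

(** An open set is the union of the countably many dyadic cells it contains, which gives
    measurability for the product sigma-algebra directly. *)
Lemma planar_open_measurable A : planar_open A -> measurable A.
Proof.
move=> oA; pose F (k : nat * int * int) : set (R * R) :=
  if `[< dcell k.1.1 k.1.2 k.2 `<=` A >] then dcell k.1.1 k.1.2 k.2 else set0.
have -> : A = \bigcup_k F k.
  apply/seteqP; split => [t At|t [[[n i] j] _]]; last first.
    by rewrite /F /=; case: asboolP => // S /S.
  have [r r0 Hr] := oA t At; have [n Hn] := exists_pow2_lt r0.
  exists (n, Num.floor (2 ^+ n * t.1), Num.floor (2 ^+ n * t.2)) => //.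
  rewrite /F /=; case: asboolP => [_|[]]; first exact: mem_dcell.
  move=> u /dcell_dist /(_ (mem_dcell n t)) [h1 h2].
  by apply: Hr; apply: le_lt_trans Hn.
apply: countable_bigcupT_measurable => // -[[n i] j]; rewrite /F/=.
by case: asboolP => _; [exact: measurable_dcell|exact: measurable0].
Qed.

Definition cmeas A g := measurable_fun A (fun t : R * R => g (cpt t)).

Lemma lipschitz_cmeas A (f : C -> C) (phi : C -> R) : planar_open A ->
  (forall z w, `|phi z - phi w| <= nc (z - w)) ->
  (forall t, A t -> ccont f (cpt t)) -> cmeas A (fun z => phi (f z)).
Proof.
move=> oA L F; apply: (measurability _ (RGenOInfty.measurableE R)).
move=> _ [_ [a ->] <-]; apply: planar_open_measurable => t [At /=].
rewrite in_itv/= andbT => H; have [r r0 Hr] := oA t At.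
have d0 : 0 < (phi (f (cpt t)) - a) / 2 by rewrite divr_gt0// subr_gt0.
have [s s0 Hs] := F t At _ d0; pose m := Num.min r (s / 2).
exists m; first by rewrite lt_min r0 divr_gt0.
move=> u; rewrite !lt_min => /andP[u1 u2] /andP[u3 u4]; split; first exact: Hr.
rewrite /= in_itv/= andbT.
have /Hs : nc (cpt u - cpt t) < s.
  by apply: le_lt_trans (nc_le_ReIm _) _; rewrite ReD ImD ReN ImN /= (splitr s) ltrD.
rewrite subrKC => /(le_trans (L _ _)); rewrite ler_norml => /andP[+ _].
move: H; set p := phi _; set q := phi _; clear; lra.
Qed.

(** Taken against [leb2] without the factor 1/pi that [pint] carries; [pintE] restores it. *)
Definition iint A g : \bar R := (\int[lam]_(t in A) (g (cpt t))%:E)%E.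

Let Dset := [set t : R * R | disc (cpt t)].

Lemma disc_planar_open : planar_open Dset.
Proof.
move=> t Dt; exists (eta (cpt t) / 2); first by rewrite divr_gt0// eta_gt0.
move=> u u1 u2; apply: (disc_nbhs Dt).
by apply: le_lt_trans (nc_le_ReIm _) _; rewrite ReD ImD ReN ImN /= (splitr (eta _)) ltrD.
Qed.

Lemma measurable_disc : measurable Dset.
Proof. exact: planar_open_measurable disc_planar_open. Qed.

Lemma holo_cmeas_nc (f : C -> C) : holo f -> cmeas Dset (fun z => nc (f z)).
Proof.
move=> hf; apply: lipschitz_cmeas; [exact: disc_planar_open|exact: lip_nc|].
by move=> t Dt; exact: holo_ccont.
Qed.

Lemma holo_cmeas_Re (f : C -> C) : holo f -> cmeas Dset (fun z => complex.Re (f z)).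
Proof.
move=> hf; apply: lipschitz_cmeas; [exact: disc_planar_open|exact: lip_Re|].
by move=> t Dt; exact: holo_ccont.
Qed.

Lemma holo_cmeas_Im (f : C -> C) : holo f -> cmeas Dset (fun z => complex.Im (f z)).
Proof.
move=> hf; apply: lipschitz_cmeas; [exact: disc_planar_open|exact: lip_Im|].
by move=> t Dt; exact: holo_ccont.
Qed.

Lemma cmeasS A B g : measurable B -> A `<=` B -> cmeas B g -> cmeas A g.
Proof. by move=> mB AB; exact: measurable_funS. Qed.

Lemma eq_cmeas A g h : (forall t, A t -> g (cpt t) = h (cpt t)) -> cmeas A g -> cmeas A h.
Proof. by move=> E; apply: eq_measurable_fun => t; rewrite inE => /E ->. Qed.

Lemma cmeas_cst A k : cmeas A (fun=> k).
Proof. exact: measurable_cst. Qed.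

Lemma cmeasM A g h : cmeas A g -> cmeas A h -> cmeas A (fun z => g z * h z).
Proof. exact: measurable_funM. Qed.

Lemma cmeasD A g h : cmeas A g -> cmeas A h -> cmeas A (fun z => g z + h z).
Proof. exact: measurable_funD. Qed.

Lemma cmeasB A g h : cmeas A g -> cmeas A h -> cmeas A (fun z => g z - h z).
Proof. exact: measurable_funB. Qed.

Lemma cmeas_sum A (I : Type) (s : seq I) (P : pred I) (g : I -> C -> R) :
  (forall i, P i -> cmeas A (g i)) -> cmeas A (fun z => \sum_(i <- s | P i) g i z).
Proof.
move=> H; elim: s => [|i s IH].
  by apply: (@eq_cmeas A (fun=> 0)); [move=> t _; rewrite big_nil|exact: cmeas_cst].
case Pi : (P i); last first.
  by apply: (eq_cmeas _ IH) => t _; rewrite big_cons Pi.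
by apply: (eq_cmeas _ (cmeasD (H i Pi) IH)) => t _; rewrite big_cons Pi.
Qed.

Lemma cmeas_powR A g p : cmeas A g -> cmeas A (fun z => g z `^ p).
Proof. by move=> H; exact: (measurableT_comp (measurable_powR p) H). Qed.

Lemma cmeasX A g n : cmeas A g -> cmeas A (fun z => g z ^+ n).
Proof. exact: measurable_funX. Qed.

Lemma cmeasV A g : (forall t, A t -> 0 <= g (cpt t)) -> cmeas A g -> cmeas A (fun z => (g z)^-1).
Proof.
move=> g0 H; apply: (eq_cmeas _ (cmeas_powR (-1) H)) => t At.
by rewrite powR_inv1// g0.
Qed.

Lemma cmeas_eta : cmeas Dset (@eta R).
Proof.
apply: cmeasB; first exact: cmeas_cst.
by apply: (@holo_cmeas_nc id); apply: holoP => z _; exists 1; exact: cdiff_id.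
Qed.

Lemma iint_ge0 A g : (forall t, A t -> 0 <= g (cpt t)) -> (0 <= iint A g)%E.
Proof. by move=> H; apply: integral_ge0 => t At; rewrite lee_fin H. Qed.

Lemma iint_le A g h : measurable A -> cmeas A g -> cmeas A h ->
  (forall t, A t -> 0 <= g (cpt t)) -> (forall t, A t -> g (cpt t) <= h (cpt t)) ->
  (iint A g <= iint A h)%E.
Proof.
move=> mA mg mh g0 gh; apply: ge0_le_integral => //.
1-2: exact/measurable_EFinP.
Qed.

Lemma eq_iint A g h : (forall t, A t -> g (cpt t) = h (cpt t)) -> iint A g = iint A h.
Proof. by move=> E; apply: eq_integral => t; rewrite inE => /E ->. Qed.

Lemma iintZ A k g : measurable A -> cmeas A g -> (forall t, A t -> 0 <= g (cpt t)) ->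
  0 <= k -> iint A (fun z => k * g z) = (k%:E * iint A g)%E.
Proof.
move=> mA mg g0 k0; rewrite /iint; under eq_integral do rewrite EFinM.
by rewrite ge0_integralZl_EFin//; exact/measurable_EFinP.
Qed.

Lemma iintD A g h : measurable A -> cmeas A g -> cmeas A h ->
  (forall t, A t -> 0 <= g (cpt t)) -> (forall t, A t -> 0 <= h (cpt t)) ->
  iint A (fun z => g z + h z) = (iint A g + iint A h)%E.
Proof.
move=> mA mg mh g0 h0; rewrite /iint; under eq_integral do rewrite EFinD.
by rewrite ge0_integralD//; exact/measurable_EFinP.
Qed.

Lemma iint_sum A (I : Type) (s : seq I) (P : pred I) (g : I -> C -> R) : measurable A ->
  (forall i, P i -> cmeas A (g i)) -> (forall i t, P i -> A t -> 0 <= g i (cpt t)) ->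
  iint A (fun z => \sum_(i <- s | P i) g i z) = (\sum_(i <- s | P i) iint A (g i))%E.
Proof.
move=> mA mg g0; elim: s => [|i s IH].
  rewrite big_nil (@eq_iint _ _ (fun=> 0)); first by rewrite /iint integral0.
  by move=> t _; rewrite big_nil.
case Pi : (P i); last first.
  by rewrite big_cons Pi -IH; apply: eq_iint => t _; rewrite big_cons Pi.
rewrite big_cons Pi -IH -iintD//.
- by apply: eq_iint => t _; rewrite big_cons Pi.
- exact: mg.
- exact: cmeas_sum.
- by move=> t; exact: g0.
- by move=> t At; apply: sumr_ge0 => k Pk; exact: g0.
Qed.

Lemma iint_subset A B g : measurable A -> measurable B -> cmeas B g ->
  (forall t, B t -> 0 <= g (cpt t)) -> A `<=` B -> (iint A g <= iint B g)%E.
Proof.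
move=> mA mB mg g0 AB; apply: ge0_subset_integral => //; exact/measurable_EFinP.
Qed.

Lemma iint_cst A k : measurable A -> iint A (fun=> k) = (k%:E * lam A)%E.
Proof. by move=> mA; rewrite /iint integral_cst. Qed.

End PlaneIntegral.

Notation Dset R := [set t : R * R | disc (cpt t)].

(** * Lines carrying at most twice the average mass *)

Section MeanValue.
Variable R : realType.
Local Notation C := (R[i])^o.
Local Notation pt x y := ((x +i* y)%C : C).
Local Notation Re := complex.Re.
Local Notation Im := complex.Im.
Local Notation mu := (@lebesgue_measure R).
Local Notation lam := (@leb2 R).
Implicit Types (f g : C -> C) (z w : C).

Section GoodLine.
Variables (I J : set R) (g : R * R -> R).
Hypotheses (mI : measurable I) (mJ : measurable J).
Hypothesis g0 : forall t, (I `*` J) t -> 0 <= g t.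
Hypothesis mg : measurable_fun (I `*` J) g.

Let G : R * R -> \bar R := (EFin \o g) \_ (I `*` J).

Let mG : measurable_fun setT G.
Proof.
apply/(measurable_restrictT _ _).1; first exact: measurableX.
exact/measurable_EFinP.
Qed.

Let G0 t : (0 <= G t)%E.
Proof. by rewrite /G patchE; case: ifPn => // tB; rewrite lee_fin g0// -in_setE. Qed.

Let sectiony y : J y -> (\int[mu]_x G (x, y) = \int[mu]_(x in I) (g (x, y))%:E)%E.
Proof.
move=> Jy; rewrite [RHS]integral_mkcond; apply: eq_integral => x _.
rewrite /G !patchE; congr (if _ then _ else _).
by apply/idP/idP; rewrite !inE /=; [case|move=> ?; split].
Qed.

Let sectionx x : I x -> (\int[mu]_y G (x, y) = \int[mu]_(y in J) (g (x, y))%:E)%E.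
Proof.
move=> Ix; rewrite [RHS]integral_mkcond; apply: eq_integral => y _.
rewrite /G !patchE; congr (if _ then _ else _).
by apply/idP/idP; rewrite !inE /=; [case|move=> ?; split].
Qed.

(** Otherwise [H] would exceed [2 * A / (d - c)] on the whole segment and its integral would be at
    least [2 * A]. *)
Let average (H : R -> \bar R) (c d A : R) : c < d -> 0 < A ->
  measurable_fun setT H -> (forall y, 0 <= H y)%E -> (\int[mu]_y H y <= A%:E)%E ->
  exists2 y, c <= y <= d & (H y <= (2 * A / (d - c))%:E)%E.
Proof.
move=> cd A0 mH H0 HA; apply: contrapT => N.
have K : (\int[mu]_(y in `[c, d]) (2 * A / (d - c))%:E <= \int[mu]_y H y)%E.
  apply: le_trans (_ : (\int[mu]_(y in `[c, d]) H y <= _)%E); last first.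
    by apply: ge0_subset_integral.
  apply: ge0_le_integral => //.
  - by move=> y _; rewrite lee_fin divr_ge0 ?mulr_ge0// ?subr_ge0 ltW.
  - exact: measurable_funTS.
  - move=> y; rewrite /= in_itv/= => ycd; apply/ltW; rewrite ltNge; apply/negP => yH.
    by apply: N; exists y.
have := le_trans K HA; rewrite integral_cst//= lebesgue_measure_itv/= lte_fin cd -EFinB -EFinM.
by rewrite lee_fin divfK ?subr_eq0 ?gt_eqF//; lra.
Qed.

Lemma good_horizontal (c d A : R) : J = `[c, d]%classic -> c < d -> 0 < A ->
  (\int[lam]_(t in I `*` J) (g t)%:E <= A%:E)%E ->
  exists2 y, c <= y <= d & (\int[mu]_(x in I) (g (x, y))%:E <= (2 * A / (d - c))%:E)%E.
Proof.
move=> JE cd A0; rewrite integral_mkcond -/G /leb2 fubini_tonelli2// => HA.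
have [||y ycd Hy] := average cd A0 _ _ HA.
- exact: measurable_fun_fubini_tonelli_G.
- by move=> y; apply: integral_ge0.
by exists y => //; rewrite -sectiony// JE /= in_itv.
Qed.

Lemma good_vertical (a b A : R) : I = `[a, b]%classic -> a < b -> 0 < A ->
  (\int[lam]_(t in I `*` J) (g t)%:E <= A%:E)%E ->
  exists2 x, a <= x <= b & (\int[mu]_(y in J) (g (x, y))%:E <= (2 * A / (b - a))%:E)%E.
Proof.
move=> IE ab A0; rewrite integral_mkcond -/G /leb2 fubini_tonelli1// => HA.
have [||x xab Hx] := average ab A0 _ _ HA.
- exact: measurable_fun_fubini_tonelli_F.
- by move=> x; apply: integral_ge0.
by exists x => //; rewrite -sectionx// IE /= in_itv.
Qed.

End GoodLine.

Lemma RI_le f (phi : C -> R) a b c d (K1 K2 K3 K4 : R) : a <= b -> c <= d ->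
  RIok f a b c d ->
  (forall z, bdQ a b c d z -> nc (f z) <= phi z) ->
  mu.-integrable `[a, b] (EFin \o (fun x => phi (pt x c))) ->
  mu.-integrable `[a, b] (EFin \o (fun x => phi (pt x d))) ->
  mu.-integrable `[c, d] (EFin \o (fun y => phi (pt b y))) ->
  mu.-integrable `[c, d] (EFin \o (fun y => phi (pt a y))) ->
  \int[mu]_(x in `[a, b]) phi (pt x c) <= K1 ->
  \int[mu]_(x in `[a, b]) phi (pt x d) <= K2 ->
  \int[mu]_(y in `[c, d]) phi (pt b y) <= K3 ->
  \int[mu]_(y in `[c, d]) phi (pt a y) <= K4 ->
  nc (RI f a b c d) <= 2 * K1 + 2 * K2 + (2 * K3 + 2 * K4).
Proof.
move=> ab cd [H1 H2 H3 H4] B i1 i2 i3 i4 k1 k2 k3 k4.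
rewrite (le_trans (ncD _ _))// ncM nc_i mul1r (CIB H1 H2) (CIB H3 H4).
apply: lerD; rewrite (le_trans (ncB _ _))//; apply: lerD.
- apply: le_trans (CI_le H1 i1 _) _; last by rewrite ler_pM2l.
  by move=> x xab; apply: B; exact: bdQ_bottom.
- apply: le_trans (CI_le H2 i2 _) _; last by rewrite ler_pM2l.
  by move=> x xab; apply: B; exact: bdQ_top.
- apply: le_trans (CI_le H3 i3 _) _; last by rewrite ler_pM2l.
  by move=> x xab; apply: B; exact: bdQ_right.
- apply: le_trans (CI_le H4 i4 _) _; last by rewrite ler_pM2l.
  by move=> x xab; apply: B; exact: bdQ_left.
Qed.

Definition Qset w (s : R) : set (R * R) := [set t | Qrect w s (cpt t)].

Lemma QsetE w (s : R) : Qset w s =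
  `[Re w - s, Re w + s]%classic `*` `[Im w - s, Im w + s]%classic.
Proof.
by apply/seteqP; split => -[x y]; rewrite /Qset /Qrect /inQ /= !in_itv.
Qed.

Lemma measurable_Qset w (s : R) : measurable (Qset w s).
Proof. by rewrite QsetE; apply: measurableX. Qed.

Lemma leb2_Qset w (s : R) : 0 <= s -> lam (Qset w s) = (4 * s ^+ 2)%:E.
Proof.
have [->|sn0] := eqVneq s 0; first move=> _.
  rewrite QsetE /leb2 product_measure1E//= !lebesgue_measure_itv/= !lte_fin !subr0 !addr0.
  by rewrite !ltxx mul0e expr0n mulr0.
rewrite le_eqVlt eq_sym (negbTE sn0)/= => s0.
rewrite QsetE /leb2 product_measure1E//= !lebesgue_measure_itv/= !lte_fin.
have lt (x : R) : x - s < x + s by rewrite ltrD2l; lra.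
by rewrite !lt -!EFinB -EFinM; congr EFin; ring.
Qed.

Lemma real_integrable_seg (f : C -> C) a b c d (k : R) :
  (forall z, inQ a b c d z -> ccont f z) ->
  (forall y, c <= y <= d -> mu.-integrable `[a, b] (EFin \o (fun x => k * nc (f (pt x y))))) /\
  (forall x, a <= x <= b -> mu.-integrable `[c, d] (EFin \o (fun y => k * nc (f (pt x y))))).
Proof.
move=> fc.
have K (h : R -> C) u v : (forall x, u <= x <= v -> rcont h x) ->
    mu.-integrable `[u, v] (EFin \o (fun x => k * nc (h x))).
  move=> H; pose g x : C := ((nc (h x))%:C)%C.
  have cg : cint g u v.
    apply: cint_cont => x xuv e e0; have [r r0 Hr] := H x xuv e e0; exists r => // t /Hr.
    apply: le_trans; rewrite /g -rmorphB nc_real; exact: lip_nc.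
  have [+ _] := cintZ (k%:C%C) cg.
  by apply: eq_integrable => //= x _; rewrite /g /= mul0r subr0.
split=> [y ycd|x xab]; apply: K.
- by move=> x xab; apply: rcont_hor; apply: fc; split.
- by move=> y ycd; apply: rcont_ver; apply: fc; split.
Qed.

End MeanValue.

(** * The area mean value inequality for holomorphic functions *)

Section SubMeanValue.
Variable R : realType.
Local Notation C := (R[i])^o.
Local Notation pt x y := ((x +i* y)%C : C).
Local Notation Re := complex.Re.
Local Notation Im := complex.Im.
Local Notation mu := (@lebesgue_measure R).
Local Notation lam := (@leb2 R).
Implicit Types (f g : C -> C) (z w : C).

Let seg_bound (h : R -> R) a0 b0 a b (k K : R) : 0 <= k -> (forall x, 0 <= h x) ->
  a0 <= a -> b <= b0 -> mu.-integrable `[a0, b0] (EFin \o h) ->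
  (\int[mu]_(x in `[a0, b0]) (h x)%:E <= K%:E)%E ->
  mu.-integrable `[a, b] (EFin \o (fun x => k * h x)) /\
  \int[mu]_(x in `[a, b]) (k * h x) <= k * K.
Proof.
move=> k0 h0 aa bb ih HK.
have S : `[a, b]%classic `<=` `[a0, b0]%classic by apply: subset_itv; rewrite leBSide.
have ih' : mu.-integrable `[a, b] (EFin \o h) by apply: integrableS ih.
split.
  rewrite (_ : EFin \o _ = fun x => k%:E * (EFin \o h) x)%E//; exact: integrableZl.
rewrite RintegralZl//; apply: ler_wpM2l => //.
rewrite -lee_fin /Rintegral fineK; last exact: integrable_fin_num.
apply: le_trans HK; apply: ge0_subset_integral => //; first exact: (measurable_int mu).
by move=> x _; rewrite lee_fin.
Qed.

(** Input for [winding_lower] on rectangles with sides between [S] and [2 * S]. *)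
Let eighth (S u v : R) : 0 < S -> S <= u <= 2 * S -> S <= v <= 2 * S ->
  1 / 8 <= u * v / (u ^+ 2 + v ^+ 2).
Proof.
move=> S0 /andP[u1 u2] /andP[v1 v2].
have u0 : 0 < u := lt_le_trans S0 u1; have v0 : 0 < v := lt_le_trans S0 v1.
rewrite ler_pdivlMr ?addr_gt0 ?exprn_gt0//.
have uS : u ^+ 2 <= (2 * S) ^+ 2 by rewrite ler_sqr ?nnegrE; lra.
have vS : v ^+ 2 <= (2 * S) ^+ 2 by rewrite ler_sqr ?nnegrE; lra.
have uv : S ^+ 2 <= u * v by rewrite expr2 ler_pM// ltW.
rewrite exprMn in uS vS; move: uS vS uv; set p := u ^+ 2; set q := v ^+ 2; set r := S ^+ 2.
by set s := u * v; clear; lra.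
Qed.

Let triple (A S : R) : 0 < S -> A / S ^+ 2 * 2 ^+ 6 / (1 / 8) = 2 ^+ 9 * A / S ^+ 2.
Proof. by move=> S0; field; rewrite lt0r_neq0. Qed.

(** Averages over circles are replaced by one well-chosen rectangle: in each of the four strips at
    distance between S/2 and S from [w], some line carries at most twice the average of |f|, that is
    4 A/S. With the kernel at most 2/S each side contributes 16 A/S^2, and the winding bound 1/8
    turns the sum 64 into [2 ^+ 9]. *)
Lemma area_mean f w (S A : R) : holo f -> 0 < S -> 2 * S < eta w -> 0 < A ->
  (iint (Qset w S) (fun z => nc (f z)) <= A%:E)%E -> nc (f w) <= 2 ^+ 9 * A / S ^+ 2.
Proof.
move=> hf S0 Sw A0 HA.
case: w => x0 y0 in Sw HA *.
pose a0 := x0 - S; pose b0 := x0 + S; pose c0 := y0 - S; pose d0 := y0 + S.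
have QD z : inQ a0 b0 c0 d0 z -> disc z by move=> zQ; exact: (Qrect_disc Sw).
have fc z : inQ a0 b0 c0 d0 z -> ccont f z by move=> /QD; exact: holo_ccont.
have mQ : cmeas (Qset (pt x0 y0) S) (fun z => nc (f z)).
  apply: cmeasS (holo_cmeas_nc hf); first exact: measurable_disc.
  by move=> t; exact: QD.
have sub a b c d : a0 <= a -> b <= b0 -> c0 <= c -> d <= d0 ->
   (\int[lam]_(t in `[a, b]%classic `*` `[c, d]%classic) (nc (f (cpt t)))%:E <= A%:E)%E /\
   measurable_fun (`[a, b]%classic `*` `[c, d]%classic) (fun t : R * R => nc (f (cpt t))).
  move=> aa bb cc dd.
  have S' : `[a, b]%classic `*` `[c, d]%classic `<=` Qset (pt x0 y0) S.
    rewrite QsetE => -[x y] /= []; rewrite !in_itv/= => /andP[h1 h2] /andP[h3 h4].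
    by rewrite (le_trans aa)// (le_trans h2)// (le_trans cc)// (le_trans h4).
  split; last by apply: measurable_funS mQ => //; exact: measurable_Qset.
  apply: le_trans HA; apply: iint_subset => //.
  - by apply: measurableX.
  - exact: measurable_Qset.
  - by move=> t _; exact: nc_ge0.
have hor c d : c0 <= c -> d <= d0 -> d - c = S / 2 ->
   exists2 y, c <= y <= d & (\int[mu]_(x in `[a0, b0]) (nc (f (pt x y)))%:E <= (4 * A / S)%:E)%E.
  move=> cc dd dc; have [I1 I2] := sub a0 b0 c d (lexx _) (lexx _) cc dd.
  have cd : c < d by rewrite -subr_gt0 dc divr_gt0.
  have := @good_horizontal R `[a0, b0]%classic `[c, d]%classic (fun t => nc (f (cpt t))).
  move=> /(_ _ _ _ I2 c d A erefl cd A0 I1)[]//; first by move=> t _; exact: nc_ge0.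
  move=> y ycd Hy; exists y => //; apply: le_trans Hy _; rewrite lee_fin dc.
  by rewrite le_eqVlt; apply/orP; left; apply/eqP; field; exact: lt0r_neq0.
have ver a b : a0 <= a -> b <= b0 -> b - a = S / 2 ->
   exists2 x, a <= x <= b & (\int[mu]_(y in `[c0, d0]) (nc (f (pt x y)))%:E <= (4 * A / S)%:E)%E.
  move=> aa bb ba; have [I1 I2] := sub a b c0 d0 aa bb (lexx _) (lexx _).
  have ab : a < b by rewrite -subr_gt0 ba divr_gt0.
  have := @good_vertical R `[a, b]%classic `[c0, d0]%classic (fun t => nc (f (cpt t))).
  move=> /(_ _ _ _ I2 a b A erefl ab A0 I1)[]//; first by move=> t _; exact: nc_ge0.
  move=> x xab Hx; exists x => //; apply: le_trans Hx _; rewrite lee_fin ba.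
  by rewrite le_eqVlt; apply/orP; left; apply/eqP; field; exact: lt0r_neq0.
have [[iH iV] [a0b0 c0d0]] : ((forall y, c0 <= y <= d0 ->
  mu.-integrable `[a0, b0] (EFin \o (fun x => nc (f (pt x y))))) /\
  (forall x, a0 <= x <= b0 -> mu.-integrable `[c0, d0] (EFin \o (fun y =>
    nc (f (pt x y)))))) /\ a0 <= b0 /\ c0 <= d0.
  split; last by rewrite /a0 /b0 /c0 /d0; split; clear -S0; lra.
  have [iH iV] := real_integrable_seg 1 fc.
  by split=> t tcd; [have := iH t tcd|have := iV t tcd];
    apply: eq_integrable => //= u _; rewrite mul1r.
have [||| c /andP[c1 c2] Hc] := hor (y0 - S) (y0 - S / 2); try by rewrite /c0 /d0; clear -S0; lra.
have [||| d /andP[d1 d2] Hd] := hor (y0 + S / 2) (y0 + S); try by rewrite /c0 /d0; clear -S0; lra.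
have [||| a /andP[a1 a2] Ha] := ver (x0 - S) (x0 - S / 2); try by rewrite /a0 /b0; clear -S0; lra.
have [||| b /andP[b1 b2] Hb] := ver (x0 + S / 2) (x0 + S); try by rewrite /a0 /b0; clear -S0; lra.
have wab : a < x0 < b by apply/andP; split; clear -S0 a1 a2 b1 b2; lra.
have wcd : c < y0 < d by apply/andP; split; clear -S0 c1 c2 d1 d2; lra.
have ab : a <= b by clear -S0 a1 a2 b1 b2; lra.
have cd : c <= d by clear -S0 c1 c2 d1 d2; lra.
have sb z : inQ a b c d z -> inQ a0 b0 c0 d0 z by exact: inQ_sub.
have CF := @cauchy_formula R f a b c d (pt x0 y0) wab wcd
  (fun z zQ => holo_cdiff_ex hf (QD z (sb z zQ))).
have WL := @winding_lower R a b c d (pt x0 y0) wab wcd.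
have k8 : 1 / 8 <= nc (cauchyJ (fun=> 1) a b c d (pt x0 y0)).
  apply: le_trans WL; apply: (eighth S0); apply/andP; split.
  - by clear -S0 a1 a2 b1 b2; lra.
  - by clear -S0 a1 a2 b1 b2; lra.
  - by clear -S0 c1 c2 d1 d2; lra.
  - by clear -S0 c1 c2 d1 d2; lra.
have fbc z : bdQ a b c d z -> ccont f z by move=> [zQ _]; exact/fc/sb.
have ok := @RIok_kernel R f a b c d (pt x0 y0) 1 wab wcd fbc.
have S20 : 0 <= 2 / S by rewrite divr_ge0// ltW.
have dist z : bdQ a b c d z -> S / 2 <= nc (z - pt x0 y0).
  move=> [_ H]; have hR := nc_Re (z - pt x0 y0); have hI := nc_Im (z - pt x0 y0).
  move: hR hI; rewrite ReD ImD ReN ImN /= => hR hI.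
  case: H => E; rewrite E in hR hI; [apply: le_trans hR|apply: le_trans hR|apply: le_trans
    hI|apply: le_trans hI].
  - by rewrite distrC ler_normr; apply/orP; left; clear -a2; lra.
  - by rewrite ler_normr; apply/orP; left; clear -b1; lra.
  - by rewrite distrC ler_normr; apply/orP; left; clear -c2; lra.
  - by rewrite ler_normr; apply/orP; left; clear -d1; lra.
have dom z : bdQ a b c d z -> nc (f z * (z - pt x0 y0)^-1 ^+ 1) <= 2 / S * nc (f z).
  move=> zb; rewrite ncM ncV mulrC ler_wpM2r ?nc_ge0//.
  have -> : 2 / S = (S / 2)^-1 by rewrite invf_div.
  by rewrite lef_pV2 ?posrE ?(lt_le_trans _ (dist z zb)) ?divr_gt0 ?dist.
have aI : a0 <= a <= b0 by rewrite a1 (le_trans ab b2).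
have bI : a0 <= b <= b0 by rewrite b2 (le_trans a1 ab).
have cI : c0 <= c <= d0 by rewrite c1 (le_trans cd d2).
have dI : c0 <= d <= d0 by rewrite d2 (le_trans c1 cd).
have [ia Ka] := seg_bound S20 (fun y => nc_ge0 (f (pt a y))) c1 d2 (iV a aI) Ha.
have [ib Kb] := seg_bound S20 (fun y => nc_ge0 (f (pt b y))) c1 d2 (iV b bI) Hb.
have [ic Kc] := seg_bound S20 (fun x => nc_ge0 (f (pt x c))) a1 b2 (iH c cI) Hc.
have [id Kd] := seg_bound S20 (fun x => nc_ge0 (f (pt x d))) a1 b2 (iH d dI) Hd.
have := @RI_le R _ (fun z => 2 / S * nc (f z)) a b c d _ _ _ _ ab cd ok dom ic id ib ia Kc Kd Kb Ka.
rewrite -/(cauchyJ f a b c d (pt x0 y0)) CF ncM => H.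
have {}H : nc (f (pt x0 y0)) * (1 / 8) <= A / S ^+ 2 * 2 ^+ 6.
  apply: le_trans (ler_wpM2l (nc_ge0 _) k8) _; apply: le_trans H _.
  by rewrite le_eqVlt; apply/orP; left; apply/eqP; field; exact: lt0r_neq0.
by rewrite -triple// ler_pdivlMr// divr_gt0.
Qed.

End SubMeanValue.

(** * The mean value inequality for powers of the modulus *)

Section SubMeanPower.
Variable R : realType.
Local Notation C := (R[i])^o.
Local Notation Re := complex.Re.
Local Notation Im := complex.Im.
Implicit Types (f g : C -> C) (z w : C).

(** For [x] above [l] the factor (x/l)^(p-1) is at least 1. As [l] is free, integrating and then
    balancing the two terms does the work of Hoelder's inequality. *)
Lemma le_powR_interp (x l p : R) : 0 <= x -> 0 < l -> 1 <= p ->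
  x <= l + l / l `^ p * x `^ p.
Proof.
move=> x0 l0 p1; have lp := powR_gt0 p l0.
have [xl|lx] := leP x l.
  by rewrite (le_trans xl)// lerDl mulr_ge0 ?powR_ge0// divr_ge0 ?powR_ge0 ?ltW.
apply: le_trans (_ : l / l `^ p * x `^ p <= _); last by rewrite lerDr ltW.
have xlE : x `^ p = (x / l) `^ p * l `^ p.
  by rewrite -powRM ?divr_ge0 ?(ltW l0)// divfK// lt0r_neq0.
rewrite xlE mulrCA -[l / _ * _]mulrA mulVf ?lt0r_neq0// mulr1.
rewrite -ler_pdivrMr//; apply: le1r_powR => //.
by rewrite ler_pdivlMr// mul1r ltW.
Qed.

Let scale_eq (A S p : R) : 0 < S -> 0 < A -> 0 < p ->
  ((A / S ^+ 2) `^ p^-1) `^ p = A / S ^+ 2.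
Proof.
by move=> S0 A0 p0; rewrite -powRrM mulVf ?lt0r_neq0// powRr1// divr_ge0 ?exprn_ge0// ltW.
Qed.

Lemma cmeas_Qset f w (S : R) : holo f -> 2 * S < eta w -> cmeas (Qset w S) (fun z => nc (f z)).
Proof.
move=> hf Sw; apply: cmeasS (holo_cmeas_nc hf); first exact: measurable_disc.
by move=> t /(Qrect_disc Sw).
Qed.

Let submean_ge1 (p : R) f w (S A : R) : 1 <= p -> holo f -> 0 < S -> 2 * S < eta w -> 0 < A ->
  (iint (Qset w S) (fun z => nc (f z) `^ p)%R <= A%:E)%E ->
  nc (f w) `^ p <= (2 ^+ 9 * 5) `^ p * (A / S ^+ 2).
Proof.
move=> p1 hf S0 Sw A0 HA; have p0 : 0 < p by exact: lt_le_trans p1.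
(* This level balances the two terms: [4 * S ^+ 2 * l] from the area of the square and [S ^+ 2 * l]
   from [A], hence the factor 5. *)
pose l := (A / S ^+ 2) `^ p^-1.
have l0 : 0 < l by rewrite powR_gt0// divr_gt0// exprn_gt0.
have lp : l `^ p = A / S ^+ 2 by exact: scale_eq.
have lp0 : 0 < l `^ p by rewrite powR_gt0.
have mf := cmeas_Qset hf Sw; have mQ := measurable_Qset w S.
have B : (iint (Qset w S) (fun z => nc (f z))%R <= (5 * S ^+ 2 * l)%:E)%E.
  apply: le_trans (_ : (iint (Qset w S) (fun z => l + l / l `^ p * nc (f z) `^ p)%R <= _)%E).
    apply: iint_le => //.
    - by apply: cmeasD; [exact: cmeas_cst|apply: cmeasM; [exact: cmeas_cst|exact: cmeas_powR]].
    - by move=> t _; exact: nc_ge0.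
    - by move=> t _; apply: le_powR_interp => //; exact: nc_ge0.
  rewrite iintD//; last 4 first.
  - exact: cmeas_cst.
  - by apply: cmeasM; [exact: cmeas_cst|exact: cmeas_powR].
  - by move=> t _; exact: ltW.
  - by move=> t _; rewrite mulr_ge0 ?powR_ge0// divr_ge0 ?powR_ge0 ?ltW.
  rewrite iint_cst// leb2_Qset ?(ltW S0)// iintZ//; last 3 first.
  - exact: cmeas_powR.
  - by move=> t _; exact: powR_ge0.
  - by rewrite divr_ge0 ?powR_ge0 ?ltW.
  apply: le_trans (_ : (l%:E * (4 * S ^+ 2)%:E + (l / l `^ p)%:E * A%:E <= _)%E).
    by apply: leeD => //; apply: lee_wpmul2l => //; rewrite lee_fin divr_ge0 ?powR_ge0 ?ltW.
  rewrite -!EFinM -EFinD lee_fin lp le_eqVlt; apply/orP; left; apply/eqP.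
  by field; rewrite !lt0r_neq0.
have BA : 0 < 5 * S ^+ 2 * l by rewrite !mulr_gt0// exprn_gt0.
have H := area_mean hf S0 Sw BA B.
have {}H : nc (f w) <= 2 ^+ 9 * 5 * l.
  by apply: le_trans H _; rewrite le_eqVlt; apply/orP; left; apply/eqP; field; rewrite lt0r_neq0.
apply: le_trans (_ : (2 ^+ 9 * 5 * l) `^ p <= _).
  apply: ge0_ler_powR H; rewrite ?nnegrE ?nc_ge0 ?(ltW p0)//.
  by rewrite !mulr_ge0 ?exprn_ge0 ?ltW.
by rewrite powRM ?(ltW l0)// ?lp// mulr_ge0 ?exprn_ge0.
Qed.

(** The distance from [z] to the boundary of the square in the maximum norm, counted negative
    outside. *)
Definition bd_dist w (S : R) z := S - Num.max `|Re z - Re w| `|Im z - Im w|.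

Lemma bd_dist_Qrect w (S d : R) z u : bd_dist w S z = d + d ->
  Qrect z d u -> Qrect w S u /\ d <= bd_dist w S u.
Proof.
rewrite /bd_dist => E [/andP[h1 h2] /andP[h3 h4]].
have m1 : `|Re z - Re w| <= S - (d + d) by rewrite -E opprB subrKC le_max lexx.
have m2 : `|Im z - Im w| <= S - (d + d) by rewrite -E opprB subrKC le_max lexx orbT.
have d0 : 0 <= d by move: (le_trans h1 h2); clear; lra.
have k1 : `|Re u - Re w| <= S - d.
  move: m1; rewrite !ler_norml => /andP[? ?]; apply/andP; split; lra.
have k2 : `|Im u - Im w| <= S - d.
  move: m2; rewrite !ler_norml => /andP[? ?]; apply/andP; split; lra.
split; last by rewrite lerBrDl -lerBrDr ge_max k1.
move: k1 k2; rewrite !ler_norml => /andP[? ?] /andP[? ?].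
by split; apply/andP; split; lra.
Qed.

(** For p < 1 the interpolation above fails and the bound absorbs itself instead. Let N be the
    supremum of |f| times a power of the distance to the boundary, finite because f is bounded on
    the square. On a smaller square |f| <= (N/e)^(1-p) |f|^p, so [area_mean] yields N <= C A
    N^(1-p), that is N^p <= C A. *)
Let submean_lt1 (p : R) f w (S A : R) : 0 < p < 1 -> holo f -> 0 < S -> 2 * S < eta w -> 0 < A ->
  (iint (Qset w S) (fun z => nc (f z) `^ p)%R <= A%:E)%E ->
  nc (f w) `^ p <= 2 ^+ 9 * 2 `^ (2 / p) * (A / S ^+ 2).
Proof.
(* With the exponent [b] the p-th power of the weight is the squared distance, which matches the
   area in [area_mean]. *)
move=> /andP[p0 p1] hf S0 Sw A0 HA; pose b := 2 / p.
have b0 : 0 < b by rewrite divr_gt0.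
have bp : b * p = 2 by rewrite divfK// lt0r_neq0.
have powb x : 0 <= x -> (x `^ b) `^ p = x ^+ 2.
  by move=> x0; rewrite -powRrM bp -[2]/(2%:R) powR_mulrn.
pose d z := bd_dist w S z.
have dw : d w = S by rewrite /d /bd_dist !subrr normr0 maxxx subr0.
have [|||M M0 HM] := @bounded_on_rect R f (Re w - S) (Re w + S) (Im w - S) (Im w + S).
- by rewrite lerD2l; clear -S0; lra.
- by rewrite lerD2l; clear -S0; lra.
- by move=> z /(Qrect_disc Sw); exact: holo_ccont.
have dS z : d z <= S by rewrite /d /bd_dist lerBlDr lerDl le_max normr_ge0.
pose E := [set x | exists2 z, Qrect w S z /\ 0 < d z & x = nc (f z) * d z `^ b].
have Ew : E (nc (f w) * S `^ b) by exists w; rewrite ?dw//; split=> //; exact: Qrect_center.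
have ubE : ubound E (M * S `^ b).
  move=> _ [z [zQ dz] ->]; apply: ler_pM; rewrite ?nc_ge0 ?powR_ge0 ?HM//.
  by apply: ge0_ler_powR; rewrite ?nnegrE ?(ltW b0) ?(ltW dz) ?(ltW S0).
have hasE : has_ubound E by exists (M * S `^ b).
pose N := sup E.
have NE z : Qrect w S z -> 0 < d z -> nc (f z) * d z `^ b <= N.
  by move=> zQ dz; apply: ub_le_sup => //; exists z.
have Nw : nc (f w) * S `^ b <= N by exact: ub_le_sup.
(* The argument divides by a power of [N]; positivity of [N] comes from [f w], and for [f w] zero
   the claim is trivial. *)
have [fw0|fw0] := eqVneq (nc (f w)) 0.
  by rewrite fw0 powR0 ?lt0r_neq0// mulr_ge0 ?exprn_ge0// divr_ge0 ?exprn_ge0// ltW.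
have Sb0 : 0 < S `^ b by rewrite powR_gt0.
have N0 : 0 < N.
  by apply: lt_le_trans Nw; rewrite mulr_gt0// lt_def fw0 nc_ge0.
have step z : Qrect w S z -> 0 < d z ->
    nc (f z) * d z `^ b <= 2 ^+ 9 * 2 `^ b * A * N `^ (1 - p).
  (* On the square of half-side [r] about [z] the distance to the boundary is still at least [r],
     which bounds |f| there by [N / e]. *)
  move=> zQ dz; pose r := d z / 2; have r0 : 0 < r by rewrite divr_gt0.
  have dr : d z = r + r by rewrite -splitr.
  pose e := r `^ b; have e0 : 0 < e by rewrite powR_gt0.
  have ep : e `^ p = r ^+ 2 by rewrite powb// ltW.
  have rS : Qset z r `<=` Qset w S by move=> t /(bd_dist_Qrect dr)[].
  have Ne0 : 0 < N / e by rewrite divr_gt0.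
  have rz : 2 * r < eta z.
    have k1 : nc (z - w) <= 2 * (S - d z).
      apply: le_trans (nc_le_ReIm _) _; rewrite ReD ImD ReN ImN mulr_natl mulr2n lerD//.
        by rewrite /d /bd_dist opprB subrKC le_max lexx.
      by rewrite /d /bd_dist opprB subrKC le_max lexx orbT.
    apply: lt_le_trans (eta_dist z w); rewrite ltrBrDr.
    apply: le_lt_trans Sw; rewrite dr in k1.
    move: k1 r0; set k := nc _; clear; lra.
  have B : (iint (Qset z r) (fun u => nc (f u))%R <= ((N / e) `^ (1 - p) * A)%:E)%E.
    apply: le_trans (_ : (iint (Qset z r) (fun u => (N / e) `^ (1 - p) * nc (f u) `^ p)%R <= _)%E).
      apply: iint_le; [exact: measurable_Qset|exact: cmeas_Qset| | |].
      - by apply: cmeasM; [exact: cmeas_cst|apply: cmeas_powR; exact: cmeas_Qset].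
      - by move=> t _; exact: nc_ge0.
      move=> t zt; have [tQ dt] := bd_dist_Qrect dr zt.
      have dt0 : 0 < d (cpt t) by exact: lt_le_trans dt.
      have fN : nc (f (cpt t)) <= N / e.
        rewrite ler_pdivlMr//; apply: le_trans (NE _ tQ dt0); rewrite ler_wpM2l ?nc_ge0//.
        by apply: ge0_ler_powR; rewrite ?nnegrE ?(ltW b0) ?(ltW dt0) ?(ltW r0).
      have [->|f0] := eqVneq (nc (f (cpt t))) 0; first by rewrite mulr_ge0 ?powR_ge0.
      rewrite -[leLHS]powRr1 ?nc_ge0// -{1}(subrK p 1) powRD ?f0 ?implybT//.
      rewrite ler_wpM2r ?powR_ge0//; apply: ge0_ler_powR; rewrite ?nnegrE ?nc_ge0 ?(ltW Ne0)//.
      by rewrite subr_ge0 ltW.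
    rewrite iintZ ?powR_ge0//; last 3 first.
    - exact: measurable_Qset.
    - by apply: cmeas_powR; exact: cmeas_Qset.
    - by move=> t _; exact: powR_ge0.
    rewrite EFinM; apply: lee_wpmul2l; first by rewrite lee_fin powR_ge0.
    apply: le_trans HA; apply: iint_subset => //.
    - exact: measurable_Qset.
    - exact: measurable_Qset.
    - by apply: cmeas_powR; exact: cmeas_Qset.
    - by move=> t _; exact: powR_ge0.
  have BA : 0 < (N / e) `^ (1 - p) * A by rewrite mulr_gt0// powR_gt0.
  have H := area_mean hf r0 rz BA B.
  have -> : d z `^ b = 2 `^ b * e.
    have -> : d z = 2 * r by rewrite dr; ring.
    by rewrite powRM ?(ltW r0).
  rewrite [leLHS]mulrCA.
  have -> : 2 ^+ 9 * 2 `^ b * A * N `^ (1 - p) = 2 `^ b * (2 ^+ 9 * A * N `^ (1 - p)) by ring.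
  rewrite ler_wpM2l ?powR_ge0// -ler_pdivlMr//; apply: le_trans H _.
  have -> : (N / e) `^ (1 - p) = N `^ (1 - p) / (e / e `^ p).
    rewrite powRM ?invr_ge0 ?(ltW N0) ?(ltW e0)//; congr (_ * _).
    rewrite -powR_inv1 ?(ltW e0)// powRAC powR_inv1 ?powR_ge0//; congr (_^-1).
    by rewrite powRB ?powRr1 ?(ltW e0)// lt0r_neq0 ?implybT.
  rewrite ep le_eqVlt; apply/orP; left; apply/eqP; field.
  by rewrite !lt0r_neq0.
have NA : N <= 2 ^+ 9 * 2 `^ b * A * N `^ (1 - p).
  apply: ge_sup; first by exists (nc (f w) * S `^ b).
  by move=> _ [z [zQ dz] ->]; exact: step.
have Np : N `^ p <= 2 ^+ 9 * 2 `^ b * A.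
  have := NA; rewrite -ler_pdivrMr ?powR_gt0//; apply: le_trans.
  by rewrite -{2}(powRr1 (ltW N0)) -powRB ?lt0r_neq0 ?implybT// opprB subrKC.
have S2 : 0 < S ^+ 2 by rewrite exprn_gt0.
rewrite mulrA ler_pdivlMr//; apply: le_trans Np.
rewrite -(powb S (ltW S0)) -powRM ?nc_ge0 ?(ltW Sb0)//.
by apply: ge0_ler_powR; rewrite ?nnegrE ?mulr_ge0 ?nc_ge0 ?(ltW Sb0) ?(ltW N0) ?(ltW p0).
Qed.

Lemma submean (p : R) : 0 < p -> exists2 K : R, 0 < K & forall f w (S A : R),
  holo f -> 0 < S -> 2 * S < eta w -> 0 < A ->
  (iint (Qset w S) (fun z => nc (f z) `^ p)%R <= A%:E)%E ->
  nc (f w) `^ p <= K * (A / S ^+ 2).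
Proof.
move=> p0; have [p1|p1] := leP 1 p.
  by exists ((2 ^+ 9 * 5) `^ p) => [|f w S A]; [rewrite powR_gt0// mulr_gt0// exprn_gt0|exact:
    submean_ge1].
exists (2 ^+ 9 * 2 `^ (2 / p)) => [|f w S A]; first by rewrite mulr_gt0 ?exprn_gt0 ?powR_gt0.
by apply: submean_lt1; rewrite p0.
Qed.

(* The mean value bound on the squares of half size, followed by Cauchy's estimate. *)
Lemma derivative_estimate (p : R) l : 0 < p -> exists2 K : R, 0 < K & forall f w (S A : R),
  holo f -> 0 < S -> 2 * S < eta w -> 0 < A ->
  (iint (Qset w S) (fun z => nc (f z) `^ p)%R <= A%:E)%E ->
  S ^+ l * nc (derive1n l f w) <= K * (A / S ^+ 2) `^ p^-1.
Proof.
move=> p0; have [K K0 HK] := submean p0; have [L L0 HL] := cauchy_estimate_n R l.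
have pV0 : 0 < p^-1 by rewrite invr_gt0.
exists (L * 2 ^+ l * (K * 4) `^ p^-1 + 1).
  by rewrite ltr_wpDl// !mulr_ge0 ?exprn_ge0 ?powR_ge0.
move=> f w S A hf S0 Sw A0 HA; have S20 : 0 < S / 2 by rewrite divr_gt0.
pose B := (A / S ^+ 2) `^ p^-1.
have AS : 0 <= A / S ^+ 2 by rewrite divr_ge0 ?exprn_ge0 ?ltW.
have Sw2 : 2 * (S / 2) < eta w.
  by apply: le_lt_trans Sw; rewrite mulrC divfK// ler_peMl ?ler1n// ltW.
have M z : Qrect w (S / 2) z -> nc (f z) <= (K * 4) `^ p^-1 * B.
  move=> zQ; rewrite /B -powRM//; last by rewrite mulr_ge0// ltW.
  have zS : 2 * (S / 2) < eta z.
    have := Qrect_eta zQ; rewrite mulrC divfK// => H; apply: lt_le_trans H.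
    by rewrite ltrBrDr -mulr2n -mulr_natl.
  have := HK f z (S / 2) A hf S20 zS A0.
  have I : (iint (Qset z (S / 2)) (fun z => nc (f z) `^ p)%R <= A%:E)%E.
    apply: le_trans HA; apply: iint_subset.
    - exact: measurable_Qset.
    - exact: measurable_Qset.
    - by apply: cmeas_powR; exact: cmeas_Qset.
    - by move=> t _; exact: powR_ge0.
    - by move=> t /(Qrect_trans zQ); rewrite -splitr.
  move=> /(_ I) H.
  have -> : nc (f z) = (nc (f z) `^ p) `^ p^-1.
    by rewrite -powRrM mulfV ?lt0r_neq0// powRr1// nc_ge0.
  apply: ge0_ler_powR; rewrite ?nnegrE ?powR_ge0 ?(ltW pV0)//.
    by apply: mulr_ge0 => //; rewrite mulr_ge0// ltW.
  apply: le_trans H _; rewrite le_eqVlt; apply/orP; left; apply/eqP.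
  by field; rewrite lt0r_neq0.
have := HL f w (S / 2) _ hf S20 Sw2 M.
have -> : L * ((K * 4) `^ p^-1 * B) / (S / 2) ^+ l = L * 2 ^+ l * (K * 4) `^ p^-1 * B / S ^+ l.
  rewrite expr_div_n; field; by rewrite !expf_neq0// lt0r_neq0.
rewrite ler_pdivlMr ?exprn_gt0// mulrC => /le_trans; apply.
by rewrite ler_wpM2r ?powR_ge0// lerDl.
Qed.

End SubMeanPower.

(** * Integration by layers and planar measure by sections *)

Section LayeredIntegral.
Variable R : realType.
Local Notation C := (R[i])^o.
Local Notation mu := (@lebesgue_measure R).
Local Notation lam := (@leb2 R).

(** The sum over [l] of [c l * h] restricted to [E l] dominates [g], and is integrated term by term.
    The sets may overlap, so nested layers and nested squares can be used as they are. *)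
Lemma integral_cover (A : set (R * R)) (g h : C -> R) (E : nat -> set (R * R))
    (c u : nat -> R) (B : R) :
  measurable A -> (forall l, measurable (E l)) -> cmeas A g -> cmeas A h ->
  (forall t, A t -> 0 <= g (cpt t)) -> (forall t, A t -> 0 <= h (cpt t)) ->
  (forall l, 0 <= c l) ->
  (forall t, A t -> exists2 l, E l t & g (cpt t) <= c l * h (cpt t)) ->
  (forall l, (iint (A `&` E l) h <= (u l)%:E)%E) ->
  (forall N, \sum_(l < N) c l * u l <= B) ->
  (iint A g <= B%:E)%E.
Proof.
move=> mA mE mg mh g0 h0 c0 cov iu sB.
pose H l : R * R -> \bar R := (fun t => (h (cpt t))%:E) \_ (E l).
have mH l : measurable_fun A (H l).
  have K : measurable_fun (A `&` E l) (fun t : R * R => (h (cpt t))%:E).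
    by apply: (measurable_funS (E := A)) => //; exact/measurable_EFinP.
  exact: (proj1 (measurable_restrict _ (mE l) mA) K).
have H0 l t : A t -> (0 <= H l t)%E.
  by move=> At; rewrite /H patchE; case: ifPn => // _; rewrite lee_fin h0.
have u0 l : 0 <= u l.
  by rewrite -lee_fin; apply: le_trans (iu l); apply: iint_ge0 => t [At _]; exact: h0.
have cH0 l t : A t -> (0 <= (c l)%:E * H l t)%E by move=> At; rewrite mule_ge0 ?lee_fin// H0.
have mcH l : measurable_fun A (fun t => (c l)%:E * H l t)%E.
  by apply: emeasurable_funM => //; exact: measurable_cst.
apply: (@le_trans _ _ (\int[lam]_(t in A) (\sum_(l <oo) ((c l)%:E * H l t)))%E).
  apply: ge0_le_integral => //.
  - exact/measurable_EFinP.
  - apply: (@ge0_emeasurable_sum _ _ _ A (fun l t => (c l)%:E * H l t)%E xpredT).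
      by move=> l t At _; exact: cH0.
    by move=> l _; exact: mcH.
  - move=> t At; have [l Elt gl] := cov t At.
    apply: (@le_trans _ _ (\sum_(0 <= i < l.+1) ((c i)%:E * H i t))%E); last first.
      by apply: nneseries_lim_ge => i _ _; exact: cH0.
    rewrite big_nat_recr//=.
    apply: (@le_trans _ _ ((c l)%:E * H l t)%E).
      by rewrite /H patchE mem_set// -EFinM lee_fin.
    by rewrite leeDr// sume_ge0// => i _; exact: cH0.
rewrite integral_nneseries//.
apply: (@le_trans _ _ (\sum_(l <oo) (c l * u l)%:E)%E).
  apply: lee_nneseries => [l _ _|l _]; first by apply: integral_ge0 => t; exact: cH0.
  rewrite ge0_integralZl_EFin; [|exact: mA|by move=> t; exact: H0|exact: mH|exact: c0].
  rewrite EFinM; apply: lee_wpmul2l; first by rewrite lee_fin.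
  by have := iu l; rewrite /iint integral_mkcondr.
have cu0 : forall k, (0 <= k)%N -> xpredT k -> (0 <= (c k * u k)%:E)%E.
  by move=> k _ _; rewrite lee_fin mulr_ge0.
apply: (lime_le (is_cvg_nneseries cu0)); apply: nearW => N.
by rewrite sumEFin lee_fin big_mkord; exact: sB.
Qed.

Lemma geometric_sum_le (a x : R) N : 0 <= a -> 0 < x < 1 ->
  \sum_(l < N) a * x ^+ l <= a / (1 - x).
Proof.
move=> a0 /andP[x0 x1]; have nx : `|x| < 1 by rewrite gtr0_norm.
by have := geometric_le_lim N a0 x0 nx; rewrite /series/= big_mkord.
Qed.

Let indic_section (B : set (R * R)) : measurable B ->
  (lam B = \int[mu]_y \int[mu]_x (\1_B (x, y))%:E)%E /\
  (lam B = \int[mu]_x \int[mu]_y (\1_B (x, y))%:E)%E.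
Proof.
move=> mB; have E : (lam B = \int[lam]_t (\1_B t)%:E)%E by rewrite integral_indic// setIT.
have m1 : measurable_fun setT (EFin \o (\1_B : R * R -> R)).
  exact/measurable_EFinP/measurable_indic.
have p1 t : (0 <= (EFin \o (\1_B : R * R -> R)) t)%E by rewrite lee_fin.
rewrite E; split.
- exact: (@fubini_tonelli2 _ _ _ _ R mu mu _ m1 p1).
- exact: (@fubini_tonelli1 _ _ _ _ R mu mu _ m1 p1).
Qed.

Let two_intervals (S : set R) (L u v : R) : 0 <= L ->
  measurable S -> (forall x, S x -> u <= x <= u + L \/ v <= x <= v + L) ->
  (\int[mu]_x (\1_S x)%:E <= (2 * L)%:E)%E.
Proof.
move=> L0 mS H; rewrite integral_indic// setIT.
apply: (@le_trans _ _ (mu (`[u, (u + L)%R]%classic `|` `[v, (v + L)%R]%classic))).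
  apply: le_measure => [| |x /H [h|h]].
  - by rewrite inE.
  - by rewrite inE; exact: measurableU.
  - by left; rewrite /= in_itv.
  - by right; rewrite /= in_itv.
apply: le_trans (measureU2 _ _ _) _ => //.
have K (a : R) : (mu `[a, (a + L)%R]%classic <= L%:E)%E.
  rewrite lebesgue_measure_itv/= lte_fin; case: ifPn => _; last by rewrite lee_fin.
  by rewrite -EFinB addrAC subrr add0r.
have -> : 2 * L = L + L by ring.
by rewrite EFinD; exact: leeD (K u) (K v).
Qed.

(** Tonelli's theorem. Two intervals per line are allowed because a line meets a thin ring along the
    unit circle in two pieces. *)
Lemma leb2_sectiony (B : set (R * R)) (J : set R) (L : R) : measurable B -> measurable J ->
  0 <= L -> (forall x y, B (x, y) -> J y) ->
  (forall y, exists u v, forall x, B (x, y) -> u <= x <= u + L \/ v <= x <= v + L) ->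
  (lam B <= (2 * L)%:E * mu J)%E.
Proof.
move=> mB mJ L0 BJ sec; have [-> _] := indic_section mB.
have m1 : measurable_fun setT (EFin \o (\1_B : R * R -> R)).
  exact/measurable_EFinP/measurable_indic.
apply: (@le_trans _ _ (\int[mu]_y ((2 * L) * \1_J y)%:E)%E); last first.
  under eq_integral do rewrite EFinM.
  rewrite ge0_integralZl_EFin ?mulr_ge0//; last exact/measurable_EFinP/measurable_indic.
  by rewrite integral_indic// setIT.
apply: ge0_le_integral => //.
- by move=> y _; apply: integral_ge0 => x _; rewrite lee_fin.
- by apply: (@measurable_fun_fubini_tonelli_G _ _ _ _ R mu _ m1) => t; rewrite lee_fin.
- by apply/measurable_EFinP; apply: measurable_funM;
  [exact: measurable_cst|exact: measurable_indic].
move=> y _; have [yJ|yJ] := pselect (J y); last first.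
  rewrite indicE memNset// mulr0.
  rewrite integral0_eq// => x _; rewrite indicE memNset// => /BJ; exact: yJ.
rewrite indicE mem_set// mulr1; have [u [v H]] := sec y.
have -> : (fun x => (\1_B (x, y))%:E) = (fun x => (\1_(ysection B y) x)%:E) :> (R -> \bar R).
  by apply/funext => x; rewrite !indicE mem_ysection.
apply: (@two_intervals (ysection B y) L u v L0); first exact: measurable_ysection.
by move=> x xB; apply: H; move: (mem_set xB); rewrite mem_ysection inE.
Qed.

Lemma leb2_sectionx (B : set (R * R)) (J : set R) (L : R) : measurable B -> measurable J ->
  0 <= L -> (forall x y, B (x, y) -> J x) ->
  (forall x, exists u v, forall y, B (x, y) -> u <= y <= u + L \/ v <= y <= v + L) ->
  (lam B <= (2 * L)%:E * mu J)%E.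
Proof.
move=> mB mJ L0 BJ sec; have [_ ->] := indic_section mB.
have m1 : measurable_fun setT (EFin \o (\1_B : R * R -> R)).
  exact/measurable_EFinP/measurable_indic.
apply: (@le_trans _ _ (\int[mu]_x ((2 * L) * \1_J x)%:E)%E); last first.
  under eq_integral do rewrite EFinM.
  rewrite ge0_integralZl_EFin ?mulr_ge0//; last exact/measurable_EFinP/measurable_indic.
  by rewrite integral_indic// setIT.
apply: ge0_le_integral => //.
- by move=> x _; apply: integral_ge0 => y _; rewrite lee_fin.
- by apply: (@measurable_fun_fubini_tonelli_F _ _ _ _ R mu _ m1) => t; rewrite lee_fin.
- by apply/measurable_EFinP; apply: measurable_funM;
  [exact: measurable_cst|exact: measurable_indic].
move=> x _; have [xJ|xJ] := pselect (J x); last first.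
  rewrite indicE memNset// mulr0.
  rewrite integral0_eq// => y _; rewrite indicE memNset// => /BJ; exact: xJ.
rewrite indicE mem_set// mulr1; have [u [v H]] := sec x.
have -> : (fun y => (\1_B (x, y))%:E) = (fun y => (\1_(xsection B x) y)%:E) :> (R -> \bar R).
  by apply/funext => y; rewrite !indicE mem_xsection.
apply: (@two_intervals (xsection B x) L u v L0); first exact: measurable_xsection.
by move=> y xB; apply: H; move: (mem_set xB); rewrite mem_xsection inE.
Qed.

End LayeredIntegral.

(** * Kernel integrals and Whitney squares *)

Section BergmanKernel.
Variable R : realType.
Local Notation C := (R[i])^o.
Local Notation Re := complex.Re.
Local Notation Im := complex.Im.
Local Notation mu := (@lebesgue_measure R).
Local Notation lam := (@leb2 R).
Local Notation D := (Dset R).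
Implicit Types (a z w : C).

Definition den a z : R := nc (1 - a^*%C * z : C).

(** The modulus of the base of the kernel powers in the test functions: at most 1 in the disc, and
    bounded below near [a]. *)
Definition pk a z : R := eta a / den a z.

Lemma den_sym a z : den a z = den z a.
Proof.
rewrite /den -nc_conj; congr nc; apply: complex_eqP; case: a => p q; case: z => x y /=; ring.
Qed.

Lemma den_ge_etar a z : nc a <= 1 -> eta z <= den a z.
Proof.
move=> a1; apply: le_trans (nc_lowerB _ _); rewrite nc1 ncM nc_conj /eta lerD2l lerN2.
by rewrite ler_piMl// nc_ge0.
Qed.

Lemma den_ge_etal a z : nc z <= 1 -> eta a <= den a z.
Proof. by move=> z1; rewrite den_sym den_ge_etar. Qed.

(** The identity behind the pseudo-hyperbolic distance; through [den_ge_dist] it gives the decay of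
    the kernel away from [a]. *)
Lemma den_sqr a z :
  den a z ^+ 2 = nc (z - a) ^+ 2 + (1 - nc a ^+ 2) * (1 - nc z ^+ 2).
Proof. by rewrite /den !nc_sqr; case: a => p q; case: z => x y /=; ring. Qed.

Lemma den_ge_dist a z : nc a <= 1 -> nc z <= 1 -> nc (z - a) <= den a z.
Proof.
move=> a1 z1; rewrite -ler_sqr ?nnegrE ?nc_ge0// den_sqr lerDl mulr_ge0// subr_ge0;
  rewrite expr_le1 ?nc_ge0//.
Qed.

Lemma den_gt0 a z : nc a < 1 -> nc z <= 1 -> 0 < den a z.
Proof. by move=> a1 z1; apply: lt_le_trans (den_ge_etal _ z1); rewrite eta_gt0. Qed.

Lemma pk_gt0 a z : nc a < 1 -> nc z <= 1 -> 0 < pk a z.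
Proof. by move=> a1 z1; rewrite divr_gt0 ?den_gt0// eta_gt0. Qed.

Lemma pk_le1 a z : nc a < 1 -> nc z <= 1 -> pk a z <= 1.
Proof. by move=> a1 z1; rewrite ler_pdivrMr ?den_gt0// mul1r den_ge_etal. Qed.

Lemma pk_eta a z : nc a < 1 -> nc z < 1 -> pk a z * eta z <= eta a.
Proof.
move=> a1 z1; rewrite /pk mulrAC (ler_pdivrMr _ _ (den_gt0 a1 (ltW z1))).
by rewrite ler_wpM2l ?(den_ge_etar _ (ltW a1))// ltW// eta_gt0.
Qed.

Lemma cmeas_den a : cmeas D (den a).
Proof.
apply: (@holo_cmeas_nc R (fun z => 1 - a^*%C * z)); apply: holoP => z _.
eexists; apply: cdiffB (cdiff_cst _ _) _; exact: (cdiffZ _ (cdiff_id z)).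
Qed.

Lemma cmeas_pk a : cmeas D (pk a).
Proof.
apply: cmeasM; first exact: cmeas_cst.
by apply: cmeasV (cmeas_den a) => t _; exact: nc_ge0.
Qed.

Lemma measurable_eta_lt (tau : R) : measurable (D `&` [set t | eta (cpt t) < tau]).
Proof.
have -> : D `&` [set t : R * R | eta (cpt t) < tau] =
    D `&` (fun t : R * R => eta (cpt t)) @^-1` `]-oo, tau[%classic.
  by apply/seteqP; split => t [Dt]; rewrite /= in_itv.
by apply: (cmeas_eta (R := R)) => //; exact: measurable_disc.
Qed.

Lemma measurable_thin_set (w : C) (rho tau : R) :
  measurable (D `&` Qset w rho `&` [set t | eta (cpt t) < tau]).
Proof.
by rewrite setIAC; apply: measurableI; [exact: measurable_eta_lt|exact: measurable_Qset].
Qed.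

(** From y^2 <= x^2 follows y^2 <= 1/2, so [X] is at least 2/3. Then (X - |x|) X <= X^2 - x^2 = 1 -
    x^2 - y^2 < 2 tau puts |x| within 3 tau of [X]. *)
Let sector (x y tau : R) : x ^+ 2 + y ^+ 2 < 1 -> 1 - (x ^+ 2 + y ^+ 2) < 2 * tau ->
  y ^+ 2 <= x ^+ 2 ->
  let X := Num.sqrt (1 - y ^+ 2) in
  X - 3 * tau <= x <= X - 3 * tau + 3 * tau \/ - X <= x <= - X + 3 * tau.
Proof.
move=> n1 nt yx X; have y2 : 0 <= 1 - y ^+ 2 by have := sqr_ge0 x; lra.
have X0 : 0 <= X by exact: sqrtr_ge0.
have X2 : X ^+ 2 = 1 - y ^+ 2 by rewrite sqr_sqrtr.
have Xh : 2 / 3 <= X.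
  by rewrite -ler_sqr ?nnegrE// X2 expr_div_n; lra.
have ax : `|x| <= X by rewrite -ler_sqr ?nnegrE// X2 real_normK ?num_real//; lra.
have K : X - `|x| <= 3 * tau.
  have H : (X - `|x|) * X <= 2 * tau.
    apply: le_trans (_ : (X - `|x|) * (X + `|x|) <= _).
      by rewrite ler_wpM2l ?subr_ge0// lerDl.
    by rewrite -subr_sqr X2 real_normK ?num_real//; lra.
  have H2 : (X - `|x|) * (2 / 3) <= (X - `|x|) * X by rewrite ler_wpM2l ?subr_ge0.
  by move: (le_trans H2 H); lra.
have [x0|x0] := leP 0 x.
  by left; move: ax K; rewrite ger0_norm// => ? ?; apply/andP; split; lra.
by right; move: ax K; rewrite ltr0_norm// => ? ?; apply/andP; split; lra.
Qed.

Let eta_sector (x y tau : R) : disc (cpt (x, y)) -> eta (cpt (x, y)) < tau ->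
  x ^+ 2 + y ^+ 2 < 1 /\ 1 - (x ^+ 2 + y ^+ 2) < 2 * tau.
Proof.
rewrite /disc /eta /= => h1 h2; set n := nc (cpt (x, y)) in h2.
have nE : x ^+ 2 + y ^+ 2 = n ^+ 2 by rewrite /n nc_sqr.
have n0 : 0 <= n by exact: nc_ge0.
have n1 : n < 1 by [].
rewrite nE; split; first by rewrite expr_lt1.
have -> : 1 - n ^+ 2 = (1 - n) * (1 + n) by ring.
apply: le_lt_trans (_ : (1 - n) * 2 < _).
  by rewrite ler_wpM2l ?subr_ge0 ?ltW//; move: n1; clear; lra.
by rewrite mulrC ltr_pM2l.
Qed.

(** The ring is cut along the diagonals: where |y| <= |x| horizontal lines meet it in two intervals
    of length 3 tau, elsewhere vertical lines do. Each part has measure at most 2 (3 tau) (2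
    rho). *)
Lemma thin_set_measure (w : C) (rho tau : R) : 0 <= rho -> 0 < tau ->
  (lam (D `&` Qset w rho `&` [set t | (eta (cpt t) < tau)%R]) <= (24 * rho * tau)%:E)%E.
Proof.
move=> r0 t0; set B := _ `&` [set t | _].
have mB : measurable B by exact: measurable_thin_set.
pose S1 := [set t : R * R | t.2 ^+ 2 <= t.1 ^+ 2]; pose S2 := [set t :
  R * R | t.1 ^+ 2 <= t.2 ^+ 2].
have m1 : measurable_fun setT (fun t : R * R => t.1 ^+ 2).
  by apply: measurable_funX; exact: measurable_fst.
have m2 : measurable_fun setT (fun t : R * R => t.2 ^+ 2).
  by apply: measurable_funX; exact: measurable_snd.
have mS1 : measurable S1.
  rewrite -[S1]setTI; have := measurable_fun_ler m2 m1 => H.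
  by have := H measurableT [set true] I; rewrite [X in measurable X -> _](_ : _ = setT `&` S1).
have mS2 : measurable S2.
  rewrite -[S2]setTI; have := measurable_fun_ler m1 m2 => H.
  by have := H measurableT [set true] I; rewrite [X in measurable X -> _](_ : _ = setT `&` S2).
have itv_len (x : R) : (mu `[(x - rho)%R, (x + rho)%R]%classic <= (2 * rho)%:E)%E.
  rewrite lebesgue_measure_itv/= lte_fin; case: ifPn => _; last by rewrite lee_fin mulr_ge0.
  by rewrite -EFinB lee_fin; lra.
have l1 : (lam (B `&` S1) <= (2 * (3 * tau))%:E * (2 * rho)%:E)%E.
  apply: le_trans (lee_wpmul2l _ (itv_len (Im w))); last by rewrite lee_fin !mulr_ge0// ltW.
  apply: leb2_sectiony => //; first exact: measurableI.
  - by rewrite mulr_ge0// ltW.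
  - by move=> x y [[[_ [_ Q]] _] _]; rewrite /= in_itv.
  move=> y; exists (Num.sqrt (1 - y ^+ 2) - 3 * tau), (- Num.sqrt (1 - y ^+ 2)) => x.
  by move=> [[[h1 _] h2] h3]; have [? ?] := eta_sector h1 h2; exact: sector.
have l2 : (lam (B `&` S2) <= (2 * (3 * tau))%:E * (2 * rho)%:E)%E.
  apply: le_trans (lee_wpmul2l _ (itv_len (Re w))); last by rewrite lee_fin !mulr_ge0// ltW.
  apply: leb2_sectionx => //; first exact: measurableI.
  - by rewrite mulr_ge0// ltW.
  - by move=> x y [[[_ [Q _]] _] _]; rewrite /= in_itv.
  move=> x; exists (Num.sqrt (1 - x ^+ 2) - 3 * tau), (- Num.sqrt (1 - x ^+ 2)) => y.
  move=> [[[h1 _] h2] h3]; have [? ?] := eta_sector h1 h2.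
  by apply: sector; rewrite 1?[y ^+ 2 + _]addrC.
have -> : B = (B `&` S1) `|` (B `&` S2).
  rewrite -setIUr; apply/esym/setIidPl => t _.
  by have [h|h] := leP (t.2 ^+ 2) (t.1 ^+ 2); [left|right; exact: ltW].
apply: le_trans (measureU2 _ _ _) _; try exact: measurableI.
have -> : 24 * rho * tau = 2 * (3 * tau) * (2 * rho) + 2 * (3 * tau) * (2 * rho) by ring.
by rewrite EFinD EFinM; exact: leeD.
Qed.

Lemma cmeas_sqrt_eta : cmeas D (fun z => (Num.sqrt (eta z))^-1).
Proof.
apply: cmeasV => [t _|]; first exact: sqrtr_ge0.
apply: (eq_cmeas _ (cmeas_powR (2^-1) (@cmeas_eta R))) => t Dt.
by rewrite powR12_sqrt// ltW// eta_gt0.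
Qed.

(** Where eta is about rho / 4^l the weight is about 2^l / sqrt rho, while the measure is of order
    rho^2 / 4^l; a geometric series of ratio 1/2 remains. *)
Lemma weight_integral (w : C) (rho : R) : 0 < rho ->
  (iint (D `&` Qset w rho) (fun z => (Num.sqrt (eta z))^-1)%R <=
    (192 * (rho * Num.sqrt rho))%:E)%E.
Proof.
move=> r0; have s0 : 0 < Num.sqrt rho by rewrite sqrtr_gt0.
have mA : measurable (D `&` Qset w rho).
  by apply: measurableI; [exact: measurable_disc|exact: measurable_Qset].
have sqE : rho = Num.sqrt rho ^+ 2 by rewrite sqr_sqrtr// ltW.
have p4 l : (0 : R) < 4 ^+ l by rewrite exprn_gt0.
(* The index is shifted: layer 0 serves the points with eta >= rho, layer k + 1 lies below rho /
   4^k, because the least l with rho / 4^l <= eta satisfies eta < rho / 4^(l-1). The shift costs the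
   factor 4 in 96 = 24 * 4. *)
pose E l : set (R * R) := if l is k.+1 then D `&` [set t | eta (cpt t) < rho / 4 ^+ k] else setT.
apply: (@integral_cover R _ _ (fun=> 1) E (fun l => (Num.sqrt rho)^-1 * 2 ^+ l)
   (fun l => 96 * rho ^+ 2 / 4 ^+ l)) => //.
- by case=> [|k]; [exact: measurableT|exact: measurable_eta_lt].
- apply: cmeasS cmeas_sqrt_eta; first exact: measurable_disc.
  exact: subIsetl.
- exact: cmeas_cst.
- move=> t [Dt _]; have e0 : 0 < eta (cpt t) by rewrite eta_gt0.
  have ex : exists l, rho / 4 ^+ l <= eta (cpt t).
    have [n Hn] := exists_pow2_lt (divr_gt0 e0 r0); exists n.
    rewrite mulrC -ler_pdivlMr//; apply: le_trans (ltW Hn).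
    rewrite lef_pV2 ?posrE ?exprn_gt0// lerXn2r ?nnegrE ?ler_nat//.
  case: (ex_minnP ex) => l Hl lmin; exists l.
    case: l Hl lmin => [//|k] _ lmin; split => //=; rewrite ltNge; apply/negP => /lmin.
    by rewrite ltnn.
  rewrite mulr1 -[2 ^+ l]invrK -invfM lef_pV2 ?posrE ?sqrtr_gt0//; last first.
    by rewrite mulr_gt0// invr_gt0 exprn_gt0.
  have -> : Num.sqrt rho * 2 ^- l = Num.sqrt (rho / 4 ^+ l).
    rewrite sqrtrM ?(ltW r0)// sqrtrV ?exprn_ge0//; congr (_ / _).
    have -> : (4 : R) ^+ l = (2 ^+ l) ^+ 2 by rewrite -exprM mulnC exprM; congr (_ ^+ l); ring.
    by rewrite sqrtr_sqr ger0_norm// exprn_ge0.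
  exact: ler_wsqrtr.
- move=> l; apply: (@le_trans _ _ (lam (D `&` Qset w rho `&` E l))).
    rewrite iint_cst ?mul1e//; apply: measurableI => //.
    by case: l => [|k]; [exact: measurableT|exact: measurable_eta_lt].
  case: l => [|k] /=.
    rewrite setIT expr0 divr1; apply: (@le_trans _ _ (lam (Qset w rho))).
      by apply: le_measure; rewrite ?inE//; exact: measurable_Qset.
    by rewrite leb2_Qset ?(ltW r0)// lee_fin ler_wpM2r ?exprn_ge0 ?(ltW r0)// ler_nat.
  rewrite setIA [_ `&` D]setIAC setIid.
  apply: le_trans (thin_set_measure _ (ltW r0) _) _; first by rewrite divr_gt0.
  rewrite lee_fin (exprS 4 k) le_eqVlt; apply/orP; left; apply/eqP.
  by move: (p4 k); set u := 4 ^+ k => u0; field; rewrite lt0r_neq0.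
move=> N; have -> : \sum_(l < N) (Num.sqrt rho)^-1 * 2 ^+ l * (96 * rho ^+ 2 / 4 ^+ l) =
    \sum_(l < N) (96 * (rho * Num.sqrt rho)) * 2^-1 ^+ l.
  apply: eq_bigr => l _; have -> : (4 : R) ^+ l = 2 ^+ l * 2 ^+ l by rewrite -exprMn;
    congr (_ ^+ l); ring.
  rewrite exprVn [rho ^+ 2](_ : _ = rho * Num.sqrt rho ^+ 2); last by rewrite -sqE expr2.
  by field; rewrite expf_neq0// lt0r_neq0.
apply: le_trans (geometric_sum_le _ _ _) _; first by rewrite !mulr_ge0// ?ltW.
  by rewrite invr_gt0 invf_lt1// ltr0n ltr1n.
by rewrite le_eqVlt; apply/orP; left; apply/eqP; field.
Qed.

(** At a distance from [a] between eta(a) 2^(m-1) and eta(a) 2^m the kernel is at most 2 / 2^m.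
    Masses growing by a factor b < 2^r from one square to the next are therefore summable against
    its r-th power. *)
Lemma kernel_integral a (h : C -> R) (U b r : R) : nc a < 1 -> 0 <= U -> 0 < b -> b < 2 `^ r ->
  0 < r -> cmeas D h -> (forall t, D t -> 0 <= h (cpt t)) ->
  (forall m, (iint (D `&` Qset a (eta a * 2 ^+ m)) h <= (U * b ^+ m)%:E)%E) ->
  (iint D (fun z => pk a z `^ r * h z)%R <= (2 `^ r * U / (1 - b / 2 `^ r))%:E)%E.
Proof.
move=> a1 U0 b0 br r0 mh h0 Hm; have e0 : 0 < eta a by rewrite eta_gt0.
have p0 : 0 < 2 `^ r :> R by rewrite powR_gt0.
apply: (@integral_cover R _ _ h (fun m => Qset a (eta a * 2 ^+ m))
  (fun m => 2 `^ r * (2 `^ r)^-1 ^+ m) (fun m => U * b ^+ m)) => //.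
- exact: measurable_disc.
- by move=> m; exact: measurable_Qset.
- by apply: cmeasM => //; apply: cmeas_powR; exact: cmeas_pk.
- by move=> t Dt; rewrite mulr_ge0 ?powR_ge0// h0.
- move=> t Dt; have z1 : nc (cpt t) < 1 by [].
  set z := cpt t in z1 *.
  have ex : exists m, nc (z - a) <= eta a * 2 ^+ m.
    have n0 : 0 < nc (z - a) + 1 by rewrite ltr_wpDl// nc_ge0.
    have [m Hm'] := exists_pow2_lt (divr_gt0 e0 n0); exists m.
    rewrite -ler_pdivrMr ?exprn_gt0//; move: Hm'; rewrite ltr_pdivlMr// mulrC => /ltW.
    by apply: le_trans; rewrite ler_wpM2r ?invr_ge0 ?exprn_ge0// lerDl.
  case: (ex_minnP ex) => m mz mmin; exists m; first exact: Qrect_near.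
  rewrite ler_wpM2r ?h0//.
  have P2 : pk a z <= 2 / 2 ^+ m.
    case: m mz mmin => [|m] mz mmin.
      by rewrite expr0 divr1 (le_trans (pk_le1 a1 (ltW z1)))// ler1n.
    have za : eta a * 2 ^+ m < nc (z - a).
      by rewrite ltNge; apply/negP => /mmin; rewrite ltnn.
    have dz : eta a * 2 ^+ m <= den a z.
      by apply: le_trans (ltW za) _; exact: den_ge_dist (ltW a1) (ltW z1).
    rewrite /pk (ler_pdivrMr _ _ (den_gt0 a1 (ltW z1))) exprS invfM mulrA mulfV ?pnatr_eq0// mul1r.
    by rewrite mulrC ler_pdivlMr ?exprn_gt0.
  apply: (@le_trans _ _ ((2 / 2 ^+ m) `^ r)).
    have pk0 := ltW (pk_gt0 a1 (ltW z1)).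
    by apply: ge0_ler_powR P2; rewrite ?nnegrE ?pk0 ?(ltW r0)// divr_ge0 ?exprn_ge0.
  rewrite powRM ?invr_ge0 ?exprn_ge0// ler_wpM2l ?powR_ge0//.
  rewrite -powR_inv1 ?exprn_ge0// powRAC powR_inv1 ?powR_ge0// exprVn.
  by rewrite -!powR_mulrn ?powR_ge0// powRAC.
move=> N; have -> : \sum_(l < N) 2 `^ r * (2 `^ r)^-1 ^+ l * (U * b ^+ l) =
    \sum_(l < N) (2 `^ r * U) * (b / 2 `^ r) ^+ l.
  by apply: eq_bigr => l _; rewrite exprMn; ring.
apply: geometric_sum_le; first by rewrite mulr_ge0// ltW.
by rewrite divr_gt0// ltr_pdivrMr// mul1r.
Qed.

End BergmanKernel.

(** * A Whitney decomposition of the disc into dyadic squares *)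

Section Whitney.
Variable R : realType.
Local Notation C := (R[i])^o.
Local Notation Re := complex.Re.
Local Notation Im := complex.Im.
Local Notation lam := (@leb2 R).
Local Notation D := (Dset R).

Let same n (t u : R * R) :=
  Num.floor (2 ^+ n * t.1) = Num.floor (2 ^+ n * u.1) /\
  Num.floor (2 ^+ n * t.2) = Num.floor (2 ^+ n * u.2).

Let same_sym n t u : same n t u -> same n u t.
Proof. by case. Qed.

Let good_num (s p q : R) : s < q / 10 -> q <= p + 2 * s -> 8 * s <= p.
Proof. by lra. Qed.

Let bad_num (s p q : R) : q < 8 * s -> p <= q + 2 * s -> p <= 10 * s.
Proof. by lra. Qed.

Let n1 (s e x y : R) : x <= 2 * e -> y <= 2 * s -> 8 * s <= e -> 0 <= s -> x + y <= 3 * e.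
Proof. by lra. Qed.

Let n2 (s x y d : R) : 8 * s <= 1 - y -> 0 <= y -> y < 1 / 4 -> x - y <= d -> d <= 2 * s ->
  x <= 1 / 2.
Proof. by lra. Qed.

Let n3 (x : R) : x <= 1 / 2 -> 1 + 1 / 2 * x <= 3 * (1 / 2).
Proof. by lra. Qed.

Let n4 (x : R) : 0 <= x -> x <= 1 / 2 -> 1 / 2 / 2 <= 1 - x <= 2 * (1 / 2).
Proof. by move=> *; apply/andP; split; lra. Qed.

Let n5 (s y : R) : 1 - y <= 20 * s -> y < 1 / 4 -> 1 / 80 <= s.
Proof. by lra. Qed.

Let n6 (s y : R) : 0 < s -> 8 * s <= 1 - y -> y <= 1.
Proof. by lra. Qed.

Let n7 (s x y : R) : 0 < s -> y <= x + 2 * s -> x <= y + 2 * s -> 8 * s <= y ->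
  y / 2 <= x <= 2 * y.
Proof. by move=> *; apply/andP; split; lra. Qed.

Let n8 : 1 / 2 ^+ 2 / 1600 <= (1 / 80) ^+ 2 :> R.
Proof. by lra. Qed.

Let n11 (x : R) : x ^+ 2 / 1600 <= (x / 20) ^+ 2.
Proof.
have -> : (x / 20) ^+ 2 = x ^+ 2 * (1 / 400) by field.
have -> : x ^+ 2 / 1600 = x ^+ 2 * (1 / 1600) by field.
by apply: ler_wpM2l; [exact: sqr_ge0|lra].
Qed.

Let n9 (x : R) : x <= 1 -> 1 + x <= 2.
Proof. by lra. Qed.

Let n10 (q r x : R) : q * 2 + r <= 2 * x -> 2 * x < q * 2 + r + 1 -> 0 <= r -> r <= 1 ->
  q <= x < q + 1.
Proof. by move=> *; apply/andP; split; lra. Qed.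

Let floor_half (x : R) : Num.floor x = (Num.floor (2 * x) %/ 2)%Z.
Proof.
apply: floor_def; set k := Num.floor (2 * x).
have /andP[h1 h2] := floor_itv (2 * x); rewrite -/k in h1 h2.
have kE := divz_eq k 2; have r0 := modz_ge0 k (isT : (2 : int) != 0).
have r1 : (k %% 2)%Z < 2 by exact: ltz_pmod.
set q := (k %/ 2)%Z in kE *; set r := (k %% 2)%Z in kE r0 r1.
have r1' : r <= 1 by rewrite -ltzD1.
have r0R : (0 : R) <= r%:~R by rewrite ler0z.
have r1R : (r%:~R : R) <= 1 by rewrite -[1]/(1%:~R) ler_int.
have kR : (k%:~R : R) = q%:~R * 2 + r%:~R by rewrite kE intrD intrM.
rewrite intrD kR in h2; rewrite kR in h1; rewrite intrD; exact: n10 h1 h2 r0R r1R.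
Qed.

Let same_pred n t u : same n.+1 t u -> same n t u.
Proof.
move=> [h1 h2]; split; rewrite floor_half [RHS]floor_half !mulrA -exprS.
  by rewrite h1.
by rewrite h2.
Qed.

Let same_le m n t u : (m <= n)%N -> same n t u -> same m t u.
Proof.
move=> /subnK <-; elim: (n - m)%N => [//|k IH]; rewrite addSn => /same_pred; exact: IH.
Qed.

(** The whole cell of [t], of side s, keeps a distance of at least 8 s from the circle; the 8 makes
    the kernel at the centre comparable to 1 on the cell. *)
Let good n t := forall u, same n t u -> 8 / 2 ^+ n <= eta (cpt u : C).

Let same_dist n t u : same n t u -> nc (cpt t - cpt u : C) <= 2 / 2 ^+ n.
Proof.
move=> [h1 h2]; have ut := mem_dcell n u; rewrite -h1 -h2 in ut.
have [k1 k2] := dcell_dist (mem_dcell n t) ut.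
apply: le_trans (nc_le_ReIm _) _; rewrite ReD ImD ReN ImN /=.
have -> : 2 / 2 ^+ n = 2 ^- n + 2 ^- n :> R by ring.
exact: lerD.
Qed.

Let same_eta n t u : same n t u -> eta (cpt u : C) <= eta (cpt t) + 2 / 2 ^+ n.
Proof.
move=> /same_dist H; rewrite -lerBlDr; apply: le_trans (eta_dist (cpt t) (cpt u)).
by rewrite lerD2l lerN2.
Qed.

Let good_same n t u : same n t u -> good n t -> good n u.
Proof.
move=> [h1 h2] H w [k1 k2]; apply: H; split; [by rewrite h1|by rewrite h2].
Qed.

(** Cells of the first good generation are the Whitney squares: as generations are nested, they are
    disjoint. *)
Let least n t := good n t /\ forall m, (m < n)%N -> ~ good m t.

Let least_same n t u : same n t u -> least n t -> least n u.
Proof.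
move=> tu [g l]; split; first exact: good_same g.
move=> m mn gu; apply: (l m mn); have [h1 h2] := same_le (ltnW mn) tu.
by apply: good_same gu; split.
Qed.

Let least_ex t : D t -> exists n, least n t.
Proof.
move=> Dt; have e0 : 0 < eta (cpt t : C) by rewrite eta_gt0.
have ex : exists n, `[< good n t >].
  have [n Hn] := exists_pow2_lt (divr_gt0 e0 (ltr0n _ 10)); exists n.
  apply/asboolP => u tu; have ut := same_sym tu.
  exact: good_num Hn (same_eta ut).
case: (ex_minnP ex) => n /asboolP gn nmin; exists n; split=> // m mn gm.
have /nmin : `[< good m t >] by apply/asboolP.
by rewrite leqNgt mn.
Qed.

(** The parent of such a cell of side s contains a point with eta below 16 s, and moving inside the
    parent changes eta by at most 4 s, which gives 20. Generation 0 is never good, since eta <=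
    1. *)
Let least_bounds n t : least n t -> 8 / 2 ^+ n <= eta (cpt t : C) <= 20 / 2 ^+ n.
Proof.
move=> [g l]; have gt := g t (conj erefl erefl); rewrite gt /=.
case: n g l gt => [|n] g l gt.
  by have := eta_le1 (cpt t : C); move: gt; rewrite expr0 divr1; set e := eta _; lra.
have [u [tu ue]] : exists u, same n t u /\ eta (cpt u : C) < 8 / 2 ^+ n.
  apply: contrapT => N; apply: (l n (ltnSn n)) => u tu; rewrite leNgt; apply/negP => ue.
  by apply: N; exists u.
have ut := same_sym tu.
have -> : 20 / 2 ^+ n.+1 = 10 * 2 ^- n :> R.
  by rewrite exprS; field; exact: expf_neq0.
exact: bad_num ue (same_eta ut).
Qed.

Let W (k : nat * int * int) : bool :=
  `[< exists2 t, dcell k.1.1 k.1.2 k.2 t & least k.1.1 t >].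

Let cell_same n i j t u : @dcell R n i j t -> dcell n i j u -> same n t u.
Proof.
by move=> /dcell_floor[h1 h2] /dcell_floor[h3 h4]; split; [rewrite -h1 -h3|rewrite -h2 -h4].
Qed.

Let W_least n i j t : W (n, i, j) -> dcell n i j t -> least n t.
Proof. by move=> /asboolP[/= u ui lu] ti; apply: least_same lu; exact: cell_same ui ti. Qed.

Let corner (k : nat * int * int) : R * R :=
  (k.1.2%:~R / 2 ^+ k.1.1, k.2%:~R / 2 ^+ k.1.1).

Let corner_in k : dcell k.1.1 k.1.2 k.2 (corner k).
Proof.
rewrite /dcell /corner /=; have p0 : 2 ^+ k.1.1 != 0 :> R by exact: expf_neq0.
by rewrite ![2 ^+ _ * _]mulrC !divfK// !lexx !ltr_int !ltzD1 !lexx.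
Qed.

Let center (k : nat * int * int) : C :=
  if W k && (1 / 4 <= nc (cpt (corner k) : C)) then cpt (corner k) else (1 / 2)%:C%C.

Let half_nc : nc ((1 / 2)%:C%C : C) = 1 / 2.
Proof. by rewrite nc_real ger0_norm. Qed.

Let half_eta : eta ((1 / 2)%:C%C : C) = 1 / 2.
Proof. by rewrite /eta half_nc; field. Qed.

Let den_near (a z : C) (s : R) : nc (z - a) <= 2 * s -> 8 * s <= eta a -> nc a <= 1 ->
  den a z <= 3 * eta a.
Proof.
move=> h1 h2 h3; rewrite /den.
have -> : 1 - a^*%C * z = (1 - a^*%C * a) - a^*%C * (z - a) by ring.
apply: le_trans (ncB _ _) _; rewrite ncM nc_conj.
have k1 : nc (1 - a^*%C * a : C) <= 2 * eta a.
  have -> : 1 - a^*%C * a = ((1 - nc a ^+ 2)%:C)%C :> C.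
    by apply: complex_eqP; rewrite /= ?nc_sqr; case: (a) => p q /=; ring.
  rewrite nc_real ger0_norm; last by rewrite subr_ge0 expr_le1 ?nc_ge0.
  have -> : 1 - nc a ^+ 2 = (1 + nc a) * eta a by rewrite /eta; ring.
  by rewrite ler_wpM2r ?subr_ge0// n9.
have k2 : nc a * nc (z - a) <= 2 * s.
  by apply: le_trans h1; rewrite ler_piMl ?nc_ge0.
have s0 : 0 <= s by have := le_trans (nc_ge0 _) h1; rewrite pmulr_rge0.
exact: n1 k1 k2 h2 s0.
Qed.

(** At a corner used as centre the comparisons come from [least_bounds]. If the centre is moved to
    1/2, the cell lies in |z| <= 1/2 and has side at least 1/80; the constant 1600 = 80^2 / 4 is
    dictated by this exceptional case. *)
Let center_spec k t : W k -> dcell k.1.1 k.1.2 k.2 t ->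
  [/\ den (center k) (cpt t) <= 3 * eta (center k),
      eta (center k) / 2 <= eta (cpt t : C) <= 2 * eta (center k) &
      eta (center k) ^+ 2 / 1600 <= (2 ^- k.1.1) ^+ 2].
Proof.
case: k => [[n i] j] Wk /= tk; have ck := corner_in (n, i, j).
have lt := W_least Wk tk; have lc := W_least Wk ck.
have /andP[t1 t2] := least_bounds lt; have /andP[c1 c2] := least_bounds lc.
have ct := same_dist (cell_same tk ck).
rewrite /center Wk /=; set c : C := cpt (corner (n, i, j)) in ct c1 c2 *.
have := same_eta (cell_same tk ck); have := same_eta (cell_same ck tk); rewrite -/c.
move: t1 t2 c1 c2 ct.
rewrite -[8 / _]/(8 * 2 ^- n) -[2 / _]/(2 * 2 ^- n) -[20 / _]/(20 * 2 ^- n).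
have s0 : 0 < 2 ^- n :> R by rewrite invr_gt0 exprn_gt0.
set s := 2 ^- n in s0 *; set z : C := cpt t => t1 t2 c1 c2 ct m1 m2.
case: ifPn => [c4|]; last first.
  rewrite -ltNge => c4; rewrite half_eta.
  have z2 : nc z <= 1 / 2.
    exact: n2 c1 (nc_ge0 c) c4 (nc_lowerB z c) ct.
  split.
  - rewrite /den; apply: le_trans (ncB _ _) _; rewrite nc1 ncM nc_conj half_nc.
    exact: n3.
  - exact: n4 (nc_ge0 z) z2.
  - have s80 : 1 / 80 <= s := n5 c2 c4.
    apply: (@le_trans _ _ ((1 / 80) ^+ 2)); first by rewrite expr_div_n expr1n n8.
    by rewrite ler_sqr ?nnegrE// ltW.
have cn1 : nc c <= 1 := n6 s0 c1.
split.
- exact: (den_near ct).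
- by apply: (n7 s0).
- apply: (@le_trans _ _ ((eta c / 20) ^+ 2)).
    exact: n11.
  rewrite ler_sqr ?nnegrE ?(ltW s0)//; last first.
    by rewrite divr_ge0// subr_ge0.
  by rewrite ler_pdivrMr// mulrC.
Qed.

(* E k is a dyadic square if v k holds, and empty otherwise. The centre a k is a
   corner of the square, except near 0, where it is 1/2 because the derivatives of
   the kernel at a k carry powers of the conjugate of a k. *)
Lemma whitney : exists (E : nat -> set (R * R)) (a : nat -> C) (v : nat -> bool),
  [/\ (forall k, measurable (E k)), trivIset setT E, \bigcup_k E k = D,
      (forall k, 1 / 4 <= nc (a k) < 1) &
      (forall k t, E k t -> [/\ v k, den (a k) (cpt t) <= 3 * eta (a k) &
         eta (a k) / 2 <= eta (cpt t : C) <= 2 * eta (a k)]) /\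
      (forall k, v k -> ((eta (a k) ^+ 2 / 1600)%:E <= lam (E k))%E)].
Proof.
(* Cells are numbered by pickling; a number that codes no cell receives the empty set and the centre
   1/2. *)
pose idx k : option (nat * int * int) := pickle_inv k.
pose v k := if idx k is Some c then W c else false.
pose E k : set (R * R) := if idx k is Some c then (if W c then dcell c.1.1 c.1.2 c.2 else set0)
  else set0.
pose a k : C := if idx k is Some c then center c else (1 / 2)%:C%C.
exists E, a, v; split.
- move=> k; rewrite /E; case: (idx k) => [c|]; last exact: measurable0.
  by case: ifP => _; [exact: measurable_dcell|exact: measurable0].
- have EP k t : E k t -> exists c, [/\ idx k = Some c, dcell c.1.1 c.1.2 c.2 t & least c.1.1 t].
    rewrite /E; case: (idx k) => [[[n i] j]|//]; case: ifPn => // Wc tc.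
    by exists (n, i, j); split=> //; exact: W_least Wc tc.
  apply/trivIsetP => k l _ _; apply: contra_neqP => /eqP/set0P[t [/EP[[[n i] j] [/= k1 k2 k3]]
    /EP[[[n' i'] j'] [/= l1 l2 l3]]]].
  have nn : n = n'.
    apply/eqP; rewrite eqn_leq; apply/andP; split; rewrite leqNgt; apply/negP => lt.
      by case: k3 => _ /(_ _ lt); apply; case: l3.
    by case: l3 => _ /(_ _ lt); apply; case: k3.
  subst n'; have [e1 e2] := dcell_floor k2; have [e3 e4] := dcell_floor l2.
  have kl : idx k = idx l by rewrite k1 l1 e1 e2 e3 e4.
  have := @pickle_invK (nat * int * int)%type k; have := @pickle_invK (nat * int * int)%type l.
  by rewrite -!/(idx _) k1 l1 /= e1 e2 e3 e4 => <- <-.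
- apply/seteqP; split=> [t [k _]|t Dt].
    rewrite /E; case: (idx k) => [[[n i] j]|//]; case: ifPn => // Wc /= tc.
    have /andP[h _] := least_bounds (W_least Wc tc).
    suff : nc (cpt t : C) < 1 by [].
    rewrite -eta_gt0; apply: lt_le_trans h.
    by rewrite divr_gt0 ?exprn_gt0.
  have [n ln] := least_ex Dt.
  pose c := (n, Num.floor (2 ^+ n * t.1), Num.floor (2 ^+ n * t.2)).
  have tc : dcell c.1.1 c.1.2 c.2 t := mem_dcell n t.
  have Wc : W c by apply/asboolP; exists t.
  by exists (pickle c) => //; rewrite /E /idx pickleK_inv Wc.
- have h : 1 / 4 <= nc ((1 / 2)%:C%C : C) < 1 by rewrite half_nc; apply/andP; split; lra.
  move=> k; rewrite /a; case: (idx k) => [c|//]; rewrite /center; case: ifPn => // /andP[Wc ->];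
    rewrite andTb.
  case: c Wc => [[n i] j] Wc; have /andP[b _] := least_bounds (W_least Wc (corner_in (n, i, j))).
  by rewrite -eta_gt0; apply: lt_le_trans b; rewrite divr_gt0 ?exprn_gt0.
- split=> [k t|k]; rewrite /E /a /v; case: (idx k) => [c|//].
    by case: ifPn => // Wc tc; have [] := center_spec Wc tc.
  by move=> Wc; rewrite Wc leb2_dcell lee_fin; have [] := center_spec Wc (corner_in c).
Qed.

End Whitney.

(** * Forelli-Rudin estimates for integrals and for sums over the centres *)

Section KernelSums.
Variable R : realType.
Local Notation C := (R[i])^o.
Local Notation lam := (@leb2 R).
Local Notation D := (Dset R).

Lemma sum_iint_le (E : nat -> set (R * R)) (P : pred nat) (g : C -> R) J :
  (forall k, measurable (E k)) -> trivIset setT E -> (forall k, E k `<=` D) ->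
  cmeas D g -> (forall t, D t -> 0 <= g (cpt t)) ->
  (\sum_(k < J | P k) iint (E k) g <= iint D g)%E.
Proof.
move=> mE tE ED mg g0.
apply: (@le_trans _ _ (\sum_(k < J) iint (E k) g)%E).
  rewrite big_mkcond /=; apply: lee_sum => k _; case: ifP => // _.
  by apply: iint_ge0 => t /ED; exact: g0.
have SD : \big[setU/set0]_(k <- index_iota 0 J) E k `<=` D.
  by rewrite -bigcup_seq => t [k _]; exact: ED.
have mB : measurable (\big[setU/set0]_(k <- index_iota 0 J) E k).
  by apply: bigsetU_measurable => k _; exact: mE.
have mgE : measurable_fun D (fun t : R * R => (g (cpt t))%:E) by exact/measurable_EFinP.
have mD : measurable D by exact: measurable_disc.
rewrite -(big_mkord xpredT (fun k => iint (E k) g)) /iint -ge0_integral_bigsetU//.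
- by apply: ge0_subset_integral.
- exact: iota_uniq.
- exact: sub_trivIset tE.
- exact: (measurable_funS mD SD mgE).
- by move=> t /SD Dt; rewrite lee_fin g0.
Qed.

Lemma powRV (x d : R) : 0 <= x -> x^-1 `^ d = (x `^ d)^-1.
Proof. by move=> x0; rewrite -powR_inv1// powRAC powR_inv1// powR_ge0. Qed.

Lemma gt1_powR2 (d : R) : 0 < d -> 4 < 2 `^ (2 + d).
Proof.
move=> d0; rewrite powRD ?pnatr_eq0 ?implybT// -[X in _ `^ X * _]/(2%:R) powR_mulrn//.
have -> : 2 ^+ 2 = 4 :> R by ring.
rewrite ltr_pMr// /powR pnatr_eq0 /= -[ltLHS]expR0 ltr_expR mulr_gt0// ln_gt0//; lra.
Qed.

(** The Forelli-Rudin estimate. The condition 4 < 2^r says r > 2, the 4 being the growth of the area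
    of squares with doubled side. *)
Lemma pk_integral (r : R) : 4 < 2 `^ r -> 0 < r -> exists2 K : R, 0 < K & forall a : C,
  nc a < 1 -> (iint D (fun z => pk a z `^ r)%R <= (K * eta a ^+ 2)%:E)%E.
Proof.
move=> r4 r0; have k0 : 0 < 1 - 4 / 2 `^ r.
  by rewrite subr_gt0 ltr_pdivrMr ?powR_gt0// mul1r.
exists (2 `^ r * 4 / (1 - 4 / 2 `^ r)); first by rewrite divr_gt0// mulr_gt0// powR_gt0.
move=> a a1; have := @kernel_integral R a (fun=> 1) (4 * eta a ^+ 2) 4 r a1.
have e0 : 0 < eta a by rewrite eta_gt0.
have -> : 2 `^ r * (4 * eta a ^+ 2) / (1 - 4 / 2 `^ r) = 2 `^ r * 4 / (1 - 4 / 2 `^ r) * eta a ^+ 2.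
  by ring.
rewrite (@eq_iint _ _ (fun z => pk a z `^ r * 1) (fun z => pk a z `^ r)); last first.
  by move=> t _; rewrite mulr1.
apply => //; first by rewrite mulr_ge0 ?exprn_ge0 ?(ltW e0).
  exact: cmeas_cst.
move=> m; have mD : measurable (D `&` Qset a (eta a * 2 ^+ m)).
  by apply: measurableI; [exact: measurable_disc|exact: measurable_Qset].
rewrite iint_cst// mul1e; apply: (@le_trans _ _ (lam (Qset a (eta a * 2 ^+ m)))).
  by apply: le_measure; rewrite ?inE//; exact: measurable_Qset.
rewrite leb2_Qset ?mulr_ge0 ?exprn_ge0 ?(ltW e0)// lee_fin le_eqVlt; apply/orP; left; apply/eqP.
have -> : (4 : R) ^+ m = 2 ^+ m * 2 ^+ m by rewrite -exprMn; congr (_ ^+ m); ring.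
by ring.
Qed.

(** By [weight_integral] the weighted masses grow by 2^(3/2) per doubling, which is bounded by 4;
    the kernel exponent 4 beats this growth. *)
Lemma pk_integral_weighted : exists2 K : R, 0 < K & forall a : C, nc a < 1 ->
  (iint D (fun z => pk a z `^ 4 * (Num.sqrt (eta z))^-1)%R <= (K * (eta a * Num.sqrt (eta
    a)))%:E)%E.
Proof.
have r4 : 4 < 2 `^ 4 :> R by rewrite -[X in _ `^ X]/(4%:R) powR_mulrn//; lra.
have k0 : 0 < 1 - 4 / 2 `^ 4 :> R.
  by rewrite subr_gt0 ltr_pdivrMr ?powR_gt0// mul1r.
exists (2 `^ 4 * 192 / (1 - 4 / 2 `^ 4)); first by rewrite divr_gt0// mulr_gt0// powR_gt0.
move=> a a1; have e0 : 0 < eta a by rewrite eta_gt0.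
have := @kernel_integral R a (fun z => (Num.sqrt (eta z))^-1) (192 * (eta a * Num.sqrt (eta a)))
  4 4 a1.
have -> : 2 `^ 4 * (192 * (eta a * Num.sqrt (eta a))) / (1 - 4 / 2 `^ 4) =
   2 `^ 4 * 192 / (1 - 4 / 2 `^ 4) * (eta a * Num.sqrt (eta a)).
  by ring.
apply => //; first by rewrite !mulr_ge0 ?sqrtr_ge0 ?(ltW e0).
  exact: cmeas_sqrt_eta.
move=> m; apply: le_trans (weight_integral _ _) _; first by rewrite mulr_gt0// exprn_gt0.
rewrite lee_fin -[leRHS]mulrA ler_pM2l// sqrtrM ?(ltW e0)//.
have -> : eta a * 2 ^+ m * (Num.sqrt (eta a) * Num.sqrt (2 ^+ m)) =
  (eta a * Num.sqrt (eta a)) * (2 ^+ m * Num.sqrt (2 ^+ m)) by ring.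
apply: ler_wpM2l; first by rewrite mulr_ge0 ?sqrtr_ge0 ?(ltW e0).
have -> : (4 : R) ^+ m = 2 ^+ m * 2 ^+ m by rewrite -exprMn; congr (_ ^+ m); ring.
apply: ler_wpM2l; first exact: exprn_ge0.
rewrite -[leRHS]ger0_norm ?exprn_ge0// -sqrtr_sqr ler_wsqrtr// expr2 ler_peMl ?exprn_ge0//.
by rewrite exprn_ege1// ler1n.
Qed.

Variables (E : nat -> set (R * R)) (a : nat -> C) (v : nat -> bool) (s : R).
Hypotheses (mE : forall k, measurable (E k)) (tE : trivIset setT E) (ED : \bigcup_k E k = D).
Hypothesis a1 : forall k, 1 / 4 <= nc (a k) < 1.
Hypothesis Ea : forall k t, E k t -> [/\ v k, den (a k) (cpt t) <= 3 * eta (a k) &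
         eta (a k) / 2 <= eta (cpt t : C) <= 2 * eta (a k)].
Hypothesis s0 : 0 < s.
Hypothesis lE : forall k, v k -> ((s * eta (a k) ^+ 2)%:E <= lam (E k))%E.

(** The sum is compared with the integral over w of the power 2 + d of [pk z w]. On [E k] its
    denominator is at most 4 times the one at the centre, the measure of [E k] is at least a
    multiple of eta(a k)^2, and the squares are disjoint. Exchanging the roles of z and the centre
    in the kernel produces the factor (eta z / eta(a k))^d. *)
Lemma kernel_sum (d : R) : 0 < d -> exists2 K : R, 0 < K & forall J (z : C), nc z < 1 ->
  \sum_(k < J | v k) pk (a k) z `^ (2 + d) * (eta z / eta (a k)) `^ d <= K.
Proof.
move=> d0; have r0 : 0 < 2 + d by rewrite addr_gt0.
have [K K0 HK] := pk_integral (gt1_powR2 d0) r0.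
have p4 : 0 < 4 `^ (2 + d) :> R by rewrite powR_gt0.
exists (s^-1 * 4 `^ (2 + d) * K); first by rewrite !mulr_gt0// invr_gt0.
move=> J z z1; have ez : 0 < eta z by rewrite eta_gt0.
have ak k : nc (a k) < 1 by have /andP[] := a1 k.
have ek k : 0 < eta (a k) by rewrite eta_gt0.
have dk k : 0 < den (a k) z by rewrite den_gt0// ltW.
pose T k := s * eta (a k) ^+ 2 * (eta z / (4 * den (a k) z)) `^ (2 + d).
have ED' k : E k `<=` D by rewrite -ED => t Et; exists k.
have mpk : cmeas D (fun w => pk z w `^ (2 + d)) by apply: cmeas_powR; exact: cmeas_pk.
have Tk k : v k -> ((T k)%:E <= iint (E k) (fun w => pk z w `^ (2 + d))%R)%E.
  move=> vk; apply: (@le_trans _ _ (iint (E k) (fun=> (eta z / (4 * den (a k) z)) `^ (2 + d))%R)).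
    rewrite iint_cst// /T mulrC EFinM; apply: lee_wpmul2l; first by rewrite lee_fin powR_ge0.
    exact: lE.
  apply: iint_le => //.
  - exact: cmeas_cst.
  - by apply: cmeasS mpk; [exact: measurable_disc|exact: ED'].
  - by move=> t _; exact: powR_ge0.
  move=> t Et; have [_ h1 _] := Ea Et; have t1 : nc (cpt t) < 1 := ED' k t Et.
  have p0 := ltW (pk_gt0 z1 (ltW t1)).
  apply: ge0_ler_powR; rewrite ?nnegrE ?(ltW r0) ?divr_ge0 ?mulr_ge0 ?(ltW ez) ?(ltW (dk k)) ?p0//.
    exact: nc_ge0.
  rewrite /pk ler_pM2l// lef_pV2 ?posrE ?mulr_gt0// ?den_gt0 ?(ltW t1)//.
  rewrite den_sym /den.
  have -> : 1 - (cpt t)^*%C * z = (1 - (a k)^*%C * z) - ((cpt t)^*%C - (a k)^*%C) * z :> C by ring.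
  apply: le_trans (ncB _ _) _; rewrite ncM -rmorphB nc_conj.
  have h2 : nc (cpt t - a k) * nc z <= 3 * den (a k) z.
    apply: (@le_trans _ _ (nc (cpt t - a k))); first by rewrite ler_piMr ?nc_ge0// ltW.
    apply: le_trans (den_ge_dist (ltW (ak k)) (ltW t1)) _; apply: le_trans h1 _.
    by rewrite ler_pM2l// den_ge_etal// ltW.
  by apply: le_trans (lerD (lexx _) h2) _; rewrite -/(den (a k) z); move: (den _ _) => x; lra.
have sT : \sum_(k < J | v k) T k <= K * eta z ^+ 2.
  rewrite -lee_fin -sumEFin; apply: le_trans (HK z z1).
  apply: le_trans (@sum_iint_le E v _ J mE tE ED' mpk _); last by move=> t _; exact: powR_ge0.
  by apply: lee_sum => k vk; exact: Tk.
have -> : \sum_(k < J | v k) pk (a k) z `^ (2 + d) * (eta z / eta (a k)) `^ d =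
  \sum_(k < J | v k) (s^-1 * 4 `^ (2 + d) / eta z ^+ 2) * T k.
  apply: eq_bigr => k _; rewrite /T /pk.
  have -> : eta z / (4 * den (a k) z) = eta z / 4 / den (a k) z by field; rewrite lt0r_neq0.
  rewrite !powRM ?invr_ge0 ?divr_ge0 ?(ltW ez) ?(ltW (ek k)) ?(ltW (dk k))//.
  rewrite !powRV ?(ltW (ek k)) ?(ltW (dk k))//.
  rewrite !(@powRD _ _ 2 d) ?lt0r_neq0 ?implybT//.
  have P2 (x : R) : 0 <= x -> x `^ 2 = x ^+ 2 by move=> x0; rewrite -powR_mulrn.
  rewrite !P2 ?(ltW ez) ?(ltW (ek k)) ?(ltW (dk k))//.
  field.
  by rewrite !lt0r_neq0 ?powR_gt0.
rewrite -mulr_sumr; apply: le_trans (ler_wpM2l _ sT) _.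
  by rewrite divr_ge0 ?exprn_ge0 ?mulr_ge0 ?invr_ge0 ?(ltW s0) ?(ltW p4) ?(ltW ez).
by rewrite le_eqVlt; apply/orP; left; apply/eqP; field; rewrite !lt0r_neq0.
Qed.

End KernelSums.

(** * Test functions *)

Section PowerSums.
Variable R : realType.

Lemma powR_le (p x y : R) : 0 <= p -> 0 <= x -> x <= y -> x `^ p <= y `^ p.
Proof. by move=> p0 x0 xy; apply: ge0_ler_powR; rewrite ?nnegrE// (le_trans x0). Qed.

Lemma powRVK (p x : R) : 0 < p -> 0 <= x -> (x `^ p^-1) `^ p = x.
Proof. by move=> p0 x0; rewrite -powRrM mulVf ?lt0r_neq0// powRr1. Qed.

Lemma powRKV (p x : R) : 0 < p -> 0 <= x -> (x `^ p) `^ p^-1 = x.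
Proof. by move=> p0 x0; rewrite -powRrM mulfV ?lt0r_neq0// powRr1. Qed.

Lemma powR_subadditive (p x y : R) : 0 < p <= 1 -> 0 <= x -> 0 <= y ->
  (x + y) `^ p <= x `^ p + y `^ p.
Proof.
move=> /andP[p0 p1] x0 y0; have [s0|s0] := leP (x + y) 0.
  have -> : x + y = 0 by apply/eqP; rewrite eq_le s0 addr_ge0.
  by rewrite powR0 ?lt0r_neq0// addr_ge0// powR_ge0.
have sp := powR_gt0 p s0.
have H u : 0 <= u -> u <= x + y -> u / (x + y) <= u `^ p / (x + y) `^ p.
  rewrite le_eqVlt => /orP[/eqP <- _|u0 us].
    by rewrite mul0r divr_ge0 ?powR_ge0// ltW.
  have -> : u `^ p / (x + y) `^ p = (u / (x + y)) `^ p.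
    by rewrite powRM ?invr_ge0 ?(ltW u0) ?(ltW s0)// powRV// ltW.
  by rewrite ger1_powR// divr_gt0//= ler_pdivrMr// mul1r.
have h1 : x <= x + y by rewrite lerDl.
have h2 : y <= x + y by rewrite lerDr.
have := lerD (H x x0 h1) (H y y0 h2).
by rewrite -!mulrDl divff ?lt0r_neq0// ler_pdivlMr// mul1r.
Qed.

Lemma powR_sum_le (p : R) (I : Type) (s : seq I) (P : pred I) (x : I -> R) : 0 < p <= 1 ->
  (forall i, P i -> 0 <= x i) -> (\sum_(i <- s | P i) x i) `^ p <= \sum_(i <- s | P i) x i `^ p.
Proof.
move=> p01 x0; elim: s => [|i s IH].
  by rewrite !big_nil powR0// lt0r_neq0//; case/andP: p01.
rewrite !big_cons; case: ifP => // Pi.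
apply: le_trans (powR_subadditive p01 (x0 i Pi) _) _; first exact: sumr_ge0.
by rewrite lerD2l.
Qed.

(** Jensen's inequality up to a constant: [le_powR_interp] in each term, at a level [l] that
    balances the two resulting sums. *)
Lemma powR_weighted_sum_le (p K : R) (I : Type) (s : seq I) (P : pred I) (w x : I -> R) :
  1 <= p -> 0 < K -> (forall i, P i -> 0 <= w i) -> (forall i, P i -> 0 <= x i) ->
  \sum_(i <- s | P i) w i <= K ->
  (\sum_(i <- s | P i) w i * x i) `^ p <=
    (2 * K) `^ p / K * \sum_(i <- s | P i) w i * x i `^ p.
Proof.
move=> p1 K0 w0 x0 wK; have p0 : 0 < p := lt_le_trans ltr01 p1.
set S := \sum_(i <- s | P i) w i * x i `^ p.
have S0 : 0 <= S by apply: sumr_ge0 => i Pi; rewrite mulr_ge0 ?w0 ?powR_ge0.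
have c0 : 0 < (2 * K) `^ p / K by rewrite divr_gt0// powR_gt0// mulr_gt0.
apply/ler_addgt0Pr => e e0.
set c := (2 * K) `^ p / K in c0 *.
(* The level has to be positive even if all terms vanish; the surplus disappears with [e]. *)
pose S' := S + e / c; have S'0 : 0 < S' by rewrite ltr_wpDl// divr_gt0.
have -> : c * S + e = c * S' by rewrite /S' mulrDr (mulrC c (e / c)) divfK ?lt0r_neq0.
pose l := (S' / K) `^ p^-1.
have SK : 0 < S' / K by rewrite divr_gt0.
have l0 : 0 < l by rewrite powR_gt0.
have lp : l `^ p = S' / K by rewrite powRVK// ltW.
have H : \sum_(i <- s | P i) w i * x i <= 2 * K * l.
  apply: (@le_trans _ _ (\sum_(i <- s | P i) (w i * l + l / l `^ p * (w i * x i `^ p)))).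
    apply: ler_sum => i Pi.
    have -> : w i * l + l / l `^ p * (w i * x i `^ p) = w i * (l + l / l `^ p * x i `^ p) by ring.
    by rewrite ler_wpM2l ?w0// le_powR_interp// x0.
  rewrite big_split/= -mulr_suml -mulr_sumr -/S lp.
  have -> : 2 * K * l = K * l + l / (S' / K) * S' by field; rewrite !lt0r_neq0.
  apply: lerD; first by rewrite ler_pM2r.
  by rewrite ler_pM2l ?divr_gt0// lerDl ltW// divr_gt0.
apply: le_trans (powR_le (ltW p0) _ H) _.
  by apply: sumr_ge0 => i Pi; rewrite mulr_ge0 ?w0 ?x0.
by rewrite powRM ?mulr_ge0 ?(ltW K0) ?(ltW l0)// lp /c mulrCA mulrC.
Qed.

End PowerSums.

(** * One summand of a kernel sum, for p <= 1 and for p > 1 *)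

Section KernelPower.
Variable R : realType.

(** Here and in the next lemma [x] stands for [pk (a k) z] and [y] for [eta (a k) / eta z]. Of seven
    powers of x six are kept, and the last is traded through x <= sqrt x <= sqrt y. *)
Lemma kernel_factor_le1 (p c x y : R) t : 0 < p -> 0 <= c -> 0 < x <= 1 -> x <= y ->
  7 <= t%:R * p ->
  (c * x ^+ t) `^ p <= c `^ p * (x ^+ 6 * Num.sqrt y).
Proof.
move=> p0 c0 /andP[x0 x1] xy tp; rewrite powRM// ?exprn_ge0 ?(ltW x0)//.
apply: ler_wpM2l; first exact: powR_ge0.
rewrite -powR_mulrn ?(ltW x0)// -powRrM.
apply: (@le_trans _ _ (x `^ 7%:R)); first by apply: ger_powR; rewrite ?x0.
rewrite powR_mulrn ?(ltW x0)// exprSr ler_pM2l ?exprn_gt0//.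
apply: (@le_trans _ _ (Num.sqrt x)); last exact: ler_wsqrtr.
by rewrite -powR12_sqrt ?(ltW x0)// ger1_powR ?x0//; lra.
Qed.

(** The summand is split into the summable weight of [kernel_sum] and a rest [X]. In w X^p the
    exponent of y is d (p - 1) = 1/2 by the choice of [d], and the exponent of x is at least t,
    hence at least 6. *)
Lemma kernel_factor_gt1 (p c x y d : R) t : 1 < p -> 0 <= c -> 0 < x <= 1 -> 0 < y ->
  d = (2 * (p - 1))^-1 -> 8 + d <= t%:R ->
  let w := x `^ (2 + d) * y^-1 `^ d in let X := c * x `^ (t%:R - 2 - d) * y `^ d in
  c * x ^+ t = w * X /\ w * X `^ p <= c `^ p * (x ^+ 6 * Num.sqrt y).
Proof.
move=> p1 c0 /andP[x0 x1] y0 de td w X; have p0 : 0 < p := lt_trans ltr01 p1.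
have d0 : 0 < d by rewrite de invr_gt0 mulr_gt0// subr_gt0.
have yV : y^-1 `^ d = (y `^ d)^-1 by rewrite powRV// ltW.
have yd := powR_gt0 d y0.
split.
  rewrite /w /X yV -powR_mulrn ?(ltW x0)//.
  have -> : t%:R = (2 + d) + (t%:R - 2 - d) :> R by ring.
  rewrite powRD ?(lt0r_neq0 x0) ?implybT//.
  have -> : 2 + d + (t%:R - 2 - d) - 2 - d = t%:R - 2 - d by ring.
  by field; rewrite lt0r_neq0.
rewrite /w /X !powRM ?mulr_ge0 ?powR_ge0// -!powRrM yV.
have -> : x `^ (2 + d) / y `^ d * (c `^ p * x `^ ((t%:R - 2 - d) * p) * y `^ (d * p)) =
  c `^ p * ((x `^ (2 + d) * x `^ ((t%:R - 2 - d) * p)) * (y `^ (d * p) / y `^ d)) by ring.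
apply: ler_wpM2l; first exact: powR_ge0.
rewrite -powRB ?(lt0r_neq0 y0) ?implybT// -powRD ?(lt0r_neq0 x0) ?implybT//.
have -> : d * p - d = 2^-1.
  by rewrite de; field; rewrite subr_eq0 gt_eqF.
rewrite powR12_sqrt ?(ltW y0)//; apply: ler_wpM2r; first exact: sqrtr_ge0.
rewrite -powR_mulrn ?(ltW x0)//; apply: ger_powR; rewrite ?x0//.
have h : (t%:R - 2 - d) * 1 <= (t%:R - 2 - d) * p.
  by rewrite ler_wpM2l ?(ltW p1)//; lra.
by rewrite mulr1 in h; lra.
Qed.

End KernelPower.

Section WeightedIntegral.
Variable R : realType.
Local Notation C := (R[i])^o.
Local Notation D := (Dset R).
Variable p : R.

(** For [b = 0] this is, up to 1/pi, the p-th power of the norm of A^p; for [b = 2] it is the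
    quantity that detects locally uniform smallness. *)
Definition wint (b : nat) (f : C -> C) : \bar R := iint D (fun z => nc (f z) `^ p * eta z ^+ b).

Lemma cmeas_wint b f : holo f -> cmeas D (fun z => nc (f z) `^ p * eta z ^+ b).
Proof.
by move=> hf; apply: cmeasM; [exact: cmeas_powR (holo_cmeas_nc hf)|exact: cmeasX (@cmeas_eta R)].
Qed.

Lemma wint_ge0 b f : (0 <= wint b f)%E.
Proof.
apply: iint_ge0 => t Dt; rewrite mulr_ge0 ?powR_ge0 ?exprn_ge0// ltW// eta_gt0; exact: Dt.
Qed.

End WeightedIntegral.

(** * Norms of the test functions against the norm of f *)

Section TestFunctions.
Variable R : realType.
Local Notation C := (R[i])^o.
Local Notation D := (Dset R).
Variables (E : nat -> set (R * R)) (a : nat -> C) (v : nat -> bool) (s : R).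
Hypotheses (mE : forall k, measurable (E k)) (tE : trivIset setT E) (ED : \bigcup_k E k = D).
Hypothesis a1 : forall k, 1 / 4 <= nc (a k) < 1.
Hypothesis Ea : forall k t, E k t -> [/\ v k, den (a k) (cpt t) <= 3 * eta (a k) &
         eta (a k) / 2 <= eta (cpt t : C) <= 2 * eta (a k)].
Hypothesis s0 : 0 < s.
Hypothesis lE : forall k, v k -> ((s * eta (a k) ^+ 2)%:E <= leb2 (E k))%E.
Variable p : R.
Hypothesis p0 : 0 < p.

Let ak k : nc (a k) < 1. Proof. by have /andP[] := a1 k. Qed.
Let ek k : 0 < eta (a k). Proof. by rewrite eta_gt0. Qed.

(* For p > 1 this is Jensen's inequality with the summable weights
   pk^(2+d) (eta z / eta (a k))^d, where d (p - 1) = 1/2. *)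
Lemma kernel_power : exists (t0 : nat) (K : R), 0 < K /\ forall t J (c : nat -> R) (z : C),
  (t0 <= t)%N -> (forall k, 0 <= c k) -> nc z < 1 ->
  (\sum_(k < J | v k) c k * pk (a k) z ^+ t) `^ p <=
  K * \sum_(k < J | v k) c k `^ p * (pk (a k) z ^+ 6 * Num.sqrt (eta (a k) / eta z)).
Proof.
have X (z : C) (z1 : nc z < 1) k : [/\ 0 < pk (a k) z <= 1,
  0 < eta (a k) / eta z & pk (a k) z <= eta (a k) / eta z].
  have ez : 0 < eta z by rewrite eta_gt0.
  by rewrite pk_gt0 ?pk_le1 ?divr_gt0 ?ler_pdivlMr ?pk_eta ?(ltW z1).
have [p1|p1] := leP p 1.
  exists (Num.truncn (7 / p)).+1, 1; split=> // t J c z tt c0 z1; rewrite mul1r.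
  have tp : 7 <= t%:R * p.
    rewrite -ler_pdivrMr//; apply: le_trans (ltW (truncnS_gt _)) _; by rewrite ler_nat.
  apply: le_trans (powR_sum_le _ _ _) _; first by rewrite p0.
    by move=> k _; rewrite mulr_ge0// exprn_ge0// ltW// pk_gt0// ltW.
  by apply: ler_sum => k _; have [h1 h2 h3] := X z z1 k; exact: kernel_factor_le1.
pose d := (2 * (p - 1))^-1.
have d0 : 0 < d by rewrite invr_gt0 mulr_gt0// subr_gt0.
have [K K0 HK] := kernel_sum mE tE ED a1 Ea s0 lE d0.
exists (Num.truncn (8 + d)).+1, ((2 * K) `^ p / K); split;
  first by rewrite divr_gt0// powR_gt0// mulr_gt0.
move=> t J c z tt c0 z1.
have td : 8 + d <= t%:R.
  by apply: le_trans (ltW (truncnS_gt _)) _; rewrite ler_nat.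
pose w k := pk (a k) z `^ (2 + d) * (eta (a k) / eta z)^-1 `^ d.
pose Y k := c k * pk (a k) z `^ (t%:R - 2 - d) * (eta (a k) / eta z) `^ d.
have XX k : c k * pk (a k) z ^+ t = w k * Y k /\
   w k * Y k `^ p <= c k `^ p * (pk (a k) z ^+ 6 * Num.sqrt (eta (a k) / eta z)).
  by have [h1 h2 h3] := X z z1 k; exact: kernel_factor_gt1.
under eq_bigr do rewrite (proj1 (XX _)).
apply: le_trans (powR_weighted_sum_le (K := K) _ _ _ _ _) _; rewrite ?(ltW p1)//.
- by move=> k _; rewrite mulr_ge0// powR_ge0.
- by move=> k _; rewrite !mulr_ge0// powR_ge0.
- by apply: le_trans (HK J z z1); apply: ler_sum => k _; rewrite /w invf_div.
apply: ler_wpM2l; first by rewrite divr_ge0 ?powR_ge0// ltW.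
by apply: ler_sum => k _; have [] := XX k.
Qed.

(* The kernel factor is at least a constant on E k, so that the local mass controls
   f on E k; its decay away from a k keeps the sum over k comparable to the
   integral of |f|^p. *)
Definition local_mass (f : C -> C) (k : nat) : \bar R :=
  iint D (fun z => nc (f z) `^ p * (pk (a k) z ^+ 5 * (eta z / eta (a k)) ^+ 3)).

(** Mass over area, brought to the scale of f by the p-th root: a local size of f at [a k]. *)
Definition coef (f : C -> C) (k : nat) : R :=
  (fine (local_mass f k) / eta (a k) ^+ 2) `^ p^-1.

Let mD : measurable D. Proof. exact: measurable_disc. Qed.

Let Dp t : D t -> [/\ 0 < eta (cpt t : C), nc (cpt t : C) < 1 & forall k, 0 < pk (a k) (cpt t)].
Proof.
by move=> Dt; have h : nc (cpt t : C) < 1 := Dt; split=> // [|k]; rewrite ?eta_gt0// pk_gt0// ltW.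
Qed.

Let fac_ge0 f k t : D t ->
  0 <= nc (f (cpt t)) `^ p * (pk (a k) (cpt t) ^+ 5 * (eta (cpt t) / eta (a k)) ^+ 3).
Proof.
move=> /Dp[h1 _ h2]; apply: mulr_ge0; first exact: powR_ge0.
by apply: mulr_ge0; apply: exprn_ge0; [|apply: divr_ge0]; exact: ltW.
Qed.

Lemma cmeas_local_mass f k : holo f ->
  cmeas D (fun z => nc (f z) `^ p * (pk (a k) z ^+ 5 * (eta z / eta (a k)) ^+ 3)).
Proof.
move=> hf; apply: cmeasM; first exact: cmeas_powR (holo_cmeas_nc hf).
apply: cmeasM; first exact: cmeasX (@cmeas_pk _ _).
by apply: cmeasX; apply: cmeasM; [exact: cmeas_eta|exact: cmeas_cst].
Qed.

Lemma local_mass_ge0 f k : (0 <= local_mass f k)%E.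
Proof.
by apply: iint_ge0 => t; exact: fac_ge0.
Qed.

(** Two powers of the kernel pay for exchanging the weight at z with the weight at the centre, in
    either direction; both inequalities rest on [x * ez <= e]. *)
Let kfac_le (x ez e : R) (b : nat) : 0 <= x <= 1 -> 0 < ez -> 0 < e -> x * ez <= e ->
  b = 0%N \/ b = 2%N -> x ^+ 2 * ez ^+ b <= e ^+ b /\ x ^+ 2 * (ez / e) ^+ 2 * e ^+ b <= ez ^+ b.
Proof.
move=> /andP[x0 x1] ez0 e0 xe [->|->].
  rewrite !expr0 !mulr1 -exprMn; split; first exact: exprn_ile1.
  by apply: exprn_ile1; [rewrite mulr_ge0 ?divr_ge0 ?(ltW ez0) ?(ltW e0)|rewrite mulrA
    ler_pdivrMr// mul1r].
split; first by rewrite -exprMn; apply: lerXn2r; rewrite ?nnegrE ?mulr_ge0 ?(ltW ez0) ?(ltW e0).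
have -> : x ^+ 2 * (ez / e) ^+ 2 * e ^+ 2 = x ^+ 2 * ez ^+ 2 by field; rewrite lt0r_neq0.
by rewrite ler_piMl ?exprn_ge0 ?(ltW ez0)// exprn_ile1.
Qed.

(** Here the exponents 5 and 3 of [local_mass] originate. Of pk^5 (eta z / eta a)^3 the part pk^3
    (eta z / eta a) is summed over the centres by [kernel_sum] with d = 1, and the part pk^2 (eta z
    / eta a)^2 moves the weight from the centre to z. *)
Lemma local_mass_sum : exists2 K : R, 0 < K & forall b f J, b = 0%N \/ b = 2%N -> holo f ->
  (\sum_(k < J | v k) (eta (a k) ^+ b)%:E * local_mass f k <= K%:E * wint p b f)%E.
Proof.
have [K K0 HK] := kernel_sum mE tE ED a1 Ea s0 lE ltr01.
exists K => // b f J hb hf; have ml := fun k => cmeas_local_mass k hf.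
have lp k t := @fac_ge0 f k t.
have EZ k : ((eta (a k) ^+ b)%:E * local_mass f k)%E = iint D (fun z => eta (a k) ^+ b *
    (nc (f z) `^ p * (pk (a k) z ^+ 5 * (eta z / eta (a k)) ^+ 3)))%R.
  by rewrite iintZ// ?exprn_ge0 ?(ltW (ek k))// => t; exact: lp.
under eq_bigr do rewrite EZ.
rewrite /wint -iintZ ?(ltW K0)//; last 2 first.
- exact: cmeas_wint.
- by move=> t /Dp[h1 _ _]; rewrite mulr_ge0 ?powR_ge0 ?exprn_ge0 ?(ltW h1).
rewrite -iint_sum//; last 2 first.
- by move=> k _; apply: cmeasM => //; exact: cmeas_cst.
- by move=> k t _ Dt; rewrite mulr_ge0 ?lp ?exprn_ge0 ?(ltW (ek k)).
apply: iint_le => //.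
- by apply: cmeas_sum => k _; apply: cmeasM => //; exact: cmeas_cst.
- by apply: cmeasM; [exact: cmeas_cst|exact: cmeas_wint].
- by move=> t Dt; apply: sumr_ge0 => k _; rewrite mulr_ge0 ?lp ?exprn_ge0 ?(ltW (ek k)).
move=> t Dt; have [ez z1 pz] := Dp Dt; set z : C := cpt t in ez z1 pz *.
apply: (@le_trans _ _ (\sum_(k < J | v k) (nc (f z) `^ p * eta z ^+ b) *
   (pk (a k) z `^ (2 + 1) * (eta z / eta (a k)) `^ 1))); last first.
  rewrite -mulr_sumr mulrC ler_wpM2r ?HK// mulr_ge0 ?powR_ge0 ?exprn_ge0 ?(ltW ez)//.
apply: ler_sum => k _; have pk1 : 0 <= pk (a k) z <= 1 by rewrite (ltW (pz k)) pk_le1// ltW.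
have [_ h] := kfac_le pk1 ez (ek k) (pk_eta (ak k) z1) hb.
have -> : pk (a k) z `^ (2 + 1) = pk (a k) z ^+ 3.
  by rewrite -powR_mulrn ?(ltW (pz k))//; congr (_ `^ _); ring.
rewrite powRr1 ?divr_ge0 ?(ltW ez) ?(ltW (ek k))//.
have -> : eta (a k) ^+ b * (nc (f z) `^ p * (pk (a k) z ^+ 5 * (eta z / eta (a k)) ^+ 3)) =
  nc (f z) `^ p * (pk (a k) z ^+ 3 * (eta z / eta (a k))) *
  (pk (a k) z ^+ 2 * (eta z / eta (a k)) ^+ 2 * eta (a k) ^+ b).
  by rewrite (exprD _ 2 3) (exprD _ 2 1) expr1; ring.
rewrite [leRHS]mulrAC; apply: ler_wpM2l => //.
apply: mulr_ge0; first exact: powR_ge0.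
by apply: mulr_ge0; [apply: exprn_ge0|apply: divr_ge0]; exact: ltW.
Qed.

Lemma local_mass_le f k : holo f -> (local_mass f k <= wint p 0 f)%E.
Proof.
move=> hf; apply: iint_le => //.
- exact: cmeas_local_mass.
- exact: cmeas_wint.
- by move=> t; exact: fac_ge0.
move=> t Dt; have [ez z1 pz] := Dp Dt; rewrite expr0 mulr1.
rewrite -[leRHS]mulr1; apply: ler_wpM2l; first exact: powR_ge0.
have p00 := ltW (pz k); have q00 : 0 <= eta (cpt t : C) / eta (a k) by rewrite divr_ge0// ltW.
rewrite (exprD _ 2 3) -mulrA -exprMn; apply: mulr_ile1; try exact: exprn_ge0.
- by apply: exprn_ge0; exact: mulr_ge0.
- by apply: exprn_ile1 => //; rewrite pk_le1// ltW.
- apply: exprn_ile1; first exact: mulr_ge0.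
  by rewrite mulrA ler_pdivrMr// mul1r pk_eta.
Qed.

Lemma local_mass_fin f k : holo f -> (wint p 0 f < +oo)%E -> local_mass f k \is a fin_num.
Proof.
move=> hf ff; rewrite ge0_fin_numE ?local_mass_ge0//.
exact: le_lt_trans (local_mass_le k hf) ff.
Qed.

Lemma coef_ge0 f k : 0 <= coef f k. Proof. exact: powR_ge0. Qed.

Lemma coefP f k : coef f k `^ p * eta (a k) ^+ 2 = fine (local_mass f k).
Proof.
rewrite /coef powRVK// ?divfK// ?divr_ge0 ?exprn_ge0 ?(ltW (ek k)) ?fine_ge0 ?local_mass_ge0//.
by rewrite expf_neq0// lt0r_neq0.
Qed.

(** Of the six kernel powers left by [kernel_power], four go to [pk_integral_weighted], whose weight
    is the square root of 1 / eta z, and two to the exchange of weights; a sum of local masses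
    remains. The coefficients do not depend on [b], so one test function is controlled in both
    weighted integrals at once. *)
Lemma test_norm_le : exists (t0 : nat) (K : R), 0 < K /\ forall t J b f g,
  (t0 <= t)%N -> b = 0%N \/ b = 2%N -> holo f -> holo g -> (wint p 0 f < +oo)%E ->
  (forall z : C, nc z < 1 -> nc (g z) <= \sum_(k < J | v k) coef f k * pk (a k) z ^+ t) ->
  (wint p b g <= K%:E * wint p b f)%E.
Proof.
have [t0 [C0 [C00 HA]]] := kernel_power.
have [K1 K10 H1] := @pk_integral_weighted R.
have [K2 K20 H2] := local_mass_sum.
exists t0, (C0 * K1 * K2); split=> [|t J b f g tt hb hf hg ff gle]; first by rewrite !mulr_gt0.
pose h k (z : C) := C0 * (coef f k `^ p * (Num.sqrt (eta (a k)) * eta (a k) ^+ b)) *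
   (pk (a k) z `^ 4 * (Num.sqrt (eta z))^-1).
have hc k : 0 <= C0 * (coef f k `^ p * (Num.sqrt (eta (a k)) * eta (a k) ^+ b)).
  by rewrite !mulr_ge0 ?powR_ge0 ?sqrtr_ge0 ?exprn_ge0 ?(ltW C00) ?(ltW (ek k)).
have mh k : cmeas D (fun z => pk (a k) z `^ 4 * (Num.sqrt (eta z))^-1).
  by apply: cmeasM (@cmeas_sqrt_eta R); apply: cmeas_powR; exact: cmeas_pk.
have h0 k t' : D t' -> 0 <= pk (a k) (cpt t') `^ 4 * (Num.sqrt (eta (cpt t')))^-1.
  by move=> _; rewrite mulr_ge0 ?powR_ge0 ?invr_ge0 ?sqrtr_ge0.
apply: (@le_trans _ _ (iint D (fun z => \sum_(k < J | v k) h k z))).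
  apply: iint_le => //.
  - exact: cmeas_wint.
  - by apply: cmeas_sum => k _; apply: cmeasM => //; exact: cmeas_cst.
  - by move=> t' /Dp[h1 _ _]; rewrite mulr_ge0 ?powR_ge0 ?exprn_ge0 ?(ltW h1).
  move=> t' Dt; have [ez z1 pz] := Dp Dt; set z : C := cpt t' in ez z1 pz *.
  have /(powR_le (ltW p0) (nc_ge0 _)) g1 := gle z z1.
  apply: le_trans (ler_wpM2r (exprn_ge0 _ (ltW ez)) (le_trans g1 (HA t J _ z tt (coef_ge0 f)
    z1))) _.
  rewrite mulr_sumr mulr_suml; apply: ler_sum => k _; rewrite /h.
  have pk1 : 0 <= pk (a k) z <= 1 by rewrite (ltW (pz k)) pk_le1// ltW.
  have [h1 _] := kfac_le pk1 ez (ek k) (pk_eta (ak k) z1) hb.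
  move: (pk (a k) z) pk1 h1 => x /andP[x0 x1] h1.
  rewrite sqrtrM ?(ltW (ek k))// sqrtrV ?(ltW ez)//.
  have -> : x `^ 4 = x ^+ 4 by rewrite -powR_mulrn.
  have -> : C0 * (coef f k `^ p * (x ^+ 6 * (Num.sqrt (eta (a k)) / Num.sqrt (eta z)))) * eta z
    ^+ b =
    C0 * coef f k `^ p * (Num.sqrt (eta (a k)) * (x ^+ 4 / Num.sqrt (eta z))) * (x ^+ 2 * eta z
      ^+ b).
    by rewrite (exprD _ 2 4); ring.
  have -> : C0 * (coef f k `^ p * (Num.sqrt (eta (a k)) * eta (a k) ^+ b)) * (x ^+ 4 / Num.sqrt
    (eta z)) =
    C0 * coef f k `^ p * (Num.sqrt (eta (a k)) * (x ^+ 4 / Num.sqrt (eta z))) * eta (a k) ^+ b.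
    by ring.
  apply: ler_wpM2l => //; rewrite !mulr_ge0 ?powR_ge0 ?invr_ge0 ?sqrtr_ge0 ?exprn_ge0 ?(ltW C00)//.
rewrite iint_sum//; last 2 first.
- by move=> k _; apply: cmeasM => //; exact: cmeas_cst.
- by move=> k t' _ Dt; rewrite mulr_ge0 ?h0.
apply: (@le_trans _ _ (\sum_(k < J | v k) (C0 * K1)%:E * ((eta (a k) ^+ b)%:E * local_mass f k))%E).
  apply: lee_sum => k _; rewrite /h iintZ//; last by move=> t1; exact: h0.
  apply: le_trans (lee_wpmul2l _ (H1 (a k) (ak k))) _; first by rewrite lee_fin.
  rewrite -(fineK (local_mass_fin k hf ff)) -!EFinM lee_fin -coefP.
  rewrite le_eqVlt; apply/orP; left; apply/eqP.
  have h2 : Num.sqrt (eta (a k)) ^+ 2 = eta (a k) by rewrite sqr_sqrtr// ltW.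
  transitivity (C0 * K1 * coef f k `^ p * eta (a k) ^+ b * eta (a k) * Num.sqrt (eta (a k)) ^+ 2).
    by ring.
  by rewrite h2; ring.
rewrite -ge0_sume_distrr; last first.
  by move=> k _; rewrite mule_ge0 ?local_mass_ge0// lee_fin exprn_ge0// ltW.
rewrite (EFinM (C0 * K1) K2) -[leRHS]muleA; apply: lee_wpmul2l;
  first by rewrite lee_fin mulr_ge0// ltW.
exact: H2.
Qed.

End TestFunctions.

(** * From the sum to its terms *)

Section HoloAlgebra.
Variable R : realType.
Local Notation C := (R[i])^o.
Implicit Types (f g : C -> C).

Lemma derive1nS l f : derive1n l.+1 f = derive1 (derive1n l f).
Proof. by rewrite /derive1n iterS. Qed.

Lemma derive1n_disc l f g z : disc z -> (forall w, disc w -> f w = g w) -> holo g ->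
  derive1n l f z = derive1n l g z.
Proof.
move=> zD E hg; elim: l z zD => [|l IH] z zD; first by rewrite /derive1n /= E.
rewrite !derive1nS; apply: (derive1_eq_disc zD IH); exact: holo_derive1n.
Qed.

Lemma holo_cst (c : C) : holo (fun=> c).
Proof. by apply: holoP => z _; exists 0; exact: cdiff_cst. Qed.

Lemma holoM f g : holo f -> holo g -> holo (fun z => f z * g z).
Proof.
move=> hf hg; apply: holoP => z zD.
by eexists; apply: cdiffM; exact: holo_cdiff.
Qed.

Lemma holoD f g : holo f -> holo g -> holo (fun z => f z + g z).
Proof.
move=> hf hg; apply: holoP => z zD.
by eexists; apply: cdiffD; exact: holo_cdiff.
Qed.

Lemma holoB f g : holo f -> holo g -> holo (fun z => f z - g z).
Proof.
move=> hf hg; apply: holoP => z zD.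
by eexists; apply: cdiffB; exact: holo_cdiff.
Qed.

Lemma holoX f t : holo f -> holo (fun z => f z ^+ t).
Proof.
move=> hf; elim: t => [|t IH]; first exact: holo_cst.
by apply: (@holo_ext R _ _ _ (holoM hf IH)) => z _; rewrite exprS.
Qed.

Lemma holo_sum (I : Type) (s : seq I) (P : pred I) (g : I -> C -> C) :
  (forall i, holo (g i)) -> holo (fun z => \sum_(i <- s | P i) g i z).
Proof.
move=> hg; elim: s => [|i s IH].

  by apply: (@holo_ext R (fun=> 0) _ _ (@holo_cst 0)) => z _; rewrite big_nil.
case Pi : (P i); last by apply: (@holo_ext R _ _ _ IH) => z _; rewrite big_cons Pi.
by apply: (@holo_ext R _ _ _ (holoD (hg i) IH)) => z _; rewrite big_cons Pi.
Qed.

Lemma holo_comp f (phi : C -> C) : holo f -> holo phi -> (forall z, disc z -> disc (phi z)) ->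
  holo (fun z => f (phi z)).
Proof.
move=> hf hphi mphi; apply: holoP => z zD.
by eexists; exact: (cdiff_comp (holo_cdiff hphi zD) (holo_cdiff hf (mphi z zD))).
Qed.

Lemma holo_Wop (u phi : C -> C) l f : holo u -> holo phi -> (forall z, disc z -> disc (phi z)) ->
  holo f -> holo (Wop u phi l f).
Proof.
move=> hu hphi mphi hf; have hd := @holo_derive1n R f l hf.
exact: (holoM hu (holo_comp hd hphi mphi)).
Qed.

Lemma derive1nD l f g z : holo f -> holo g -> disc z ->
  derive1n l (fun w => f w + g w) z = derive1n l f z + derive1n l g z.
Proof.
move=> hf hg; elim: l z => [|l IH] z zD; first by rewrite /derive1n /=.
rewrite !derive1nS.
rewrite (derive1_eq_disc zD IH (holoD (@holo_derive1n R f l hf) (@holo_derive1n R g l hg))).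
exact: (cdiff_derive1 (cdiffD (holo_cdiff (@holo_derive1n R f l hf) zD) (holo_cdiff
  (@holo_derive1n R g l hg) zD))).
Qed.

Lemma derive1nZ l (c : C) f z : holo f -> disc z ->
  derive1n l (fun w => c * f w) z = c * derive1n l f z.
Proof.
move=> hf; elim: l z => [|l IH] z zD; first by rewrite /derive1n /=.
rewrite !derive1nS.
rewrite (derive1_eq_disc zD IH (holoM (@holo_cst c) (@holo_derive1n R f l hf))).
exact: (cdiff_derive1 (cdiffZ c (holo_cdiff (@holo_derive1n R f l hf) zD))).
Qed.

Lemma derive1n_cst0 l (z : C) : disc z -> derive1n l (fun=> 0 : C) z = 0.
Proof.
move=> zD; rewrite -[RHS](mul0r (derive1n l (fun=> 0 : C) z)) -(derive1nZ l 0 (@holo_cst 0) zD).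
by apply: derive1n_disc zD _ (holoM (@holo_cst 0) (@holo_cst 0)) => w _; rewrite mul0r.
Qed.

Lemma derive1n_sum (I : Type) (s : seq I) (P : pred I) (m : I -> C) (g : I -> C -> C) l z :
  (forall i, holo (g i)) -> disc z ->
  derive1n l (fun z => \sum_(i <- s | P i) m i * g i z) z = \sum_(i <- s | P i) m i * derive1n l
    (g i) z.
Proof.
move=> hg zD; have hm i : holo (fun z => m i * g i z) := holoM (@holo_cst (m i)) (hg i).
elim: s => [|i s IH].
  rewrite big_nil -[RHS](derive1n_cst0 l zD); apply: derive1n_disc zD _ (@holo_cst 0) => w _.
  by rewrite big_nil.
have hs : holo (fun w => \sum_(i <- s | P i) m i * g i w) by exact: (@holo_sum _ s P (fun i w =>
  m i * g i w)).
rewrite big_cons; case: ifP => Pi; rewrite -IH.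
  rewrite -(derive1nZ l (m i) (hg i) zD) -(derive1nD l (hm i) hs zD).
  by apply: derive1n_disc zD _ (holoD (hm i) hs) => w _; rewrite big_cons Pi.
by apply: derive1n_disc zD _ hs => w _; rewrite big_cons Pi.
Qed.

Definition rising (t l : nat) : nat := \prod_(i < l) (t + i).

Lemma rising0 t : rising t 0 = 1%N. Proof. by rewrite /rising big_ord0. Qed.
Lemma risingS t l : rising t l.+1 = (rising t l * (t + l))%N.
Proof. by rewrite /rising big_ord_recr. Qed.
Lemma risingSl t l : rising t l.+1 = (t * rising t.+1 l)%N.
Proof.
rewrite /rising big_ord_recl addn0; congr (_ * _)%N; apply: eq_bigr => i _.
by rewrite lift0 addnS addSn.
Qed.

Definition kerf (a z : C) : C := (eta a)%:C%C / (1 - a^*%C * z).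

Lemma nc_kerf a z : nc a < 1 -> nc (kerf a z) = pk a z.
Proof. by move=> a1; rewrite /kerf ncM ncV nc_real gtr0_norm// eta_gt0. Qed.

Lemma kerf_neq0 a (z : C) : nc a < 1 -> disc z -> 1 - a^*%C * z != 0.
Proof. by move=> a1 /ltW zD; rewrite -nc_gt0 -/(den a z) den_gt0. Qed.

Let cdiff_lin a z : cdiff (fun w : C => 1 - a^*%C * w) z (- a^*%C).
Proof.
have -> : - a^*%C = 0 - a^*%C * 1 :> C by rewrite mulr1 sub0r.
apply: cdiffB; first exact: cdiff_cst.
by apply: cdiffZ; exact: cdiff_id.
Qed.

Let cdiff_inv a (z : C) : nc a < 1 -> disc z ->
  cdiff (fun w => (1 - a^*%C * w)^-1) z (a^*%C / (1 - a^*%C * z) * (1 - a^*%C * z)^-1).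
Proof.
move=> a1 zD; have n0 := kerf_neq0 a1 zD.
have := cdiffV (f := fun w : C => 1 - a^*%C * w) n0 (cdiff_lin a z);
  set d := (X in cdiff _ _ X -> _).
by rewrite (_ : d = a^*%C / (1 - a^*%C * z) * (1 - a^*%C * z)^-1)// /d; field.
Qed.

Lemma holo_kerf a : nc a < 1 -> holo (kerf a).
Proof.
move=> a1; apply: holoM; first exact: holo_cst.
by apply: holoP => z zD; eexists; exact: cdiff_inv.
Qed.

Let cdiff_invX a (z : C) m : nc a < 1 -> disc z ->
  cdiff (fun w => (1 - a^*%C * w)^-1 ^+ m) z (m%:R * (a^*%C / (1 - a^*%C * z)) * (1 - a^*%C *
    z)^-1 ^+ m).
Proof.
move=> a1 zD; elim: m => [|m IH].
  by rewrite mulr0n !mul0r; exact: (cdiff_cst 1 z).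
have := cdiffM (cdiff_inv a1 zD) IH.
set d := (X in cdiff _ _ X -> _); set d' := (X in _ -> cdiff _ _ X).
have -> : d = d' by rewrite /d /d' exprS -natr1; ring.
by apply: cdiff_near (ltr01) _ => w _; rewrite exprS.
Qed.

Lemma derive1n_kerf a t l z : nc a < 1 -> disc z ->
  derive1n l (fun w => kerf a w ^+ t) z =
  (rising t l)%:R * (a^*%C / (1 - a^*%C * z)) ^+ l * kerf a z ^+ t.
Proof.
move=> a1; elim: l z => [|l IH] z zD; first by rewrite rising0 expr0 /derive1n /= !mul1r.
(* The l-th derivative is a constant times the power t + l of 1 / (1 - conj(a) w), and
   differentiating that power supplies the next factor t + l of the rising factorial. *)
pose c : C := (rising t l)%:R * a^*%C ^+ l * (eta a)%:C%C ^+ t.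
rewrite derive1nS; apply: cdiff_derive1.
apply: (@cdiff_near R (fun w => c * (1 - a^*%C * w)^-1 ^+ (t + l)) _ z _ (eta z)).
- by rewrite eta_gt0.
- move=> w /(disc_nbhs zD) wD; rewrite (IH w wD) /kerf /c !exprMn exprD; ring.
have := cdiffZ c (cdiff_invX (t + l) a1 zD).
set d := (X in cdiff _ _ X -> _); set d' := (X in _ -> cdiff _ _ X).
have -> // : d = d'; rewrite /d /d' /c risingS /kerf natrM !exprMn exprD !exprS; ring.
Qed.

End HoloAlgebra.

(** * Separation of the orders of differentiation and of the summands *)

Section RisingFactorials.
Variable R : realType.
Local Notation C := (R[i])^o.

(** The discrete counterpart of (x^(l+1))' = (l+1) x^l; it lowers the order in the induction that
    separates the derivatives. *)
Lemma rising_diff t l : (rising t.+1 l.+1 = rising t l.+1 + l.+1 * rising t.+1 l)%N.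
Proof. by rewrite risingS risingSl -mulnDl mulnC addSnnS. Qed.

(* A difference in t turns the system for n + 1 into one for n. *)
Lemma rising_system n N : exists2 K : R, 0 < K & forall (x : nat -> C) l, (l <= n)%N ->
  nc (x l) <= K * \sum_(i < n.+1) nc (\sum_(j < n.+1) (rising (N + i) j)%:R * x j).
Proof.
elim: n N => [|n IH] N.
  exists 1 => // x l; rewrite leqn0 => /eqP ->.
  by rewrite !big_ord1 rising0 !mul1r.
have [K K0 HK] := IH N.+1.
pose A := \sum_(j < n.+1) (rising N j.+1)%:R : R.
have A0 : 0 <= A by apply: sumr_ge0 => j _; rewrite ler0n.
exists (2 * K + 1 + A * (2 * K)); first by rewrite ltr_pwDl ?mulr_ge0 ?(ltW K0)// addr_gt0//
  mulr_gt0.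
move=> x l ln; pose S t : C := \sum_(j < n.+2) (rising t j)%:R * x j.
pose T := \sum_(i < n.+2) nc (S (N + i)%N).
rewrite -/T; have T0 : 0 <= T by apply: sumr_ge0 => i _; exact: nc_ge0.
have H m : (m <= n)%N -> nc (x m.+1) <= 2 * K * T.
  move=> mn; have := HK (fun j => j.+1%:R * x j.+1) m mn.
  set Q := (X in K * X); move=> h.
  have QT : Q <= 2 * T.
    apply: (@le_trans _ _ (\sum_(i < n.+1) (nc (S (N + i).+1) + nc (S (N + i)%N)))).
      apply: ler_sum => i _; apply: le_trans (ncB _ _); rewrite le_eqVlt; apply/orP; left;
        apply/eqP.
      congr (nc _); rewrite /S addSn -sumrB [RHS]big_ord_recl/= !rising0 subrr add0r.
      apply: eq_bigr => j _; rewrite /bump leq0n add1n rising_diff natrD natrM; ring.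
    rewrite big_split/=.
    have h1 : \sum_(i < n.+1) nc (S (N + i).+1) <= T.
      rewrite /T [leRHS]big_ord_recl/= -[leLHS]add0r; apply: lerD; first exact: nc_ge0.
      by apply: ler_sum => i _; rewrite /bump leq0n add1n addnS.
    have h2 : \sum_(i < n.+1) nc (S (N + i)%N) <= T.
      by rewrite /T [leRHS]big_ord_recr/= lerDl nc_ge0.
    by move: h1 h2; lra.
  have h3 : nc (x m.+1) <= nc (m.+1%:R * x m.+1).
    by rewrite ncM nc_nat ler_peMl ?nc_ge0// ler1n.
  apply: le_trans h3 (le_trans h _).
  by rewrite (mulrC 2 K) -mulrA ler_pM2l.
case: l ln => [_|l ln]; last first.
  apply: le_trans (H l ln) _; by rewrite ler_wpM2r// -addrA lerDl addr_ge0// mulr_ge0//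
    mulr_ge0// (ltW K0).
have -> : x 0%N = S N - \sum_(j < n.+1) (rising N j.+1)%:R * x j.+1.
  by rewrite /S big_ord_recl/= rising0 mul1r; apply/eqP; rewrite eq_sym subr_eq.
apply: le_trans (ncB _ _) _.
have h1 : nc (S N) <= T by rewrite /T big_ord_recl/= addn0 lerDl sumr_ge0// => i _; exact: nc_ge0.
have h2 : nc (\sum_(j < n.+1) (rising N j.+1)%:R * x j.+1) <= A * (2 * K * T).
  apply: le_trans (nc_sum _ _ _) _; rewrite /A mulr_suml; apply: ler_sum => j _.
  by rewrite ncM nc_nat ler_wpM2l// H// -ltnS.
apply: le_trans (lerD h1 h2) _.
have -> : (2 * K + 1 + A * (2 * K)) * T = T + A * (2 * K * T) + 2 * K * T by ring.
by rewrite lerDl !mulr_ge0// ltW.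
Qed.

(** Each term is at most the (1/q)-th power of [T]; this crude argument covers q < 1 and q >= 1
    alike. *)
Lemma powR_sum_le_card (q : R) (I : finType) (x : I -> R) : 0 < q -> (forall i, 0 <= x i) ->
  (\sum_i x i) `^ q <= #|I|%:R `^ q * \sum_i x i `^ q.
Proof.
move=> q0 x0; set T := \sum_i x i `^ q; have T0 : 0 <= T by apply: sumr_ge0 => i _; exact: powR_ge0.
have h i : x i <= T `^ q^-1.
  rewrite -[leLHS](powRKV q0 (x0 i)); apply: powR_le; rewrite ?invr_ge0 ?(ltW q0) ?powR_ge0//.
  by rewrite /T (bigD1 i)//= lerDl sumr_ge0// => j _; exact: powR_ge0.
have : \sum_i x i <= #|I|%:R * T `^ q^-1.
  apply: le_trans (ler_sum _ (fun i _ => h i)) _.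
  by rewrite sumr_const mulr_natl.
move=> /(powR_le (ltW q0) _) H; apply: le_trans (H _) _; first exact: sumr_ge0.
by rewrite powRM ?ler0n ?powR_ge0// powRVK.
Qed.

(* The sums for two sign vectors differing only at k differ by 2 Y_k. *)
Lemma sign_average (q : R) J (P : pred 'I_J) (Y : 'I_J -> C) k : 0 < q -> P k ->
  2 ^+ J * nc (Y k) `^ q <=
  2 * \sum_(e : {ffun 'I_J -> bool}) nc (\sum_(j | P j) (-1) ^+ e j * Y j) `^ q.
Proof.
move=> q0 Pk; pose S (e : {ffun 'I_J -> bool}) := \sum_(j | P j) (-1) ^+ e j * Y j.
pose flip (e : {ffun 'I_J -> bool}) := [ffun j => e j (+) (j == k)].
have flipK : involutive flip.
  by move=> e; apply/ffunP => j; rewrite !ffunE -addbA addbb addbF.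
have D e : S e - S (flip e) = (-1) ^+ e k * (2 * Y k).
  rewrite /S -sumrB (bigD1 k)//= big1 ?addr0; last first.
    by move=> j /andP[_ /negbTE jk]; rewrite ffunE jk addbF subrr.
  rewrite ffunE eqxx addbT; case: (e k) => /=; rewrite ?expr0 ?expr1; ring.
have H e : nc (Y k) `^ q <= nc (S e) `^ q + nc (S (flip e)) `^ q.
  have h : 2 * nc (Y k) <= nc (S e) + nc (S (flip e)).
    have := ncB (S e) (S (flip e)); rewrite D !ncM nc_nat.
    have -> : nc ((-1) ^+ e k : C) = 1 by case: (e k); rewrite ?expr0 ?expr1 ?ncN nc1.
    by rewrite mul1r.
  have [h1|h1] := leP (nc (Y k)) (nc (S e)).
    by apply: le_trans (powR_le (ltW q0) (nc_ge0 _) h1) _; rewrite lerDl powR_ge0.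
  have h2 : nc (Y k) <= nc (S (flip e)) by move: h h1; lra.
  by apply: le_trans (powR_le (ltW q0) (nc_ge0 _) h2) _; rewrite lerDr powR_ge0.
have : \sum_(e : {ffun 'I_J -> bool}) nc (Y k) `^ q <= \sum_e (nc (S e) `^ q + nc (S (flip e)) `^
  q).
  by apply: ler_sum => e _; exact: H.
rewrite sumr_const card_ffun card_bool card_ord big_split/= -[_ `^ q *+ _]mulr_natl natrX => h.
apply: le_trans h _; rewrite mulr_natl mulr2n lerD2l.
by rewrite [leRHS](reindex_inj (inv_inj flipK)).
Qed.

(** The case [A = 0] is wanted because local masses may vanish. The passage from [A + e] to [A]
    takes place on p-th powers, where the bound is affine in [A]. *)
Lemma derivative_estimate_ge0 (p : R) l : 0 < p -> exists2 K : R, 0 < K & forall (f : C ->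
  C) w (S A : R),
  holo f -> 0 < S -> 2 * S < eta w -> 0 <= A ->
  (iint (Qset w S) (fun z => nc (f z) `^ p)%R <= A%:E)%E ->
  S ^+ l * nc (derive1n l f w) <= K * (A / S ^+ 2) `^ p^-1.
Proof.
move=> p0; have [K K0 HK] := derivative_estimate l p0; exists K => // f w S A hf S0 Sw A0 hA.
set X := S ^+ l * _; have X0 : 0 <= X / K by rewrite divr_ge0 ?mulr_ge0 ?nc_ge0 ?exprn_ge0 ?ltW.
have S2 : 0 < S ^+ 2 by rewrite exprn_gt0.
have h : (X / K) `^ p <= A / S ^+ 2.
  rewrite ler_pdivlMr//; apply/ler_addgt0Pr => e e0.
  have Ae : 0 < A + e by rewrite ltr_wpDl.
  have : X <= K * ((A + e) / S ^+ 2) `^ p^-1.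
    by apply: HK => //; apply: le_trans hA _; rewrite lee_fin lerDl ltW.
  rewrite mulrC -ler_pdivrMr// => /(powR_le (ltW p0) X0).
  by rewrite powRVK ?divr_ge0 ?(ltW Ae) ?(ltW S2)// ler_pdivlMr.
rewrite mulrC -ler_pdivrMr// -[leLHS](powRKV p0 X0); apply: powR_le h; rewrite ?powR_ge0//.
by rewrite invr_ge0 ltW.
Qed.

End RisingFactorials.

(** * Derivatives of f against its coefficients *)

Section Transfer.
Variable R : realType.
Local Notation C := (R[i])^o.
Local Notation D := (Dset R).
Variables (E : nat -> set (R * R)) (a : nat -> C) (v : nat -> bool).
Hypothesis a1 : forall k, 1 / 4 <= nc (a k) < 1.
Hypothesis Ea : forall k t, E k t -> [/\ v k, den (a k) (cpt t) <= 3 * eta (a k) &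
         eta (a k) / 2 <= eta (cpt t : C) <= 2 * eta (a k)].
Variable p : R.
Hypothesis p0 : 0 < p.

Let ak k : nc (a k) < 1. Proof. by have /andP[] := a1 k. Qed.
Let ek k : 0 < eta (a k). Proof. by rewrite eta_gt0. Qed.
Let real_bound0 (e h : R) : 0 < e -> e / 2 <= h -> 2 * (e / 32) < h.
Proof. by lra. Qed.

Let real_bound1 (e h d : R) : 0 < e -> e / 2 <= h -> d <= 2 * (e / 32) -> e / 4 <= h - d.
Proof. by lra. Qed.

Let real_bound2 (e x d : R) : 0 < e -> x <= 3 * e -> d <= 2 * (e / 32) -> x + d <= 4 * e.
Proof. by lra. Qed.

Lemma den_perturb (a0 z w : C) : nc a0 <= 1 -> den a0 z <= den a0 w + nc (z - w).
Proof.
move=> a01; rewrite /den.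
have -> : 1 - a0^*%C * z = (1 - a0^*%C * w) - a0^*%C * (z - w) :> C by ring.
by apply: le_trans (ncB _ _) _; rewrite lerD2l ncM nc_conj ler_piMl ?nc_ge0.
Qed.

(** The square of half-side eta(a k)/32 about a point of [E k] is so small that [pk (a k)] and eta /
    eta(a k) stay above 1/4 on it. The factor in [local_mass] is then at least 4^(-8), so the local
    mean of |f|^p is bounded by a multiple of the p-th power of the coefficient, and the derivative
    estimate applies. *)
Lemma local_derivative l : exists2 K : R, 0 < K & forall f k t,
  holo f -> (wint p 0 f < +oo)%E -> E k t ->
  eta (a k) ^+ l * nc (derive1n l f (cpt t)) <= K * coef a p f k.
Proof.
have [K K0 HK] := @derivative_estimate_ge0 R p l p0.
have B0 : 0 < 4 ^+ 8 * 32 ^+ 2 :> R by rewrite mulr_gt0// exprn_gt0.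
exists (32 ^+ l * (K * (4 ^+ 8 * 32 ^+ 2) `^ p^-1)).
  by rewrite !mulr_gt0// ?exprn_gt0// powR_gt0.
move=> f k t hf ff Et; set w : C := cpt t; set e := eta (a k); have e0 : 0 < e := ek k.
have [vk dk /andP[h1 h2]] := Ea Et; rewrite -/w -/e in dk h1 h2.
have S0 : 0 < e / 32 by rewrite divr_gt0.
have Sw : 2 * (e / 32) < eta w by exact: real_bound0.
have Q u : Qset w (e / 32) u -> [/\ D u, 4^-1 <= pk (a k) (cpt u) & 4^-1 <= eta (cpt u : C) / e].
  move=> Qu; have Du : D u by exact: Qrect_disc Sw Qu.
  have du := Qrect_dist Qu; split=> //; last first.
    rewrite ler_pdivlMr// mulrC; apply: le_trans (real_bound1 e0 h1 du) _; exact: eta_dist.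
  have dp : 0 < den (a k) (cpt u) by rewrite den_gt0// ltW.
  rewrite /pk -/e ler_pdivlMr// mulrC ler_pdivrMr// mulrC.
  by apply: le_trans (den_perturb _ w (ltW (ak k))) _; exact: real_bound2.
have mQ : measurable (Qset w (e / 32)) by exact: measurable_Qset.
have QD : Qset w (e / 32) `<=` D by move=> u /Q[].
have lf := local_mass_fin a1 k hf ff.
have A0 : 0 <= 4 ^+ 8 * fine (local_mass a p f k).
  by rewrite mulr_ge0 ?exprn_ge0// fine_ge0// local_mass_ge0.
pose h z := 4 ^+ 8 * (nc (f z) `^ p * (pk (a k) z ^+ 5 * (eta z / e) ^+ 3)).
have mfac : cmeas D (fun z => nc (f z) `^ p * (pk (a k) z ^+ 5 * (eta z / e) ^+ 3)).
  exact: cmeas_local_mass.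
have fac0 u : D u -> 0 <= nc (f (cpt u)) `^ p * (pk (a k) (cpt u) ^+ 5 * (eta (cpt u) / e) ^+ 3).
  move=> Du; have u1 : nc (cpt u : C) < 1 := Du.
  apply: mulr_ge0; first exact: powR_ge0.
  apply: mulr_ge0; apply: exprn_ge0; first by rewrite ltW// pk_gt0// ltW.
  by apply: divr_ge0; rewrite ltW// eta_gt0.
have HI : (iint (Qset w (e / 32)) (fun z => nc (f z) `^ p)%R <= (4 ^+ 8 * fine (local_mass a p f
  k))%:E)%E.
  rewrite EFinM fineK// /local_mass -iintZ; last exact: exprn_ge0; last first.
  - exact: fac0.
  - exact: mfac.
  - exact: measurable_disc.
  apply: (@le_trans _ _ (iint (Qset w (e / 32)) h)); last first.
    apply: iint_subset => //; first exact: measurable_disc.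
      by apply: cmeasM => //; exact: cmeas_cst.
    by move=> u Du; apply: mulr_ge0; [exact: exprn_ge0|exact: fac0].
  apply: iint_le => //.
  - by apply: cmeasS QD _; [exact: measurable_disc|exact: cmeas_powR (holo_cmeas_nc hf)].
  - apply: cmeasS QD _; first exact: measurable_disc.
    by apply: cmeasM => //; exact: cmeas_cst.
  - by move=> u _; exact: powR_ge0.
  move=> u /Q[_ q1 q2]; rewrite /h.
  have q : 4^-1 ^+ 8 <= pk (a k) (cpt u) ^+ 5 * (eta (cpt u) / e) ^+ 3.
    rewrite (exprD _ 5 3); apply: ler_pM; rewrite ?exprn_ge0 ?invr_ge0//.
      by apply: lerXn2r; rewrite ?nnegrE ?invr_ge0// (le_trans _ q1)// invr_ge0.
    by apply: lerXn2r; rewrite ?nnegrE ?invr_ge0// (le_trans _ q2)// invr_ge0.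
  rewrite mulrCA -[leLHS]mulr1; apply: ler_wpM2l; first exact: powR_ge0.
  apply: le_trans (ler_wpM2l (exprn_ge0 8 (ler0n _ 4)) q).
  by rewrite -exprMn divff ?pnatr_eq0// expr1n.
have := HK f w _ _ hf S0 Sw A0 HI.
have -> : 4 ^+ 8 * fine (local_mass a p f k) / (e / 32) ^+ 2 =
  (4 ^+ 8 * 32 ^+ 2) * (fine (local_mass a p f k) / e ^+ 2).
  by field; rewrite lt0r_neq0.
rewrite powRM ?(ltW B0) ?divr_ge0 ?exprn_ge0 ?(ltW e0) ?fine_ge0 ?local_mass_ge0//.
rewrite -/(coef a p f k) exprMn exprVn => H.
have h32 : 0 < 32 ^+ l :> R by rewrite exprn_gt0.
have -> : e ^+ l * nc (derive1n l f w) = 32 ^+ l * (e ^+ l / 32 ^+ l * nc (derive1n l f w)).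
  by field; rewrite lt0r_neq0.
by rewrite -[leRHS]mulrA ler_pM2l// -[leRHS]mulrA.
Qed.

End Transfer.

(** * The pointwise bound by averages over signs *)

Section TransferLemma.
Variable R : realType.
Local Notation C := (R[i])^o.
Local Notation D := (Dset R).
Variables (E : nat -> set (R * R)) (a : nat -> C) (v : nat -> bool).
Hypothesis ED : \bigcup_k E k = D.
Hypothesis a1 : forall k, 1 / 4 <= nc (a k) < 1.
Hypothesis Ea : forall k t, E k t -> [/\ v k, den (a k) (cpt t) <= 3 * eta (a k) &
         eta (a k) / 2 <= eta (cpt t : C) <= 2 * eta (a k)].
Variables p q : R.
Hypotheses (p0 : 0 < p) (q0 : 0 < q).

Let ak k : nc (a k) < 1. Proof. by have /andP[] := a1 k. Qed.
Let ek k : 0 < eta (a k). Proof. by rewrite eta_gt0. Qed.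

Definition test_function (f : C -> C) J (e : {ffun 'I_J -> bool}) t (z : C) : C :=
  \sum_(k < J | v k) ((-1) ^+ e k * (coef a p f k)%:C%C) * kerf (a k) z ^+ t.

Lemma nc_sign (b : bool) : nc ((-1) ^+ b : C) = 1.
Proof. by case: b; rewrite ?expr0 ?expr1 ?ncN nc1. Qed.

Lemma test_function_holo f J (e : {ffun 'I_J -> bool}) t : holo (test_function f e t).
Proof.
apply: holo_sum => k; apply: holoM; [exact: holo_cst|].
apply: holoX; exact: holo_kerf (ak k).
Qed.

Lemma test_function_le f J (e : {ffun 'I_J -> bool}) t (z : C) :
  nc (test_function f e t z) <= \sum_(k < J | v k) coef a p f k * pk (a k) z ^+ t.
Proof.
apply: le_trans (nc_sum _ _ _) _; apply: ler_sum => k _.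
by rewrite !ncM nc_sign mul1r ncX nc_kerf// nc_real ger0_norm// coef_ge0.
Qed.

(** What each differentiation of a power of [kerf (a k)] contributes besides an integer; it does not
    depend on the power. *)
Definition sym_factor (z : C) k : C := (a k)^*%C / (1 - (a k)^*%C * z).

Definition rising_form n (x : nat -> C) t : C := \sum_(j < n.+1) (rising t j)%:R * x j.

Lemma Lop_test_function n (us : 'I_n.+1 -> C -> C) (phi : C -> C) f J (e : {ffun 'I_J ->
  bool}) t z :
  disc (phi z) -> Lop us phi (test_function f e t) z =
  \sum_(k < J | v k) (-1) ^+ e k * ((coef a p f k)%:C%C * kerf (a k) (phi z) ^+ t *
     rising_form n (fun j => us (inord j) z * sym_factor (phi z) k ^+ j) t).
Proof.
move=> pz; rewrite /Lop /Wop /test_function.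
under eq_bigr => j _.
  rewrite (@derive1n_sum R _ _ _ (fun k : 'I_J => (-1) ^+ e k * (coef a p f k)%:C%C)
    (fun (k : 'I_J) w => kerf (a k) w ^+ t) j (phi z)); last exact: pz.
    rewrite mulr_sumr; over.
  by move=> k; apply: holoX; exact: holo_kerf (ak k).
rewrite exchange_big/=; apply: eq_bigr => k _.
rewrite /rising_form !mulr_sumr; apply: eq_bigr => j _.
by rewrite derive1n_kerf// inord_val -/(sym_factor (phi z) k); ring.
Qed.

(** This is where the centres must stay away from 0: 12 = 4 * 3, from |a k| >= 1/4 and the bound 3
    eta(a k) of the denominator. *)
Lemma sym_factor_ge k t : E k t -> (12 * eta (a k))^-1 <= nc (sym_factor (cpt t) k).
Proof.
move=> Et; have [_ h _] := Ea Et; have /andP[h1 _] := a1 k.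
have Dt : D t by rewrite -ED; exists k.
have d0 : 0 < den (a k) (cpt t) by rewrite den_gt0// ltW.
rewrite ncM ncV nc_conj -/(den (a k) (cpt t)) ler_pdivlMr// mulrC ler_pdivrMr ?mulr_gt0//.
apply: le_trans h _; have -> : 3 * eta (a k) = 1 / 4 * (12 * eta (a k)) by field.
by rewrite ler_pM2r// mulr_gt0.
Qed.

Lemma pk_ge_third k t : E k t -> 3^-1 <= pk (a k) (cpt t).
Proof.
move=> Et; have [_ h _] := Ea Et; have Dt : D t by rewrite -ED; exists k.
have d0 : 0 < den (a k) (cpt t) by rewrite den_gt0// ltW.
by rewrite /pk ler_pdivlMr// mulrC ler_pdivrMr// mulrC.
Qed.

(** Where phi z lies in [E k], the l-th derivative of f is bounded by the coefficient over eta(a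
    k)^l, and this loss is made up by the l-th power of [sym_factor]. [rising_system] recovers the
    resulting product from n + 1 consecutive exponents, the kernel is at least 1/3 on [E k] so that
    its powers can be divided out, and [sign_average] bounds the k-th summand by the mean over the
    2^J sign vectors. *)
Lemma transfer_pointwise n (l : 'I_n.+1) N : exists2 K : R, 0 < K &
  forall (us : 'I_n.+1 -> C -> C) (phi : C -> C) f (z : C) k t J,
  holo f -> (wint p 0 f < +oo)%E -> E k t -> phi z = cpt t -> (k < J)%N ->
  nc (Wop (us l) phi l f z) `^ q <=
  K / 2 ^+ J * \sum_(i < n.+1) \sum_(e : {ffun 'I_J -> bool})
    nc (Lop us phi (test_function f e (N + i)) z) `^ q.
Proof.
have [K K0 HK] := local_derivative a1 Ea p0 l.
have [K1 K10 HK1] := @rising_system R n N.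
pose M := K * 12 ^+ l * K1 * 3 ^+ (N + n).
have M0 : 0 < M by rewrite !mulr_gt0// exprn_gt0.
exists (M `^ q * n.+1%:R `^ q * 2); first by rewrite !mulr_gt0 ?powR_gt0 ?ltr0n.
move=> us phi f z k t J hf ff Et pz kJ; have [vk _ _] := Ea Et.
have Dt : D t by rewrite -ED; exists k.
have pzD : disc (phi z) by rewrite pz.
pose x j := us (inord j) z * sym_factor (phi z) k ^+ j.
pose c := coef a p f k; have c0 : 0 <= c := coef_ge0 a p f k.
pose Y i (j : 'I_J) := (coef a p f j)%:C%C * kerf (a j) (phi z) ^+ (N + i) *
  rising_form n (fun m => us (inord m) z * sym_factor (phi z) j ^+ m) (N + i).
pose k' := Ordinal kJ.
have HW : nc (Wop (us l) phi l f z) <= M * \sum_(i < n.+1) nc (Y i k').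
  have h1 : nc (Wop (us l) phi l f z) <= K * 12 ^+ l * (c * nc (x l)).
    rewrite /Wop ncM pz; have e0 := exprn_gt0 l (ek k).
    have h : nc (derive1n l f (cpt t)) <= K * c / eta (a k) ^+ l.
      by rewrite ler_pdivlMr// mulrC; exact: HK.
    apply: le_trans (ler_wpM2l (nc_ge0 _) h) _.
    have hs : (eta (a k) ^+ l)^-1 <= 12 ^+ l * nc (sym_factor (phi z) k) ^+ l.
      rewrite -exprMn -exprVn; apply: lerXn2r; rewrite ?nnegrE ?invr_ge0 ?mulr_ge0 ?nc_ge0 ?(ltW
        (ek k))//.
      have := sym_factor_ge Et; rewrite -pz invfM => hh.
      by rewrite -ler_pdivrMl.
    rewrite /x inord_val ncM ncX.
    have -> : nc (us l z) * (K * c / eta (a k) ^+ l) = (nc (us l z) * K * c) * (eta (a k) ^+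
      l)^-1 by ring.
    have -> : K * 12 ^+ l * (c * (nc (us l z) * nc (sym_factor (phi z) k) ^+ l)) =
      (nc (us l z) * K * c) * (12 ^+ l * nc (sym_factor (phi z) k) ^+ l) by ring.
    by apply: ler_wpM2l => //; rewrite !mulr_ge0 ?nc_ge0 ?(ltW K0).
  apply: le_trans h1 _; rewrite /M -!(mulrA (K * _)); apply: ler_wpM2l.
    by rewrite mulr_ge0 ?exprn_ge0 ?(ltW K0).
  have h2 := HK1 x l (ltn_ord l).
  apply: le_trans (ler_wpM2l c0 h2) _; rewrite mulrCA -[leRHS]mulrA; apply: ler_wpM2l;
    first exact: ltW.
  rewrite !mulr_sumr; apply: ler_sum => i _.
  have -> : nc (Y i k') = pk (a k) (phi z) ^+ (N + i) * (c * nc (rising_form n x (N + i))).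
    by rewrite /Y (_ : nat_of_ord k' = k)// !ncM ncX nc_kerf// nc_real ger0_norm// -/x -/c; ring.
  rewrite mulrA -/(rising_form n x (N + i)) -[leLHS]mul1r; apply: ler_wpM2r;
    first by rewrite mulr_ge0 ?nc_ge0.
  have pk3 := pk_ge_third Et; rewrite -pz in pk3.
  have p1 : pk (a k) (phi z) <= 1 by rewrite pk_le1// ltW.
  have pp : 0 < pk (a k) (phi z) by apply: lt_le_trans pk3; rewrite invr_gt0.
  rewrite -ler_pdivrMl ?exprn_gt0// mulr1 -exprVn.
  apply: (@le_trans _ _ (pk (a k) (phi z) ^+ (N + n))).
    by apply: lerXn2r; rewrite ?nnegrE ?invr_ge0// ltW.
  by apply: ler_wiXn2l; rewrite ?(ltW pp)// leq_add2l -ltnS.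
have J0 : 0 < 2 ^+ J :> R by rewrite exprn_gt0.
have S0 : 0 <= \sum_(i < n.+1) nc (Y i k') by apply: sumr_ge0 => i _; exact: nc_ge0.
apply: le_trans (powR_le (ltW q0) (nc_ge0 _) HW) _.
rewrite powRM ?(ltW M0)// -!mulrA; apply: ler_wpM2l; first exact: powR_ge0.
have := @powR_sum_le_card R q 'I_n.+1 (fun i => nc (Y i k')) q0 (fun i => nc_ge0 _).
rewrite card_ord => h; apply: le_trans h _; apply: ler_wpM2l; first exact: powR_ge0.
rewrite mulrA mulr_sumr; apply: ler_sum => i _.
have := @sign_average R q J (fun j => v j) (Y i) k' q0 vk.
under eq_bigr do rewrite -Lop_test_function//.
by rewrite -ler_pdivlMl// mulrA [_^-1 * 2]mulrC.
Qed.

End TransferLemma.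

(** * Integration of the pointwise bound *)

Section TransferIntegral.
Variable R : realType.
Local Notation C := (R[i])^o.
Local Notation D := (Dset R).

Lemma wint0E (q : R) (g : C -> C) : wint q 0 g = iint D (fun z => nc (g z) `^ q).
Proof. by apply: eq_iint => t _; rewrite expr0 mulr1. Qed.

Lemma holo_Lop n (us : 'I_n.+1 -> C -> C) (phi : C -> C) f : (forall k, holo (us k)) -> holo phi ->
  (forall z, disc z -> disc (phi z)) -> holo f -> holo (Lop us phi f).
Proof.
move=> hus hphi mphi hf; apply: (@holo_sum R _ _ _ (fun (k : 'I_n.+1) z =>
  Wop (us k) phi k f z)) => k.
exact: holo_Wop (hus k) hphi mphi hf.
Qed.

(** The sets where phi falls into [E k] are disjoint and cover the disc, so the pointwise bounds add
    up to averages of integrals of |L F|^q, each at most [e]. The constant does not depend on the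
    number J of squares, which may therefore tend to infinity. The bound of F in both weighted
    integrals lets the same statement serve boundedness and compactness. *)
Lemma transfer (p q : R) n (l : 'I_n.+1) : 0 < p -> 0 < q -> exists2 K : R, 0 < K &
  forall (us : 'I_n.+1 -> C -> C) (phi : C -> C) f (e : R),
  (forall k, holo (us k)) -> holo phi -> (forall z, disc z -> disc (phi z)) ->
  holo f -> (wint p 0 f < +oo)%E ->
  (forall F, holo F -> (wint p 0 F <= K%:E * wint p 0 f)%E -> (wint p 2 F <= K%:E * wint p 2 f)%E ->
     (wint q 0 (Lop us phi F) <= e%:E)%E) ->
  (wint q 0 (Wop (us l) phi l f) <= (K * e)%:E)%E.
Proof.
move=> p0 q0; have [E [a [v [mE tE ED a1 [Ea lE]]]]] := @whitney R.
have s0 : 0 < 1600^-1 :> R by rewrite invr_gt0 ltr0n.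
have lE' k : v k -> ((1600^-1 * eta (a k) ^+ 2)%:E <= leb2 (E k))%E.
  by move=> /lE; rewrite mulrC.
have [t0 [K1 [K10 H1]]] := test_norm_le mE tE ED a1 Ea s0 lE' p0.
have [K2 K20 H2] := transfer_pointwise ED a1 Ea p0 q0 l t0.
exists (K1 + K2 * n.+1%:R); first by rewrite addr_gt0// mulr_gt0.
move=> us phi f e hus hphi mphi hf ff HF.
have mD : measurable D by exact: measurable_disc.
(* The coordinates of [phi] are extended by 0 outside the disc to a measurable map of the plane, so
   that preimages of the squares are measurable. *)
pose hr := (fun t : R * R => complex.Re (phi (cpt t))) \_ D.
pose hi := (fun t : R * R => complex.Im (phi (cpt t))) \_ D.
pose h (t : R * R) : R * R := (hr t, hi t).
have hK t : D t -> phi (cpt t) = cpt (h t).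
  by move=> Dt; rewrite /h /hr /hi !patchT ?inE//; case: (phi _).
have mh : measurable_fun setT h.
  apply: measurable_fun_pair; apply/(measurable_restrictT _ mD).
    exact: holo_cmeas_Re hphi.
  exact: holo_cmeas_Im hphi.
pose G k := D `&` h @^-1` E k.
have mG k : measurable (G k) by apply: measurableI => //; rewrite -[_ @^-1` _]setTI; exact: mh.
have GD k : G k `<=` D by move=> t [].
have GU : \bigcup_k G k = D.
  apply/seteqP; split=> [t [k _ [//]]|t Dt].
  have : D (h t) by rewrite /= -hK//; exact: mphi.
  by rewrite -{1}ED => -[k _ Ek]; exists k.
have tG : trivIset setT G.
  by apply/trivIsetP => i j _ _ ij; rewrite /G setIACA -preimage_setI ((iffLR trivIsetP) tE)//
    preimage_set0 setI0.
have hW : holo (Wop (us l) phi l f) := holo_Wop (hus l) hphi mphi hf.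
have mW : cmeas D (fun z => nc (Wop (us l) phi l f z) `^ q) by exact: cmeas_powR (holo_cmeas_nc hW).
have W0 t : D t -> 0 <= nc (Wop (us l) phi l f (cpt t)) `^ q by move=> _; exact: powR_ge0.
have ak k : nc (a k) < 1 by have /andP[] := a1 k.
have HT J (g : {ffun 'I_J -> bool}) i :
    (iint D (fun z => nc (Lop us phi (test_function a v p f g (t0 + i)) z) `^ q)%R <= e%:E)%E.
  have hF : holo (test_function a v p f g (t0 + i)) := @test_function_holo _ _ _ a1 _ _ _ _ _.
  rewrite -wint0E; apply: HF => //.
    apply: le_trans (H1 (t0 + i)%N J 0%N f _ (leq_addr _ _) (or_introl erefl) hf hF ff _) _.
      by move=> z _; exact: test_function_le.
    by apply: lee_wpmul2r; [exact: wint_ge0|rewrite lee_fin lerDl mulr_ge0// ltW].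
  apply: le_trans (H1 (t0 + i)%N J 2%N f _ (leq_addr _ _) (or_intror erefl) hf hF ff _) _.
    by move=> z _; exact: test_function_le.
  by apply: lee_wpmul2r; [exact: wint_ge0|rewrite lee_fin lerDl mulr_ge0// ltW].
(* Any test function bounds [e] below by a nonnegative integral; the empty sum, with J = 0, will
   do. *)
have e0 : 0 <= e.
  rewrite -lee_fin; apply: le_trans (HT 0%N [ffun=> true] 0%N).
  by apply: iint_ge0 => t _; exact: powR_ge0.
rewrite wint0E /iint -{1}GU ge0_integral_bigcup//; last 2 first.
- by rewrite GU; exact/measurable_EFinP.
- by rewrite GU => t Dt; rewrite lee_fin W0.
apply: lime_le; first by apply: is_cvg_nneseries => k _ _; apply: integral_ge0 => t _;
  rewrite lee_fin powR_ge0.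
(* The first J squares are paired with the test functions of J summands. *)
near=> J; rewrite big_mkord.
have J0 : 0 < 2 ^+ J :> R by rewrite exprn_gt0.
pose L (g : {ffun 'I_J -> bool}) (i : 'I_n.+1) (z : C) :=
  nc (Lop us phi (test_function a v p f g (t0 + i)) z) `^ q.
have mL g i : cmeas D (L g i).
  have hF : holo (test_function a v p f g (t0 + i)) := @test_function_holo _ _ _ a1 _ _ _ _ _.
  have hL : holo (Lop us phi (test_function a v p f g (t0 + i))) := holo_Lop hus hphi mphi hF.
  exact: cmeas_powR (holo_cmeas_nc hL).
pose S z := K2 / 2 ^+ J * \sum_(i < n.+1) \sum_g L g i z.
have mS' : cmeas D (fun z => \sum_(i < n.+1) \sum_g L g i z).
  by apply: cmeas_sum => i _; apply: cmeas_sum => g _; exact: mL.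
have mS : cmeas D S by apply: cmeasM => //; exact: cmeas_cst.
have K2J : 0 <= K2 / 2 ^+ J by rewrite divr_ge0 ?(ltW K20) ?(ltW J0).
have S0' t : 0 <= \sum_(i < n.+1) \sum_g L g i (cpt t).
  by apply: sumr_ge0 => i _; apply: sumr_ge0 => g _; exact: powR_ge0.
apply: (@le_trans _ _ (\sum_(k < J) iint (G k) S)%E).
  apply: lee_sum => k _; apply: (@iint_le R (G k) (fun z => nc (Wop (us l) phi l f z) `^ q) S) =>
    //.
  - exact: (cmeasS mD (GD k) mW).
  - exact: (cmeasS mD (GD k) mS).
  - by move=> t [Dt _]; exact: W0.
  by move=> t [Dt Ek]; exact: (H2 us phi f (cpt t) k (h t) J hf ff Ek (hK t Dt) (ltn_ord k)).
apply: le_trans (@sum_iint_le R G xpredT S J mG tG GD mS _) _.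
  by move=> t _; rewrite mulr_ge0.
rewrite iintZ// iint_sum//; last 2 first.
- by move=> i _; apply: cmeas_sum => g _; exact: mL.
- by move=> i t _ _; apply: sumr_ge0 => g _; exact: powR_ge0.
apply: (@le_trans _ _ ((K2 / 2 ^+ J)%:E * (\sum_(i < n.+1) (2 ^+ J * e)%:E))%E).
  apply: lee_wpmul2l; first by rewrite lee_fin.
  apply: lee_sum => i _; rewrite iint_sum//; last by move=> g t _ _; exact: powR_ge0.
  apply: (@le_trans _ _ (\sum_(g : {ffun 'I_J -> bool}) e%:E)%E).
    by apply: lee_sum => g _; exact: HT.
  by rewrite sumEFin lee_fin sumr_const card_ffun card_bool card_ord -[leLHS]mulr_natl natrX.
rewrite sumEFin -EFinM lee_fin sumr_const card_ord -[X in _ * X <= _]mulr_natl.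
have -> : K2 / 2 ^+ J * (n.+1%:R * (2 ^+ J * e)) = K2 * n.+1%:R * e by field; rewrite lt0r_neq0.
by apply: ler_wpM2r => //; rewrite lerDr ltW.
Unshelve. all: by end_near.
Qed.

End TransferIntegral.

(** * Bounded and compact operators *)

Section Operators.
Variable R : realType.
Local Notation C := (R[i])^o.
Local Notation D := (Dset R).
Implicit Types (f g : C -> C) (T : (C -> C) -> C -> C).

Let mD : measurable D. Proof. exact: measurable_disc. Qed.
Let Dp t : D t -> 0 < eta (cpt t : C). Proof. by move=> Dt; rewrite eta_gt0; exact: Dt. Qed.

Lemma pi_ge1 : 1 <= pi :> R.
Proof. by apply: le_trans (pi_ge2 R); rewrite ler1n. Qed.

Lemma pintE (p : R) f : holo f -> pint p f = (pi^-1%:E * wint p 0 f)%E.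
Proof.
move=> hf; rewrite wint0E -iintZ ?invr_ge0 ?pi_ge0//.
- by apply: eq_integral => t _; rewrite mulrC.
- exact: cmeas_powR (holo_cmeas_nc hf).
- by move=> t _; exact: powR_ge0.
Qed.

Lemma wint_ltoo (p : R) f : Ap p f <-> holo f /\ (wint p 0 f < +oo)%E.
Proof.
split=> -[hf H]; split=> //; move: H; rewrite pintE//.
  have := wint_ge0 p 0 f; case: (wint p 0 f) => [r _ _|_|//]; first exact: ltry.
  by rewrite mulry gtr0_sg ?invr_gt0 ?pi_gt0// mul1e.
have := wint_ge0 p 0 f; case: (wint p 0 f) => [r _ _|//|//]; exact: ltry.
Qed.

(** An infinite integral is sent to 0 by [fine] on both sides, so the identity holds on all
    holomorphic functions. *)
Lemma normA_powR (p : R) f : 0 < p -> holo f -> normA p f `^ p = pi^-1 * fine (wint p 0 f).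
Proof.
move=> p0 hf; rewrite /normA pintE// powRVK//; last first.
  by rewrite fine_ge0// mule_ge0 ?wint_ge0// lee_fin invr_ge0 pi_ge0.
have := wint_ge0 p 0 f; case: (wint p 0 f) => [r _//|_|//].
by rewrite mulry gtr0_sg ?invr_gt0 ?pi_gt0// mul1e mulr0.
Qed.

Lemma normA_ge0 (p : R) f : 0 <= normA p f. Proof. exact: powR_ge0. Qed.

Lemma wint_fin (p : R) b f : (wint p b f < +oo)%E -> wint p b f \is a fin_num.
Proof. by move=> H; rewrite ge0_fin_numE; [exact: H|exact: wint_ge0]. Qed.

Lemma eq_wint (p : R) b f g : (forall z, disc z -> f z = g z) -> wint p b f = wint p b g.
Proof. by move=> H; apply: eq_iint => t Dt; rewrite H. Qed.

Lemma wintZ (p : R) b (c : C) f : holo f ->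
  wint p b (fun z => c * f z) = ((nc c `^ p)%:E * wint p b f)%E.
Proof.
move=> hf; rewrite /wint -iintZ ?powR_ge0//.
- by apply: eq_iint => t _; rewrite ncM powRM ?nc_ge0// mulrA.
- exact: cmeas_wint.
- by move=> t /Dp h; rewrite mulr_ge0 ?powR_ge0 ?exprn_ge0// ltW.
Qed.

Lemma wint2_le (p : R) f : holo f -> (wint p 2 f <= wint p 0 f)%E.
Proof.
move=> hf; apply: iint_le => //; try exact: cmeas_wint.
- by move=> t /Dp h; rewrite mulr_ge0 ?powR_ge0 ?exprn_ge0// ltW.
move=> t Dt; rewrite ler_wpM2l ?powR_ge0// expr0 exprn_ile1 ?(ltW (Dp Dt))//.
by rewrite eta_le1.
Qed.

Lemma wint_sub (p : R) b f g : 0 < p -> holo f -> holo g ->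
  (wint p b (fun z => f z - g z)%R <= (2 `^ p)%:E * (wint p b f + wint p b g))%E.
Proof.
move=> p0 hf hg; have hfg := holoB hf hg.
have c0 h t : D t -> 0 <= nc (h (cpt t) : C) `^ p * eta (cpt t : C) ^+ b.
  by move=> /Dp e0; rewrite mulr_ge0 ?powR_ge0 ?exprn_ge0// ltW.
rewrite /wint -iintD//; try exact: cmeas_wint; try exact: c0.
rewrite -iintZ ?powR_ge0//; last 2 first.
- by apply: cmeasD; exact: cmeas_wint.
- by move=> t Dt; rewrite addr_ge0 ?c0.
apply: iint_le => //; try exact: cmeas_wint; try exact: c0.
  apply: cmeasM; first exact: cmeas_cst.
  by apply: cmeasD; exact: cmeas_wint.
  by move=> t Dt; exact: (c0 (fun z => f z - g z)).
move=> t Dt; rewrite -mulrDl mulrA; apply: ler_wpM2r; first by rewrite exprn_ge0// ltW// Dp.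
have := @powR_sum_le_card R p bool (fun b => if b then nc (f (cpt t)) else nc (g (cpt t))) p0.
rewrite card_bool !big_bool/= => H; apply: le_trans (H _); last by case; exact: nc_ge0.
by apply: powR_le; [exact: ltW|exact: nc_ge0|exact: ncB].
Qed.

(** On a square about [w] eta is at least eta(w)/2, so the weight costs only a constant there;
    smallness of [wint p 2] thus forces smallness of all derivatives at [w]. *)
Lemma eval_bound (p : R) l (w : C) : 0 < p -> disc w -> exists2 K : R, 0 < K & forall f (d : R),
  holo f -> 0 <= d -> (wint p 2 f <= d%:E)%E -> nc (derive1n l f w) <= K * d `^ p^-1.
Proof.
move=> p0 wD; have [K K0 HK] := @derivative_estimate_ge0 R p l p0.
have e0 : 0 < eta w by rewrite eta_gt0.
set S := eta w / 4; have S0 : 0 < S by rewrite divr_gt0.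
have Sw : 2 * S < eta w by rewrite /S; move: e0; set x := eta w; move=> x0; lra.
pose c := (eta w / 2) ^- 2 / S ^+ 2.
have c0 : 0 < c by rewrite divr_gt0 ?invr_gt0 ?exprn_gt0// divr_gt0.
exists (S ^- l * K * c `^ p^-1).
  by rewrite !mulr_gt0 ?invr_gt0 ?exprn_gt0// powR_gt0.
move=> f d hf d0 hd.
have A0 : 0 <= (eta w / 2) ^- 2 * d by rewrite mulr_ge0 ?invr_ge0 ?exprn_ge0 ?divr_ge0 ?(ltW e0).
have QD : Qset w S `<=` D by move=> t /(Qrect_disc Sw).
have HI : (iint (Qset w S) (fun z => nc (f z) `^ p)%R <= ((eta w / 2) ^- 2 * d)%:E)%E.
  have i0 : 0 <= (eta w / 2) ^- 2 by rewrite invr_ge0 exprn_ge0// divr_ge0// ltW.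
  rewrite EFinM; apply: le_trans (lee_wpmul2l _ hd); last by rewrite lee_fin.
  rewrite /wint -iintZ//; last 2 first.
  - exact: cmeas_wint.
  - by move=> t /Dp h; rewrite mulr_ge0 ?powR_ge0 ?exprn_ge0// ltW.
  apply: (@le_trans _ _ (iint (Qset w S) (fun z => (eta w / 2) ^- 2 * (nc (f z) `^ p * eta z ^+
    2))%R)); last first.
    apply: iint_subset => //; first exact: measurable_Qset.
      by apply: cmeasM; [exact: cmeas_cst|exact: cmeas_wint].
    by move=> t /Dp h; rewrite !mulr_ge0 ?powR_ge0 ?exprn_ge0// ltW.
  apply: iint_le; first exact: measurable_Qset.
  - exact: (cmeasS mD QD (cmeas_powR p (holo_cmeas_nc hf))).
  - apply: (cmeasS mD QD); apply: cmeasM; [exact: cmeas_cst|exact: cmeas_wint].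
  - by move=> t _; exact: powR_ge0.
  move=> t Qt; have h := Qrect_eta Qt.
  have h2 : eta w / 2 <= eta (cpt t : C).
    apply: le_trans h; rewrite /S; move: e0; set x := eta w; move=> x0; lra.
  rewrite mulrCA -[leLHS]mulr1; apply: ler_wpM2l; first exact: powR_ge0.
  rewrite mulrC -ler_pdivrMr ?invr_gt0 ?exprn_gt0 ?divr_gt0// mul1r invrK.
  by apply: lerXn2r; rewrite ?nnegrE ?divr_ge0 ?(ltW e0)// (le_trans _ h2)// divr_ge0// ltW.
have := HK f w S _ hf S0 Sw A0 HI; rewrite mulrC -ler_pdivlMr ?exprn_gt0// => H.
apply: le_trans H _; rewrite le_eqVlt; apply/orP; left; apply/eqP.
have -> : (eta w / 2) ^- 2 * d / S ^+ 2 = c * d by rewrite /c mulrAC.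
by rewrite powRM ?(ltW c0)//; ring.
Qed.

(** What the criteria on the unit ball use of an operator, shared by [Lop] and by every [Wop]. The
    identities are asked for holomorphic functions and inside the disc only, where derivatives are
    under control; the last clause is continuity of point evaluations with respect to [wint p 2]. *)
Definition admissible (p : R) T := [/\ (forall f, holo f -> holo (T f)),
  (forall (c : C) f z, holo f -> disc z -> T (fun w => c * f w) z = c * T f z),
  (forall f g z, holo f -> holo g -> disc z -> T (fun w => f w - g w) z = T f z - T g z) &
  (forall z, disc z -> exists2 K : R, 0 < K & forall f (d : R),
     holo f -> 0 <= d -> (wint p 2 f <= d%:E)%E -> nc (T f z) <= K * d `^ p^-1)].

(* Boundedness and compactness are both read off the behaviour on the unit ball
   of A^p; compactness means smallness where the weighted integral
   [wint p 2 f] is small, which on the ball is equivalent to f being small locally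
   uniformly. *)
Definition ball_bounded (p q : R) T := exists2 c : R, 0 < c & forall f, holo f ->
  (wint p 0 f <= 1%:E)%E -> (wint q 0 (T f) <= c%:E)%E.

Definition ball_compact (p q : R) T := forall e : R, 0 < e -> exists2 d : R, 0 < d & forall f,
  holo f -> (wint p 0 f <= 1%:E)%E -> (wint p 2 f <= d%:E)%E -> (wint q 0 (T f) <= e%:E)%E.

(** The multiple of f by the scalar M^(-1/p), whose p-th power is 1/M for either weight and whose
    q-th power appears on the image. *)
Lemma normalize (p q : R) T f (M : R) : 0 < p -> admissible p T -> holo f -> 0 < M ->
  exists g, [/\ holo g, forall b, wint p b g = (M^-1%:E * wint p b f)%E &
    wint q 0 (T g) = ((M `^ (- (q / p)))%:E * wint q 0 (T f))%E].
Proof.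
move=> p0 [hT hZ _ _] hf M0; pose c : C := (M `^ (- p^-1))%:C%C.
have nc_c : nc c = M `^ (- p^-1) by rewrite nc_real ger0_norm ?powR_ge0.
exists (fun z => c * f z); split.
- exact: (holoM (@holo_cst R c) hf).
- by move=> b; rewrite wintZ// nc_c -powRrM mulNr mulVf ?lt0r_neq0// powR_inv1// ltW.
rewrite (@eq_wint q 0 (T (fun z => c * f z)) (fun z => c * T f z)); last by move=> z zD; rewrite hZ.
by rewrite (wintZ q 0 c (hT f hf)) nc_c -powRrM mulNr (mulrC p^-1).
Qed.

Lemma ball_scale (q s M : R) (x : \bar R) : 0 < M -> ((M `^ (- s))%:E * x <= q%:E)%E ->
  (x <= (q * M `^ s)%:E)%E.
Proof.
move=> M0; have Ms := powR_gt0 s M0; rewrite powRN; case: x => [r| |].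
- by rewrite -EFinM !lee_fin -ler_pdivlMl ?invr_gt0// invrK mulrC.
- by rewrite mulry gtr0_sg ?invr_gt0// mul1e.
- by move=> _; exact: leNye.
Qed.

Lemma ball_bounded_scale (p q : R) T (c : R) : 0 < p -> admissible p T ->
  (forall f, holo f -> (wint p 0 f <= 1%:E)%E -> (wint q 0 (T f) <= c%:E)%E) ->
  forall f (M : R), holo f -> 0 < M -> (wint p 0 f <= M%:E)%E ->
    (wint q 0 (T f) <= (c * M `^ (q / p))%:E)%E.
Proof.
move=> p0 aT H f M hf M0 fM; have [g [hg wg wTg]] := normalize q p0 aT hf M0.
apply: ball_scale => //; rewrite -wTg; apply: (H g hg); rewrite wg.
apply: le_trans (lee_wpmul2l _ fM) _; first by rewrite lee_fin invr_ge0 ltW.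
by rewrite -EFinM mulVf ?lt0r_neq0.
Qed.

Lemma ball_compact_scale (p q : R) T (M e : R) : 0 < p -> admissible p T -> ball_compact p q T ->
  0 < M -> 0 < e -> exists2 d : R, 0 < d & forall f, holo f -> (wint p 0 f <= M%:E)%E ->
    (wint p 2 f <= d%:E)%E -> (wint q 0 (T f) <= e%:E)%E.
Proof.
move=> p0 aT H M0 e0; have Ms := powR_gt0 (q / p) M0.
have [d d0 Hd] := H _ (divr_gt0 e0 Ms); exists (M * d); first exact: mulr_gt0.
move=> f hf fM fd; have [g [hg wg wTg]] := normalize q p0 aT hf M0.
rewrite -[e](divfK (lt0r_neq0 Ms)); apply: ball_scale => //; rewrite -wTg.
have M1 : (0%:E <= M^-1%:E)%E by rewrite lee_fin invr_ge0 ltW.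
apply: (Hd g hg); rewrite wg.
  by apply: le_trans (lee_wpmul2l M1 fM) _; rewrite -EFinM mulVf ?lt0r_neq0.
by apply: le_trans (lee_wpmul2l M1 fd) _; rewrite -EFinM mulKf ?lt0r_neq0.
Qed.

(** As [wint p 2] never exceeds [wint p 0], dividing |f|^p by [d^-1 + 1] makes the smallness
    condition automatic on the ball; homogeneity restores f. *)
Lemma ball_compact_bounded (p q : R) T : 0 < p -> admissible p T -> ball_compact p q T ->
  ball_bounded p q T.
Proof.
move=> p0 aT H; have [d d0 Hd] := H 1 ltr01.
have M0 : 0 < d^-1 + 1 by rewrite addr_gt0// invr_gt0.
exists (1 * (d^-1 + 1) `^ (q / p)); first by rewrite mul1r powR_gt0.
move=> f hf f1; have [g [hg wg wTg]] := normalize q p0 aT hf M0.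
apply: ball_scale => //; rewrite -wTg.
have M1 : (0%:E <= (d^-1 + 1)^-1%:E)%E by rewrite lee_fin invr_ge0 ltW.
have h1 : (d^-1 + 1)^-1 <= 1 by rewrite invf_le1// lerDr invr_ge0 ltW.
have h2 : (d^-1 + 1)^-1 <= d by rewrite -[leRHS]invrK lef_pV2 ?posrE ?invr_gt0// lerDl.
apply: (Hd g hg); rewrite wg; last first.
  apply: le_trans (lee_wpmul2l M1 (le_trans (wint2_le p hf) f1)) _.
  by rewrite -EFinM mulr1 lee_fin.
by apply: le_trans (lee_wpmul2l M1 f1) _; rewrite -EFinM mulr1 lee_fin.
Qed.

Lemma bounded_opP (p q : R) T : 0 < p -> 0 < q -> admissible p T ->
  bounded_op p q T <-> ball_bounded p q T.
Proof.
move=> p0 q0 aT; have [hT _ _ _] := aT; split=> [[maps [c Hc]]|[c c0 Hc]].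
  (* The constant [c] of the hypothesis may be negative, hence its modulus; the summand 1 makes the
     new constant positive. *)
  exists (pi * (`|c| `^ q + 1)).
    by rewrite mulr_gt0 ?pi_gt0// ltr_wpDl// powR_ge0.
  move=> f hf f1; have Af : Ap p f by apply/wint_ltoo; split=> //; exact: le_lt_trans f1 (ltry _).
  have [hTf fin] := (wint_ltoo q (T f)).1 (maps f Af).
  have nf : normA p f <= 1.
    have w0 := wint_ge0 p 0 f.
    have <- : 1 `^ p^-1 = 1 :> R by rewrite powR1.
    rewrite -(powRKV p0 (normA_ge0 p f)) normA_powR//.
    apply: powR_le; rewrite ?invr_ge0 ?(ltW p0) ?mulr_ge0 ?invr_ge0 ?pi_ge0 ?fine_ge0//.
    rewrite mulrC ler_pdivrMr ?pi_gt0// mul1r; apply: le_trans pi_ge1.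
    by rewrite -lee_fin (fineK (wint_fin (le_lt_trans f1 (ltry _)))).
  have : normA q (T f) <= `|c|.
    apply: le_trans (Hc f Af) _; apply: (@le_trans _ _ (`|c| * normA p f)).
      by rewrite ler_wpM2r ?normA_ge0// ler_norm.
    by rewrite ler_piMr.
  move=> /(powR_le (ltW q0) (normA_ge0 _ _)); rewrite normA_powR// mulrC ler_pdivrMr ?pi_gt0// => H.
  rewrite -[X in (X <= _)%E](fineK (wint_fin fin)).
  by rewrite lee_fin (le_trans H)// mulrC ler_pM2l ?pi_gt0// lerDl.
have S := ball_bounded_scale p0 aT Hc.
have maps f : Ap p f -> Ap q (T f).
  move=> /wint_ltoo[hf ff]; apply/wint_ltoo; split; first exact: hT.
  have w0 := wint_ge0 p 0 f.
  have fk := wint_fin ff.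
  apply: le_lt_trans (S f (fine (wint p 0 f) + 1) hf _ _) (ltry _).
    by rewrite ltr_wpDl// fine_ge0.
  by rewrite EFinD fineK// leeDl.
split=> //; exists ((pi^-1 * c) `^ q^-1 * pi `^ p^-1) => f Af.
have [hf ff] := (wint_ltoo p f).1 Af; have [hTf Tff] := (wint_ltoo q (T f)).1 (maps f Af).
have w0 := wint_ge0 p 0 f.
have fk := wint_fin ff.
have Tk := wint_fin Tff.
set W := fine (wint p 0 f); have W0 : 0 <= W by rewrite fine_ge0.
have pc0 : 0 < pi^-1 * c by rewrite mulr_gt0// invr_gt0 pi_gt0.
set c' := (pi^-1 * c) `^ q^-1; have c'0 : 0 < c' by rewrite powR_gt0.
(* [W] may be 0, so the normalisation is done at the level [W + e], and [e] tends to 0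
   afterwards. *)
have key (e : R) : 0 < e -> normA q (T f) <= c' * (W + e) `^ p^-1.
  move=> e0; have We : 0 < W + e by rewrite ltr_wpDl.
  have fe : (wint p 0 f <= (W + e)%:E)%E by rewrite EFinD (fineK fk) leeDl// lee_fin; exact: ltW.
  have := S f (W + e) hf We fe; rewrite -[X in (X <= _)%E]fineK// lee_fin => h.
  rewrite -(powRKV q0 (normA_ge0 q (T f))) normA_powR//.
  apply: (@le_trans _ _ ((pi^-1 * (c * (W + e) `^ (q / p))) `^ q^-1)).
    apply: powR_le; rewrite ?invr_ge0 ?(ltW q0)// ?mulr_ge0 ?invr_ge0 ?pi_ge0 ?fine_ge0 ?wint_ge0//.
    by rewrite ler_pM2l// invr_gt0 pi_gt0.
  rewrite mulrA powRM ?(ltW pc0) ?powR_ge0// -/c' -powRrM mulrAC mulfV ?lt0r_neq0// mul1r.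
  exact: lexx.
have h : (normA q (T f) / c') `^ p <= W.
  apply/ler_addgt0Pr => e e0; have := key e e0; rewrite mulrC -ler_pdivrMr//.
  move=> /(powR_le (ltW p0) _) => /(_ (divr_ge0 (normA_ge0 _ _) (ltW c'0))).
  by rewrite powRVK// addr_ge0// ltW.
have n0 : 0 <= normA q (T f) / c' by rewrite divr_ge0 ?normA_ge0 ?(ltW c'0).
have : normA q (T f) / c' <= W `^ p^-1.
  by rewrite -(powRKV p0 n0); apply: powR_le; rewrite ?invr_ge0 ?(ltW p0) ?powR_ge0.
rewrite ler_pdivrMr// mulrC => H; apply: le_trans H _.
rewrite -mulrA ler_pM2l// -(powRKV p0 (normA_ge0 p f)) normA_powR// -powRM ?pi_ge0//.
  by rewrite mulrA mulfV ?mul1r ?lt0r_neq0 ?pi_gt0.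
by rewrite mulr_ge0 ?invr_ge0 ?pi_ge0.
Qed.

End Operators.

(** * Limits of bounded sequences along an ultrafilter *)

Section UltraLimits.
Variable R : realType.
Local Notation C := (R[i])^o.
Variable F : set_system nat.
Hypotheses (UF : UltraFilter F) (Foo : forall N, F [set n | (N <= n)%N]).

Let PF : ProperFilter F := ultra_proper.
Local Existing Instance PF.

(** Compactness of [-M, M] provides a cluster point, and an ultrafilter converges to each of its
    cluster points. *)
Lemma real_ultra_limit (u : nat -> R) (M : R) : (forall n, `|u n| <= M) ->
  exists x, forall e, 0 < e -> F [set n | `|u n - x| < e].
Proof.
move=> uM; have := @segment_compact R (- M) M.
move=> /(_ (u @ F) _) [].
  apply: (@filterS _ F _ setT); last exact: filterT.
  by move=> n _ /=; rewrite in_itv/= -ler_norml; exact: uM.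
move=> x [_ xcl]; exists x => e e0.
have [//|H] := in_ultra_setVsetC [set n | `|u n - x| < e] UF.
have [y [/= y1 y2]] := xcl [set y | ~ (`|y - x| < e)] (ball x e) H (nbhsx_ballx x e e0).
by case: y1; rewrite distrC.
Qed.

Definition ulim (u : nat -> C) (l : C) := forall e : R, 0 < e -> F [set n | nc (u n - l) <= e].

Lemma ulim_ex (u : nat -> C) (M : R) : (forall n, nc (u n) <= M) -> exists l, ulim u l.
Proof.
move=> uM.
have [x Hx] := @real_ultra_limit (fun n => complex.Re (u n)) M (fun n => le_trans (nc_Re _) (uM n)).
have [y Hy] := @real_ultra_limit (fun n => complex.Im (u n)) M (fun n => le_trans (nc_Im _) (uM n)).
exists (x +i* y)%C => e e0; have e2 : 0 < e / 2 by rewrite divr_gt0.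
apply: filterS (filterI (Hx _ e2) (Hy _ e2)) => n [/= h1 h2].
apply: le_trans (nc_le_ReIm _) _; rewrite [e]splitr.
have -> : complex.Re (u n - (x +i* y)%C : C) = complex.Re (u n) - x by case: (u n).
have -> : complex.Im (u n - (x +i* y)%C : C) = complex.Im (u n) - y by case: (u n).
by rewrite lerD// ltW.
Qed.

Lemma ulim_dist (u w : nat -> C) l l' (K : R) : ulim u l -> ulim w l' ->
  (forall n, nc (u n - w n) <= K) -> nc (l - l') <= K.
Proof.
move=> ul wl H; apply/ler_addgt0Pr => e e0; have e2 : 0 < e / 2 by rewrite divr_gt0.
have [n [/= h1 h2]] := filter_ex (filterI (ul _ e2) (wl _ e2)).
have -> : l - l' = (u n - w n) - (u n - l) + (w n - l') by ring.
apply: le_trans (ncD _ _) _; rewrite [e]splitr addrA; apply: lerD h2.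
by apply: le_trans (ncB _ _) _; rewrite lerD.
Qed.

End UltraLimits.

(** * Montel's theorem for bounded sets of A^p *)

Section Montel.
Variable R : realType.
Local Notation C := (R[i])^o.
Local Notation D := (Dset R).

Lemma free_ultrafilter : exists F : set_system nat, UltraFilter F /\ forall N,
  F [set n | (N <= n)%N].
Proof.
have [F [UF FF]] := ultraFilterLemma (@eventually_filter).
by exists F; split=> // N; apply: FF; exists N.
Qed.

(** A sequence running through all dyadic points of the plane; an index that codes none is sent to
    0. *)
Definition dyadic_point (j : nat) : C :=
  if pickle_inv j is Some (n, a, b) then ((a : int)%:~R / 2 ^+ n +i* ((b :
    int)%:~R / 2 ^+ n))%C else 0.

Lemma dyadic_dense (z : C) (r : R) : 0 < r -> exists j, nc (dyadic_point j - z) <= r.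
Proof.
move=> r0; have [n nr] := @exists_pow2_lt R (r / 2) (divr_gt0 r0 (ltr0n _ 2)).
case: z => x y; pose a := Num.floor (2 ^+ n * x); pose b := Num.floor (2 ^+ n * y).
have p0 : 0 < 2 ^+ n :> R by rewrite exprn_gt0.
exists (pickle (n, a, b)); rewrite /dyadic_point pickleK_inv.
have K (t : R) : `|(Num.floor (2 ^+ n * t))%:~R / 2 ^+ n - t| <= 2 ^- n.
  rewrite -[X in _ - X](mulfK (lt0r_neq0 p0)) -mulrBl normrM [X in _ * X]gtr0_norm ?invr_gt0//.
  rewrite -[leRHS]mul1r ler_pM2r ?invr_gt0// distrC (mulrC t).
  have /andP[h1 h2] := floor_itv (2 ^+ n * t).
  by rewrite ger0_norm ?subr_ge0// lerBlDl ltW// (lt_le_trans h2)// intrD.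
apply: le_trans (nc_le_ReIm _) _; rewrite ReD ImD ReN ImN [r]splitr.
by apply: lerD; apply: le_trans (K _) (ltW nr).
Qed.

Lemma local_bound (p B : R) (z : C) : 0 < p -> 0 <= B -> disc z ->
  exists2 M : R, 0 < M & forall (f : C -> C) w,
  holo f -> (wint p 0 f <= B%:E)%E -> Qrect z (eta z / 8) w -> nc (f w) <= M.
Proof.
move=> p0 B0 zD; have [K K0 HK] := @submean R p p0.
have e0 : 0 < eta z by rewrite eta_gt0.
have B1 : 0 < B + 1 by rewrite ltr_wpDl.
have S0 : 0 < eta z / 8 by rewrite divr_gt0.
exists ((K * ((B + 1) / (eta z / 8) ^+ 2)) `^ p^-1).
  by rewrite powR_gt0// mulr_gt0// divr_gt0// exprn_gt0.
move=> f w hf fB Qw; have h := Qrect_eta Qw.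
have Sw : 2 * (eta z / 8) < eta w.
  by apply: lt_le_trans h; move: e0; set x := eta z; move=> x0; lra.
have QD : Qset w (eta z / 8) `<=` D by move=> t /(Qrect_disc Sw).
have mD : measurable D by exact: measurable_disc.
rewrite -[leLHS](powRKV p0 (nc_ge0 _)); apply: powR_le; rewrite ?invr_ge0 ?(ltW p0) ?powR_ge0//.
apply: (HK f w (eta z / 8) (B + 1) hf S0 Sw B1).
apply: (@le_trans _ _ (wint p 0 f)); last by apply: le_trans fB _; rewrite lee_fin lerDl.
rewrite wint0E; apply: iint_subset => //; first exact: measurable_Qset.
  exact: (cmeas_powR p (holo_cmeas_nc hf)).
by move=> t _; exact: powR_ge0.
Qed.

(** Equicontinuity: [L] and [r] are chosen before [f], since the local bound and the Cauchy estimate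
    depend only on [B] and on the point. *)
Lemma local_lipschitz (p B : R) (z : C) : 0 < p -> 0 <= B -> disc z -> exists L r : R,
  [/\ 0 < L, 0 < r, forall h : C, nc h <= r -> disc (z + h) & forall (f : C -> C) h,
  holo f -> (wint p 0 f <= B%:E)%E -> nc h <= r -> nc (f (z + h) - f z) <= L * nc h].
Proof.
move=> p0 B0 zD; have [M M0 HM] := local_bound p0 B0 zD.
have e0 : 0 < eta z by rewrite eta_gt0.
have S0 : 0 < eta z / 8 by rewrite divr_gt0.
have Sw : 2 * (eta z / 8) < eta z by move: e0; set x := eta z; move=> x0; lra.
have r0 : 0 < eta z / 8 / 4 by rewrite divr_gt0.
exists (2 ^+ 17 * M / (eta z / 8)), (eta z / 8 / 4); split=> //.
- by rewrite divr_gt0// mulr_gt0// exprn_gt0.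
- move=> h hr; apply: (disc_nbhs zD); rewrite (_ : z + h - z = h) ?(addrC z h) ?addrK//.
  by apply: le_lt_trans hr _; move: e0; set x := eta z; move=> x0; lra.
move=> f h hf fB hr; apply: cauchy_lipschitz => //.
by move=> w Qw; exact: (HM f w hf fB Qw).
Qed.

(* The limit is taken pointwise along a free ultrafilter; a subsequence converging
   to it on the dyadic points converges everywhere by equicontinuity. *)
Lemma montel (p B : R) (fs : nat -> C -> C) : 0 < p -> 0 <= B -> (forall m, holo (fs m)) ->
  (forall m, (wint p 0 (fs m) <= B%:E)%E) -> exists (sigma : nat -> nat) (f : C -> C),
  [/\ {homo sigma : m k / (m < k)%N}, forall z, disc z ->
    clim (fun m => fs (sigma m) z) (f z) & holo f].
Proof.
move=> p0 B0 hfs fB; have [F [UF Foo]] := free_ultrafilter.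
have PF : ProperFilter F := ultra_proper.
have lim_ex (z : C) : exists l, disc z -> ulim F (fun m => fs m z) l.
  have [zD|nz] := pselect (disc z); last by exists 0.
  have [M M0 HM] := local_bound p0 B0 zD.
  have S0 : 0 < eta z / 8 by rewrite divr_gt0// eta_gt0.
  have [l Hl] := @ulim_ex R F UF (fun m => fs m z) M
    (fun m => HM (fs m) z (hfs m) (fB m) (Qrect_center z S0)).
  by exists l.
have [f Hf] := choice lim_ex.
(* One index beyond [N] serves the first k + 1 dyadic points at once, because finite intersections
   stay in the filter. *)
have step k N : exists m, (N < m)%N /\ forall j, (j <= k)%N -> disc (dyadic_point j) ->
    nc (fs m (dyadic_point j) - f (dyadic_point j)) <= k.+1%:R^-1.
  have H : F [set m | forall j, (j <= k)%N -> disc (dyadic_point j) ->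
      nc (fs m (dyadic_point j) - f (dyadic_point j)) <= k.+1%:R^-1].
    have k0 : 0 < k.+1%:R^-1 :> R by rewrite invr_gt0 ltr0n.
    elim: {1}k => [|i IH].
      have [d0|nd] := pselect (disc (dyadic_point 0)).
        by apply: filterS (Hf _ d0 _ k0) => m hm j; rewrite leqn0 => /eqP ->.
      by apply: filterS filterT => m _ j; rewrite leqn0 => /eqP ->.
    have [d0|nd] := pselect (disc (dyadic_point i.+1)).
      apply: filterS (filterI IH (Hf _ d0 _ k0)) => m [h1 h2] j.
      by rewrite leq_eqVlt ltnS => /orP[/eqP ->//|]; exact: h1.
    by apply: filterS IH => m h1 j; rewrite leq_eqVlt ltnS => /orP[/eqP ->//|]; exact: h1.
  have [m [h1 h2]] := filter_ex (filterI H (Foo N.+1)).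
  by exists m; split.
have [g Hg] := choice (fun x : nat * nat => step x.1 x.2).
pose sigma := fix sg k := if k is k'.+1 then g (k, sg k') else g (0%N, 0%N).
have sigmaS k : (sigma k < sigma k.+1)%N by have [] := Hg (k.+1, sigma k).
have sigmaP k j : (j <= k)%N -> disc (dyadic_point j) ->
    nc (fs (sigma k) (dyadic_point j) - f (dyadic_point j)) <= k.+1%:R^-1.
  by case: k => [|k]; [have [_] := Hg (0%N, 0%N)|have [_] := Hg (k.+1, sigma k)]; exact.
have conv z : disc z -> clim (fun m => fs (sigma m) z) (f z).
  move=> zD e e0; have [L [r [L0 r0 Dr Hr]]] := local_lipschitz p0 B0 zD.
  have e3 : 0 < e / 3 by rewrite divr_gt0.
  pose rho := Num.min r (e / 3 / L).
  have rho0 : 0 < rho by rewrite lt_min r0 divr_gt0.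
  have [j Hj] := dyadic_dense z rho0.
  set h := dyadic_point j - z in Hj.
  have hz : z + h = dyadic_point j by rewrite /h addrC subrK.
  have hr : nc h <= r by apply: le_trans Hj _; rewrite ge_min lexx.
  have hL : L * nc h <= e / 3.
    rewrite mulrC -ler_pdivlMr//; apply: le_trans Hj _; by rewrite ge_min lexx orbT.
  have D1 : disc (dyadic_point j) by rewrite -hz; exact: Dr.
  have H1 m : nc (fs m (dyadic_point j) - fs m z) <= e / 3.
    by rewrite -hz; apply: le_trans hL; exact: Hr (hfs m) (fB m) hr.
  have H2 : nc (f (dyadic_point j) - f z) <= e / 3.
    exact: (ulim_dist UF (Hf _ D1) (Hf _ zD) H1).
  exists (maxn j (Num.truncn (e / 3)^-1)) => k; rewrite geq_max => /andP[jk ek].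
  have H3 := sigmaP k j jk D1.
  have H4 : k.+1%:R^-1 <= e / 3.
    rewrite -[leRHS]invrK lef_pV2 ?posrE ?invr_gt0 ?ltr0n//.
    by apply: le_trans (ltW (truncnS_gt _)) _; rewrite ler_nat ltnS.
  have -> : fs (sigma k) z - f z = (fs (sigma k) (dyadic_point j) - f (dyadic_point j)) -
     (fs (sigma k) (dyadic_point j) - fs (sigma k) z) + (f (dyadic_point j) - f z) by ring.
  have -> : e = e / 3 + e / 3 + e / 3 by field.
  apply: le_trans (ncD _ _) _; apply: lerD H2.
  by apply: le_trans (ncB _ _) _; apply: lerD (H1 _); exact: le_trans H3 H4.
exists sigma, f; split=> //; first exact: homo_ltn ltn_trans sigmaS.
apply: holoP => z zD; have e0 : 0 < eta z by rewrite eta_gt0.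
have S0 : 0 < eta z / 8 by rewrite divr_gt0.
have Sw : 2 * (eta z / 8) < eta z by move: e0; set x := eta z; move=> x0; lra.
have [M M0 HM] := local_bound p0 B0 zD.
apply: (@bounded_limit_cdiff R (fun m => fs (sigma m)) f z (eta z / 8) M S0).
- by move=> m w /(Qrect_disc Sw) wD; exact: holo_cdiff_ex.
- by move=> m w Qw; exact: (HM (fs (sigma m)) w (hfs _) (fB _) Qw).
- by move=> w /(Qrect_disc Sw) wD; exact: conv.
Qed.

End Montel.

(** * Compactness as a condition on the unit ball *)

Section CompactOperators.
Variable R : realType.
Local Notation C := (R[i])^o.
Local Notation D := (Dset R).
Implicit Types (f g : C -> C) (T : (C -> C) -> C -> C).

Let mD : measurable D. Proof. exact: measurable_disc. Qed.
Let Dp t : D t -> 0 < eta (cpt t : C). Proof. by move=> Dt; rewrite eta_gt0; exact: Dt. Qed.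

Lemma clim_sub (u : nat -> C) l : clim u l -> clim (fun m => u m - l) 0.
Proof. by move=> H e /H[N HN]; exists N => n /HN; rewrite subr0. Qed.

(** Differentiability of the power gives continuity only away from 0, so the limit 0 is treated by
    hand. *)
Lemma clim_powR (p : R) (u : nat -> C) l : 0 < p -> clim u l ->
  (fun m => nc (u m) `^ p) @ \oo --> nc l `^ p.
Proof.
move=> p0 H; have Hl : (fun m => nc (u m)) @ \oo --> nc l.
  apply/cvgrPdist_le => e /H[N HN]; exists N => // n /HN.
  by apply: le_trans; rewrite ncBC; exact: lip_nc.
have [l0|l0] := ltP 0 (nc l).
  have cp : {for nc l, continuous (fun x : R => x `^ p)}.
    apply: differentiable_continuous; apply/derivable1_diffP.
    by have [] := is_derive1_powR p l0.
  exact: (@cvg_comp _ _ _ (fun m => nc (u m)) (fun x : R => x `^ p) _ _ _ Hl cp).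
have nl : nc l = 0 by apply/eqP; rewrite eq_le l0 nc_ge0.
rewrite nl powR0 ?lt0r_neq0//; apply/cvgrPdist_le => e e0.
have [N HN] := H _ (powR_gt0 p^-1 e0); exists N => // n /HN h.
rewrite sub0r normrN ger0_norm ?powR_ge0// -[leRHS](powRVK p0 (ltW e0)).
apply: powR_le; rewrite ?(ltW p0) ?nc_ge0//.
have l00 : l = 0 by apply/eqP; rewrite -nc_eq0 nl.
by move: h; rewrite l00 subr0.
Qed.

(** Fatou's lemma, since the convergence is only pointwise. *)
Lemma wint_limit_le (p B : R) (fs : nat -> C -> C) f : 0 < p -> (forall m, holo (fs m)) ->
  (forall m, (wint p 0 (fs m) <= B%:E)%E) -> (forall z, disc z -> clim (fun m => fs m z) (f z)) ->
  (wint p 0 f <= B%:E)%E.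
Proof.
move=> p0 hfs fB lim; rewrite wint0E.
pose F m (t : R * R) := (nc (fs m (cpt t)) `^ p)%:E.
have mF m : measurable_fun D (F m).
  by apply/measurable_EFinP; exact: (cmeas_powR p (holo_cmeas_nc (hfs m))).
have F0 m t : D t -> (0 <= F m t)%E by move=> _; rewrite lee_fin powR_ge0.
have := fatou (@leb2 R) mD mF F0.
have -> : (\int[@leb2 R]_(t in D) limn_einf (F^~ t) = iint D (fun z => nc (f z) `^ p)%R)%E.
  apply: eq_integral => t; rewrite inE => Dt.
  have : F^~ t @ \oo --> (nc (f (cpt t)) `^ p)%:E.
    by apply: cvg_EFin; [exact: nearW|exact: clim_powR (lim _ Dt)].
  by move=> /cvg_limn_einf_sup[].
move=> H; apply: le_trans H _; rewrite limn_einf_lim; apply: lime_le; first exact: is_cvg_einfs.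
apply: nearW => m; apply: le_trans (ereal_inf_lbound _) (fB m).
by exists m => //=; rewrite wint0E.
Qed.

(** The mean value inequality on the square of half-side eta(z)/4 loses a factor of order
    eta(z)^(-2). The weight exponent 2 compensates exactly this, so that constants are majorants on
    bounded sets of A^p. *)
Lemma wint_pointwise (p A : R) : 0 < p -> 0 <= A -> exists2 K : R, 0 < K & forall f z,
  holo f -> (wint p 0 f <= A%:E)%E -> disc z -> nc (f z) `^ p * eta z ^+ 2 <= K.
Proof.
move=> p0 A0; have [K K0 HK] := @submean R p p0; have A1 : 0 < A + 1 by rewrite ltr_wpDl.
exists (K * (A + 1) * 4 ^+ 2); first by rewrite !mulr_gt0// exprn_gt0.
move=> f z hf fA zD; have e0 : 0 < eta z by rewrite eta_gt0.
have S0 : 0 < eta z / 4 by rewrite divr_gt0.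
have Sz : 2 * (eta z / 4) < eta z by move: e0; set x := eta z; move=> x0; lra.
have QD : Qset z (eta z / 4) `<=` D by move=> t /(Qrect_disc Sz).
have HI : (iint (Qset z (eta z / 4)) (fun z => nc (f z) `^ p)%R <= (A + 1)%:E)%E.
  apply: (@le_trans _ _ (wint p 0 f)); last by apply: le_trans fA _; rewrite lee_fin lerDl.
  rewrite wint0E; apply: iint_subset => //; first exact: measurable_Qset.
    exact: (cmeas_powR p (holo_cmeas_nc hf)).
  by move=> t _; exact: powR_ge0.
have := HK f z _ _ hf S0 Sz A1 HI.
have -> : K * ((A + 1) / (eta z / 4) ^+ 2) = K * (A + 1) * 4 ^+ 2 / eta z ^+ 2.
  by field; rewrite lt0r_neq0.
by rewrite ler_pdivlMr// exprn_gt0.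
Qed.

(** Dominated convergence, with the constant of [wint_pointwise] as majorant on the disc, which has
    finite area. *)
Lemma wint2_limit (p B : R) (hs : nat -> C -> C) : 0 < p -> 0 <= B -> (forall m, holo (hs m)) ->
  (forall m, (wint p 0 (hs m) <= B%:E)%E) -> (forall z, disc z -> clim (fun m => hs m z) 0) ->
  forall d : R, 0 < d -> exists N, forall m, (N <= m)%N -> (wint p 2 (hs m) <= d%:E)%E.
Proof.
move=> p0 B0 hhs hB lim d d0; have [K K0 HK] := wint_pointwise p0 B0.
pose F m (t : R * R) := (nc (hs m (cpt t)) `^ p * eta (cpt t : C) ^+ 2)%:E.
have [] := @dominated_convergence _ _ R (@leb2 R) D mD F (cst 0) (cst K%:E).
- by move=> m; apply/measurable_EFinP; exact: cmeas_wint.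
- exact: measurable_cst.
- apply: aeW => t Dt; apply: cvg_EFin; first exact: nearW.
  have H := clim_powR p0 (lim _ Dt); rewrite nc0 powR0 ?lt0r_neq0// in H.
  have := cvgM H (cvg_cst (eta (cpt t : C) ^+ 2)); rewrite mul0r; exact.
- apply/integrableP; split; first exact: measurable_cst.
  under eq_integral do rewrite /cst abse_EFin.
  rewrite integral_cst//; apply: lte_mul_pinfty; rewrite ?lee_fin//.
  have H : (leb2 D <= leb2 (Qset (0%R : C) 1%R))%E.
    apply: le_measure; rewrite ?inE//; first exact: measurable_Qset.
    move=> t Dt; have t1 : nc (cpt t : C) < 1 := Dt.
    have hr := ltW (le_lt_trans (nc_Re _) t1); have hi := ltW (le_lt_trans (nc_Im _) t1).
    by split; rewrite /= ?add0r ?sub0r -ler_norml.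
  by apply: le_lt_trans H _; rewrite leb2_Qset ?ler01// ltry.
- apply: aeW => t m Dt; rewrite /F abse_EFin lee_fin ger0_norm; last first.
    by rewrite mulr_ge0 ?powR_ge0 ?exprn_ge0// ltW// Dp.
  exact: HK (hhs m) (hB m) Dt.
move=> _ _; rewrite integral0 => H.
have [N _ HN] := H _ (nbhs_open_ereal_lt (f := fun=> d) d0).
by exists N => m /HN /= /ltW.
Qed.

Lemma compact_extract (p B : R) (fs : nat -> C -> C) : 0 < p -> 0 <= B -> (forall m, holo (fs m)) ->
  (forall m, (wint p 0 (fs m) <= B%:E)%E) -> exists (sigma : nat -> nat) f,
  [/\ {homo sigma : m k / (m < k)%N}, holo f, (wint p 0 f <= B%:E)%E,
      (forall m, wint p 0 (fun z => fs (sigma m) z - f z)%R <= (2 `^ p * (B + B))%:E)%E &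
      forall d : R, 0 < d -> exists N, forall m, (N <= m)%N ->
        (wint p 2 (fun z => fs (sigma m) z - f z)%R <= d%:E)%E].
Proof.
move=> p0 B0 hfs fB; have [sigma [f [hs lim hf]]] := montel p0 B0 hfs fB.
have fB' : (wint p 0 f <= B%:E)%E.
  exact: (@wint_limit_le p B (fun m => fs (sigma m)) f p0 (fun m => hfs _) (fun m => fB _) lim).
have sB m : (wint p 0 (fun z => fs (sigma m) z - f z)%R <= (2 `^ p * (B + B))%:E)%E.
  apply: le_trans (wint_sub 0 p0 (hfs _) hf) _; rewrite EFinM.
  apply: lee_wpmul2l; first by rewrite lee_fin powR_ge0.
  rewrite EFinD; exact: leeD (fB _) fB'.
exists sigma, f; split; [exact: hs|exact: hf|exact: fB'|exact: sB|move=> d d0].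
have BB : 0 <= 2 `^ p * (B + B) by rewrite mulr_ge0 ?powR_ge0 ?addr_ge0.
apply: (@wint2_limit p _ (fun m z => fs (sigma m) z - f z) p0 BB _ sB _ d d0).
  by move=> m; exact: holoB (hfs _) hf.
by move=> z zD; exact: clim_sub (lim z zD).
Qed.

Lemma normA_le_wint (q e : R) f : 0 < q -> holo f -> 0 <= e ->
  (wint q 0 f <= (e `^ q)%:E)%E -> normA q f <= e.
Proof.
move=> q0 hf e0 H; have fin := wint_fin (le_lt_trans H (ltry _)).
rewrite -(powRKV q0 (normA_ge0 q f)) -[leRHS](powRKV q0 e0) normA_powR//.
have w0 : 0 <= fine (wint q 0 f) by rewrite fine_ge0// wint_ge0.
apply: powR_le; rewrite ?invr_ge0 ?(ltW q0) ?mulr_ge0 ?invr_ge0 ?pi_ge0//.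
move: H; rewrite -{1}(fineK fin) lee_fin => H; apply: le_trans H.
by rewrite ler_piMl// invf_le1 ?pi_gt0// pi_ge1.
Qed.

(** [compact_extract] yields differences that are bounded in [wint p 0] and tend to 0 in [wint p 2];
    on such functions the criterion, rescaled, makes the images small, so the images of the
    subsequence converge to [T f]. *)
Lemma compact_of_ball_compact (p q : R) T : 0 < p -> 0 < q -> admissible p T ->
  ball_compact p q T -> compact_op p q T.
Proof.
move=> p0 q0 aT cT; have [hT hZ hB _] := aT.
have bT := (bounded_opP p0 q0 aT).2 (ball_compact_bounded p0 aT cT).
split; first exact: bT.1.
move=> fs Afs [M HM].
have hfs m : holo (fs m) := (Afs m).1.
pose B := pi * (`|M| `^ p); have B0 : 0 <= B by rewrite mulr_ge0 ?pi_ge0 ?powR_ge0.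
have fB m : (wint p 0 (fs m) <= B%:E)%E.
  have [hf ff] := (wint_ltoo p (fs m)).1 (Afs m).
  rewrite -(fineK (wint_fin ff)) lee_fin /B -ler_pdivrMl ?pi_gt0// -normA_powR//.
  by apply: powR_le; [exact: ltW|exact: normA_ge0|exact: le_trans (HM m) (ler_norm _)].
have [sigma [f [hs hf f1 sB s2]]] := compact_extract p0 B0 hfs fB.
have Af : Ap p f by apply/wint_ltoo; split=> //; exact: le_lt_trans f1 (ltry _).
exists sigma, (T f); split; first exact: hs.
split; first exact: (bT.1 f Af).
apply/cvgrPdist_le => e e0.
have M0 : 0 < 2 `^ p * (B + B) + 1 by rewrite ltr_wpDl// mulr_ge0 ?powR_ge0 ?addr_ge0.
have [d d0 Hd] := ball_compact_scale p0 aT cT M0 (powR_gt0 q e0).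
have [N HN] := s2 d d0.
exists N => // m /= Nm; rewrite sub0r normrN ger0_norm ?normA_ge0//.
have hm := holoB (hfs (sigma m)) hf.
have hTm : holo (T (fs (sigma m)) \- T f) := holoB (hT _ (hfs (sigma m))) (hT _ hf).
apply: (normA_le_wint q0 hTm (ltW e0)).
have E z : disc z -> (T (fs (sigma m)) \- T f) z = T (fun z => fs (sigma m) z - f z) z.
  by move=> zD; rewrite (hB _ _ _ (hfs (sigma m)) hf zD).
rewrite (eq_wint q 0 E); apply: (Hd _ hm _ (HN m Nm)).
by apply: le_trans (sB m) _; rewrite lee_fin lerDl.
Qed.

(** By contradiction, from functions in the ball with [wint p 2] at most 1/(m+1) and images that are
    not small. Some subsequence of the images has a limit g in A^q. Continuity of the evaluations
    makes the images tend to 0 pointwise, and convergence in A^q makes them tend to g pointwise;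
    hence g = 0 in the disc and the images are small after all. *)
Lemma ball_compact_of_compact (p q : R) T : 0 < p -> 0 < q -> admissible p T ->
  compact_op p q T -> ball_compact p q T.
Proof.
move=> p0 q0 aT [maps cT]; have [hT _ _ ev] := aT; move=> e e0.
apply: contrapT => nH.
have bad (m : nat) : exists f, [/\ holo f, (wint p 0 f <= 1%:E)%E,
  (wint p 2 f <= (m.+1%:R^-1)%:E)%E &
    ~ (wint q 0 (T f) <= e%:E)%E].
  apply: contrapT => nb; apply: nH; exists m.+1%:R^-1; first by rewrite invr_gt0 ltr0n.
  by move=> f hf f1 f2; apply: contrapT => nf; apply: nb; exists f.
have [fs Hfs] := choice bad.
have hfs m : holo (fs m) by have [] := Hfs m.
have Afs m : Ap p (fs m).
  by have [hf f1 _ _] := Hfs m; apply/wint_ltoo; split=> //; exact: le_lt_trans f1 (ltry _).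
have [|sigma [g [hs [Ag lim]]]] := cT fs Afs.
  exists 1 => m; have [hf f1 _ _] := Hfs m.
  by apply: normA_le_wint; rewrite ?ler01// powR1.
have [hg _] := (wint_ltoo q g).1 Ag.
have sm m : (m <= sigma m)%N.
  elim: m => [//|m IH]; apply: leq_ltn_trans IH _; exact: hs.
have hTs m : holo (T (fs (sigma m)) \- g) := holoB (hT _ (hfs _)) hg.
have AT m : Ap q (T (fs (sigma m))) := maps _ (Afs _).
have fin m : (wint q 0 (T (fs (sigma m)) \- g)%R < +oo)%E.
  have [h1 h2] := (wint_ltoo q _).1 (AT m); have [_ h3] := (wint_ltoo q g).1 Ag.
  apply: le_lt_trans (wint_sub 0 q0 h1 hg) _; rewrite -(fineK (wint_fin h2)) -(fineK (wint_fin h3)).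
  by rewrite -EFinD -EFinM ltry.
have small (x : R) : 0 < x -> exists N, forall m, (N <= m)%N ->
  (wint q 0 (T (fs (sigma m)) \- g)%R <= x%:E)%E.
  move=> x0; pose y := (pi^-1 * x) `^ q^-1.
  have px : 0 < pi^-1 * x by rewrite mulr_gt0// invr_gt0 pi_gt0.
  have y0 : 0 < y by rewrite powR_gt0.
  have /cvgrPdist_le /(_ y y0) [N _ HN] := lim; exists N => m /HN /=.
  rewrite sub0r normrN ger0_norm ?normA_ge0// => /(powR_le (ltW q0) (normA_ge0 _ _)).
  rewrite (normA_powR q0 (hTs m)) powRVK ?(ltW px)// ler_pM2l ?invr_gt0 ?pi_gt0// => H.
  by rewrite -(fineK (wint_fin (fin m))) lee_fin.
have g0 z : disc z -> g z = 0.
  move=> zD; apply/eqP; rewrite -nc_eq0 eq_le nc_ge0 andbT.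
  apply/ler_addgt0Pr => x x0; rewrite add0r.
  have [K K0 HK] := ev z zD; have [K' K'0 HK'] := @eval_bound R q 0 z q0 zD.
  have dK (L s : R) : 0 < s -> 0 < L -> exists2 d : R, 0 < d & L * d `^ s^-1 <= x / 2.
    move=> s1 L0; exists ((x / 2 / L) `^ s); first by rewrite powR_gt0// !divr_gt0.
    by rewrite powRKV ?divr_ge0 ?(ltW x0) ?(ltW L0)// mulrC divfK ?lt0r_neq0.
  have [d d0 Hd] := dK K p p0 K0; have [d' d'0 Hd'] := dK K' q q0 K'0.
  have [N HN] := small d' d'0.
  pose m := maxn N (Num.truncn d^-1).
  have dm : (sigma m).+1%:R^-1 <= d.
    rewrite -[leRHS]invrK lef_pV2 ?posrE ?invr_gt0 ?ltr0n//.
    apply: le_trans (ltW (truncnS_gt _)) _; rewrite ler_nat ltnS.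
    by apply: leq_trans (sm m); rewrite leq_maxr.
  have [_ _ f2 _] := Hfs (sigma m).
  have h1 : nc (T (fs (sigma m)) z) <= x / 2.
    apply: le_trans (HK _ d (hfs _) (ltW d0) _) Hd.
    by apply: le_trans f2 _; rewrite lee_fin.
  have h2 : nc (T (fs (sigma m)) z - g z) <= x / 2.
    apply: le_trans (HK' _ d' (hTs m) (ltW d'0) _) Hd'.
    by apply: le_trans (wint2_le q (hTs m)) _; apply: HN; rewrite leq_maxl.
  have -> : g z = T (fs (sigma m)) z - (T (fs (sigma m)) z - g z) by ring.
  by apply: le_trans (ncB _ _) _; rewrite [x]splitr lerD.
have [N HN] := small e e0; have [_ _ _ nle] := Hfs (sigma N); apply: nle.
have E z : disc z -> T (fs (sigma N)) z = (T (fs (sigma N)) \- g) z.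
  by move=> zD /=; rewrite (g0 z zD) subr0.
by rewrite (eq_wint q 0 E); exact: (HN N (leqnn N)).
Qed.

Lemma compact_opP (p q : R) T : 0 < p -> 0 < q -> admissible p T ->
  compact_op p q T <-> ball_compact p q T.
Proof.
by move=> p0 q0 aT; split; [exact: ball_compact_of_compact|exact: compact_of_ball_compact].
Qed.

End CompactOperators.

(** * The sum of the operators against its terms, on the unit ball *)

Section OperatorSums.
Variable R : realType.
Local Notation C := (R[i])^o.
Local Notation D := (Dset R).
Implicit Types (f g u : C -> C).

Lemma derive1nB l f g z : holo f -> holo g -> disc z ->
  derive1n l (fun w => f w - g w) z = derive1n l f z - derive1n l g z.
Proof.
move=> hf hg zD; have hN := holoM (@holo_cst R (-1)) hg.
rewrite -[- derive1n l g z]mulN1r -(derive1nZ l (-1) hg zD) -(derive1nD l hf hN zD).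
by apply: (derive1n_disc l zD _ (holoD hf hN)) => w _; rewrite mulN1r.
Qed.

Variable phi : C -> C.
Hypotheses (hphi : holo phi) (mphi : forall z, disc z -> disc (phi z)).

Lemma admissible_Wop (p : R) u l : 0 < p -> holo u -> admissible p (Wop u phi l).
Proof.
move=> p0 hu; split.
- by move=> f hf; exact: holo_Wop hu (@hphi) (@mphi) hf.
- by move=> c f z hf zD; rewrite /Wop (derive1nZ l c hf (mphi zD)) mulrCA.
- by move=> f g z hf hg zD; rewrite /Wop (derive1nB l hf hg (mphi zD)) mulrBr.
move=> z zD; have [K K0 HK] := @eval_bound R p l (phi z) p0 (mphi zD).
exists ((nc (u z) + 1) * K); first by rewrite mulr_gt0// ltr_wpDl// nc_ge0.
move=> f d hf d0 fd; rewrite /Wop ncM -mulrA.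
apply: ler_pM; rewrite ?nc_ge0 ?lerDl//; exact: HK.
Qed.

Variables (n : nat) (us : 'I_n.+1 -> C -> C).
Hypothesis hus : forall k, holo (us k).

Lemma admissible_Lop (p : R) : 0 < p -> admissible p (Lop us phi).
Proof.
move=> p0; have aW (k : 'I_n.+1) := admissible_Wop k p0 (@hus k); split.
- by move=> f hf; exact: holo_Lop (@hus) (@hphi) (@mphi) hf.
- move=> c f z hf zD; rewrite /Lop mulr_sumr; apply: eq_bigr => k _.
  by have [_ H _ _] := aW k; exact: H.
- move=> f g z hf hg zD; rewrite /Lop -sumrB; apply: eq_bigr => k _.
  by have [_ _ H _] := aW k; exact: H.
move=> z zD; have ev (k : 'I_n.+1) : exists K : R, 0 < K /\ forall f (d : R),
    holo f -> 0 <= d -> (wint p 2 f <= d%:E)%E -> nc (Wop (us k) phi k f z) <= K * d `^ p^-1.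
  by have [_ _ _ /(_ z zD)[K K0 HK]] := aW k; exists K.
have [K HK] := choice ev.
exists (\sum_k K k).
  rewrite big_ord_recl ltr_pwDl//; first exact: (HK ord0).1.
  by apply: sumr_ge0 => k _; exact: ltW (HK _).1.
move=> f d hf d0 fd; apply: le_trans (nc_sum _ _ _) _; rewrite mulr_suml.
by apply: ler_sum => k _; exact: (HK k).2.
Qed.

Lemma wint_Lop_le (q e : R) f : 0 < q -> holo f ->
  (forall k : 'I_n.+1, (wint q 0 (Wop (us k) phi k f) <= e%:E)%E) ->
  (wint q 0 (Lop us phi f) <= (n.+1%:R `^ q * (n.+1%:R * e))%:E)%E.
Proof.
move=> q0 hf H; have hW k : holo (Wop (us k) phi k f) := holo_Wop (@hus k) (@hphi) (@mphi) hf.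
have hL : holo (Lop us phi f) := holo_Lop (@hus) (@hphi) (@mphi) hf.
have mD : measurable D by exact: measurable_disc.
have mW (k : 'I_n.+1) : cmeas D (fun z => nc (Wop (us k) phi k f z) `^ q).
  exact: cmeas_powR (holo_cmeas_nc (hW k)).
rewrite wint0E.
apply: (@le_trans _ _ (iint D (fun z => n.+1%:R `^ q * \sum_(k < n.+1) nc (Wop (us k) phi k f z)
  `^ q)%R)).
  apply: iint_le => //.
  - exact: cmeas_powR (holo_cmeas_nc hL).
  - by apply: cmeasM; [exact: cmeas_cst|apply: cmeas_sum => k _; exact: mW].
  - by move=> t _; exact: powR_ge0.
  move=> t _; have := @powR_sum_le_card R q 'I_n.+1 (fun k =>
    nc (Wop (us k) phi k f (cpt t))) q0 (fun k => nc_ge0 _).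
  rewrite card_ord; apply: le_trans; apply: powR_le; rewrite ?(ltW q0) ?nc_ge0//.
  exact: nc_sum.
rewrite iintZ ?powR_ge0//; last 2 first.
- by apply: cmeas_sum => k _; exact: mW.
- by move=> t _; apply: sumr_ge0 => k _; exact: powR_ge0.
rewrite iint_sum//; last by move=> k t _ _; exact: powR_ge0.
rewrite EFinM; apply: lee_wpmul2l; first by rewrite lee_fin powR_ge0.
apply: (@le_trans _ _ (\sum_(k < n.+1) e%:E)%E).
  by apply: lee_sum => k _; have := H k; rewrite wint0E.
by rewrite sumEFin lee_fin sumr_const card_ord mulr_natl.
Qed.

(** From the sum to a term by [transfer]: its test functions satisfy [wint p 0 F <= K] instead of 1,
    which homogeneity absorbs. The converse is the estimate of a finite sum. *)
Lemma ball_bounded_Lop (p q : R) : 0 < p -> 0 < q ->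
  ball_bounded p q (Lop us phi) <-> forall k : 'I_n.+1, ball_bounded p q (Wop (us k) phi k).
Proof.
move=> p0 q0; split=> [[c c0 Hc] l|H].
  have [K K0 HK] := @transfer R p q n l p0 q0.
  have Hs := ball_bounded_scale p0 (admissible_Lop p0) Hc.
  exists (K * (c * K `^ (q / p))); first by rewrite !mulr_gt0// powR_gt0.
  move=> f hf f1; have ff := le_lt_trans f1 (ltry _).
  apply: (HK us phi f _ (@hus) (@hphi) (@mphi) hf ff) => F hF F0 _; apply: (Hs F K hF K0).
  apply: le_trans F0 _; rewrite -[leRHS]mule1; apply: lee_wpmul2l f1.
  by rewrite lee_fin ltW.
have ev (k : 'I_n.+1) : exists c : R, 0 < c /\ forall f, holo f -> (wint p 0 f <= 1%:E)%E ->
    (wint q 0 (Wop (us k) phi k f) <= c%:E)%E.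
  by have [c c0 Hc] := H k; exists c.
(* The sum of the constants is a common upper bound. *)
have [c Hc] := choice ev; pose e := \sum_k c k.
have ce k : c k <= e.
  rewrite /e (bigD1 k)//= lerDl sumr_ge0// => i _; exact: ltW (Hc i).1.
have e0 : 0 < e := lt_le_trans (Hc ord0).1 (ce ord0).
exists (n.+1%:R `^ q * (n.+1%:R * e)); first by rewrite !mulr_gt0 ?powR_gt0.
move=> f hf f1; apply: (wint_Lop_le q0 hf) => k.
by apply: le_trans ((Hc k).2 f hf f1) _; rewrite lee_fin.
Qed.

(** Both bounds that [transfer] grants to F matter here: the first keeps F in a fixed ball, the
    second transmits the smallness of [wint p 2] from f to F, at the cost of the factor [K] in
    [d / K]. *)
Lemma ball_compact_Lop (p q : R) : 0 < p -> 0 < q ->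
  ball_compact p q (Lop us phi) <-> forall k : 'I_n.+1, ball_compact p q (Wop (us k) phi k).
Proof.
move=> p0 q0; split=> [H l e e0|H e e0].
  have [K K0 HK] := @transfer R p q n l p0 q0.
  have [d d0 Hd] := ball_compact_scale p0 (admissible_Lop p0) H K0 (divr_gt0 e0 K0).
  exists (d / K); first exact: divr_gt0.
  have K00 : (0%:E <= K%:E)%E by rewrite lee_fin ltW.
  move=> f hf f1 fd; have ff := le_lt_trans f1 (ltry _).
  have -> : e = K * (e / K) by rewrite mulrC divfK ?lt0r_neq0.
  apply: (HK us phi f _ (@hus) (@hphi) (@mphi) hf ff) => F hF F0 F2; apply: (Hd F hF).
    by apply: le_trans F0 _; rewrite -[leRHS]mule1; exact: lee_wpmul2l f1.
  apply: le_trans F2 _; have -> : d = K * (d / K) by rewrite mulrC divfK ?lt0r_neq0.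
  by rewrite EFinM; exact: lee_wpmul2l fd.
have N0 : 0 < n.+1%:R `^ q * n.+1%:R :> R by rewrite mulr_gt0 ?powR_gt0.
pose e' := e / (n.+1%:R `^ q * n.+1%:R).
have e'0 : 0 < e' by rewrite divr_gt0.
have ev (k : 'I_n.+1) : exists d : R, 0 < d /\ forall f, holo f -> (wint p 0 f <= 1%:E)%E ->
    (wint p 2 f <= d%:E)%E -> (wint q 0 (Wop (us k) phi k f) <= e'%:E)%E.
  by have [d d0 Hd] := H k e' e'0; exists d.
have [d Hd] := choice ev.
(* Summing inverses gives a positive number below every [d k]. *)
pose d' := (\sum_k (d k)^-1)^-1.
have dV i : 0 <= (d i)^-1 by rewrite invr_ge0 ltW// (Hd i).1.
have sV : 0 < \sum_k (d k)^-1.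
  by rewrite big_ord_recl ltr_pwDl// ?sumr_ge0// invr_gt0 (Hd ord0).1.
exists d'; first by rewrite invr_gt0.
have dd k : d' <= d k.
  rewrite /d' -[leRHS]invrK lef_pV2 ?posrE ?invr_gt0 ?(Hd k).1//.
  by rewrite (bigD1 k)//= lerDl sumr_ge0.
move=> f hf f1 f2; have -> : e = n.+1%:R `^ q * (n.+1%:R * e').
  by rewrite mulrA /e' mulrC divfK ?lt0r_neq0.
apply: (wint_Lop_le q0 hf) => k; apply: ((Hd k).2 f hf f1).
by apply: le_trans f2 _; rewrite lee_fin.
Qed.

End OperatorSums.

(** Admissibility of the sum and of each term translates both notions to the unit ball, where the
    sum and its terms have been compared. *)
Theorem theorem1p8 (R : realType) (p q : R) (n : nat)
  (us : 'I_n.+1 -> (R[i])^o -> (R[i])^o) (phi : (R[i])^o -> (R[i])^o) :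
  0 < p -> 0 < q -> (0 < n)%N ->
  (forall k, holo (us k)) ->
  holo phi -> (forall z, disc z -> disc (phi z)) ->
  (bounded_op p q (Lop us phi) <->
     (forall k : 'I_n.+1, bounded_op p q (Wop (us k) phi k))) /\
  (compact_op p q (Lop us phi) <->
     (forall k : 'I_n.+1, compact_op p q (Wop (us k) phi k))).
Proof.
move=> p0 q0 _ hus hphi mphi.
have aL := admissible_Lop hphi mphi hus p0.
have aW (k : 'I_n.+1) := admissible_Wop hphi mphi k p0 (hus k).
have bL := ball_bounded_Lop hphi mphi hus p0 q0.
have cL := ball_compact_Lop hphi mphi hus p0 q0.
split; split.
- move=> /(bounded_opP p0 q0 aL) /bL H k.
  exact: ((bounded_opP p0 q0 (aW k)).2 (H k)).
- move=> H; apply: ((bounded_opP p0 q0 aL).2 (bL.2 _)) => k.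
  exact: ((bounded_opP p0 q0 (aW k)).1 (H k)).
- move=> /(compact_opP p0 q0 aL) /cL H k.
  exact: ((compact_opP p0 q0 (aW k)).2 (H k)).
- move=> H; apply: ((compact_opP p0 q0 aL).2 (cL.2 _)) => k.
  exact: ((compact_opP p0 q0 (aW k)).1 (H k)).
Qed.
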